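(* Let $m\ge1$ be an integer, let $\alpha,\beta\in\mathbb{C}$ with $\beta^2=4\alpha$ and $0<|\beta|<2$, and let $\varphi(z)=\overline{z}^m+\alpha z^m+\beta$. Let $z_0\in\mathbb{C}$ satisfy $z_0^m=-\frac{\beta}{2\alpha}$, so that $\alpha z^{2m}+\beta z^m+1=\alpha(z^m-z_0^m)^2$, and define on $\mathbb{D}$ $$G_1(z)=\frac{z^{m-1}}{(\alpha z^{2m}+\beta z^m+1)^{3/2}}\,e^{\frac{\beta}{2\alpha}\frac{1}{z^m-z_0^m}},$$ $$h_1(z)=G_1(z),\qquad h_j(z)=-G_1(z)\int_0^z\frac{t^{j-2}}{t(\alpha t^{2m}+\beta t^m+1)G_1(t)}\,dt\quad(2\le j\le m).$$ Then $h_1,\dots,h_m$ are linearly independent and $\ker(T_\varphi)=\mathrm{Span}\{h_1,\dots,h_m\}$, where $T_\varphi$ is the Toeplitz operator on $L^2_a(\mathbb{D})$ with symbol $\varphi$.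
   Context: $\mathbb{D}$ is the open unit disk in $\mathbb{C}$ and $dA$ is the normalized Lebesgue area measure on $\mathbb{D}$. The Bergman space $L^2_a(\mathbb{D})$ is the closed subspace of analytic functions in $L^2(\mathbb{D},dA)$, and $P:L^2(\mathbb{D},dA)\to L^2_a(\mathbb{D})$ is the orthogonal projection. For $\varphi\in L^\infty(\mathbb{D},dA)$ the Toeplitz operator is $T_\varphi f=P(\varphi f)$ on $L^2_a(\mathbb{D})$. The power $(\alpha z^{2m}+\beta z^m+1)^{3/2}$ denotes a fixed holomorphic branch on $\mathbb{D}$; since $\alpha z^{2m}+\beta z^m+1=(1+\frac{\beta}{2}z^m)^2$ one may take $(1+\frac{\beta}{2}z^m)^3$. The integrand has a pole at $t=0$; its Laurent expansion at $0$ has the form $\sum_{k\ge0}a_kt^{\,j-2-m+km}$, which contains no $t^{-1}$ term for $2\le j\le m$, and $\int_0^z$ denotes termwise integration, i.e. $\int_0^z(\cdots)dt=\sum_{k\ge0}a_k\frac{z^{\,j-1-m+km}}{j-1-m+km}$. *)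

(* Defs.v *)
From HB Require Import structures.
From mathcomp Require Import all_boot all_order all_algebra.
From mathcomp Require Import all_classical all_reals all_analysis.

Set Implicit Arguments.
Unset Strict Implicit.
Unset Printing Implicit Defensive.

Import Order.TTheory GRing.Theory Num.Theory numFieldNormedType.Exports.
(* Required last: [Re] and [Im] are then the projections of [R[i]] onto [R]. *)
From mathcomp Require Import complex.

Local Open Scope classical_set_scope.
Local Open Scope complex_scope.
Local Open Scope ring_scope.

(* The field of complex numbers is [R[i]] for [R : realType]; its topology and
   its normed-module structure are found on the convertible type [R[i]^o]. *)

Section Bergman.
Context {R : realType}.
Implicit Types (z : R[i]) (p : R * R) (f g h k phi : R[i] -> R[i]).

Definition unit_disk : set R[i] := [set z | `|z| < 1].

Definition holomorphic_on_disk f : Prop :=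
  forall z, unit_disk z -> derivable (f : R[i]^o -> R[i]^o) z 1.

Definition plane_pt p : R[i] := p.1 +i* p.2.

Definition plane_disk : set (measurableTypeR R * measurableTypeR R) :=
  [set p | unit_disk (plane_pt p)].

Lemma invpi_ge0 : 0 <= (@pi R)^-1.
Proof. by rewrite invr_ge0 pi_ge0. Qed.

(* Normalized so that [plane_disk] has measure 1. *)
Definition area_measure :
    {measure set (measurableTypeR R * measurableTypeR R) -> \bar R} :=
  mscale (NngNum invpi_ge0) ((@lebesgue_measure R) \x (@lebesgue_measure R))%E.

Definition disk_integral g : R[i] :=
  Rintegral area_measure plane_disk (fun p => Re (g (plane_pt p))) +i*
  Rintegral area_measure plane_disk (fun p => Im (g (plane_pt p))).

Definition L2_disk f : Prop :=
  [/\ measurable_fun plane_disk (fun p => Re (f (plane_pt p))),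
      measurable_fun plane_disk (fun p => Im (f (plane_pt p))) &
      (\int[area_measure]_(p in plane_disk)
         (Re (f (plane_pt p)) ^+ 2 + Im (f (plane_pt p)) ^+ 2)%:E < +oo)%E].

(* Elements of the Bergman space are represented by functions on the whole
   plane of which only the values on the disk matter. *)
Definition bergman_space f : Prop := holomorphic_on_disk f /\ L2_disk f.

Definition inner f g : R[i] := disk_integral (fun z => f z * (g z)^*%C).

Definition is_bergman_projection g h : Prop :=
  bergman_space h /\
  forall k, bergman_space k -> inner (fun z => g z - h z) k = 0.

(* For [g] in L^2 of the disk, such an [h] exists and is unique on the disk.
   The default value of the choice is nonzero, so that the vanishing of the
   projection on the disk is never an artifact of that default. *)
Definition bergman_projection g : R[i] -> R[i] :=
  xget (fun=> 1) [set h | is_bergman_projection g h].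

Definition toeplitz phi f : R[i] -> R[i] :=
  bergman_projection (fun z => phi z * f z).

Definition toeplitz_kernel phi : set (R[i] -> R[i]) :=
  [set f | bergman_space f /\
           forall z, unit_disk z -> toeplitz phi f z = 0].

Definition span_on_disk n (h : 'I_n -> R[i] -> R[i]) : set (R[i] -> R[i]) :=
  [set f | exists c : 'I_n -> R[i],
           forall z, unit_disk z -> f z = \sum_(i < n) c i * h i z].

Definition lin_indep_on_disk n (h : 'I_n -> R[i] -> R[i]) : Prop :=
  forall c : 'I_n -> R[i],
    (forall z, unit_disk z -> \sum_(i < n) c i * h i z = 0) ->
    forall i, c i = 0.

End Bergman.

Section KernelFunctions.
Context {R : realType}.
Implicit Types (z t : R[i]) (f g : R[i] -> R[i]).

Definition cexp z : R[i] := (expR (Re z))%:C * (cos (Im z) +i* sin (Im z)).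

(* A holomorphic branch of [f ^ (3/2)] on the disk. *)
Definition branch_pow32 f g : Prop :=
  holomorphic_on_disk g /\ forall z, unit_disk z -> g z ^+ 2 = f z ^+ 3.

(* [g t = \sum_(k >= 0) a k * t ^ e k] on the punctured disk, where the
   exponents [e k] are integers, possibly negative. *)
Definition is_laurent (e : nat -> int) g (a : nat -> R[i]) : Prop :=
  forall t, unit_disk t -> t != 0 ->
    series (fun k => (a k * t ^ e k : R[i]^o)) @ \oo --> (g t : R[i]^o).

Definition laurent_coef (e : nat -> int) g : nat -> R[i] :=
  xget (fun=> 0) [set a | is_laurent e g a].

(* The integral from 0 to z of the Laurent expansion of [g], term by term;
   meaningful when [e k] is never -1. *)
Definition termwise_int (e : nat -> int) g z : R[i] :=
  lim (series (fun k =>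
    (laurent_coef e g k * (z ^ (e k + 1) / (e k + 1)%:~R) : R[i]^o)) @ \oo).

(* The function [F], with its singularity at 0 removed. *)
Definition extend0 (F : R[i] -> R[i]) z : R[i] :=
  if z == 0 then lim ((F : R[i]^o -> R[i]^o) @ (0 : R[i]^o)^') else F z.

Section Family.
Variables (m : nat) (alpha beta z0 : R[i]) (S : R[i] -> R[i]).

Definition symbol z : R[i] := z^*%C ^+ m + alpha * z ^+ m + beta.

Definition quad z : R[i] := alpha * z ^+ (2 * m) + beta * z ^+ m + 1.

(* [S] stands for [quad ^ (3/2)]. *)
Definition G1 z : R[i] :=
  z ^+ (m - 1) / S z * cexp (beta / (2 * alpha) * (1 / (z ^+ m - z0 ^+ m))).

Definition integrand (j : nat) t : R[i] :=
  t ^+ (j - 2) / (t * quad t * G1 t).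

Definition integrand_exp (j k : nat) : int :=
  j%:Z - 2 - m%:Z + k%:Z * m%:Z.

Definition hfun (j : nat) : R[i] -> R[i] :=
  if j == 1%N then G1
  else extend0 (fun z => - G1 z *
                  termwise_int (integrand_exp j) (integrand j) z).

End Family.
End KernelFunctions.

(* Main.v *)
Require Import Defs.
From HB Require Import structures.
From mathcomp Require Import all_boot all_order all_algebra.
From mathcomp Require Import all_classical all_reals all_analysis.
From mathcomp Require Import measurable_realfun ring lra.
Import Order.TTheory GRing.Theory Num.Theory numFieldNormedType.Exports.
From mathcomp Require Import complex.
Local Open Scope classical_set_scope.
Local Open Scope complex_scope.
Local Open Scope ring_scope.

(* Idea. Testing against monomials turns [T_phi f = 0] into a recurrence for
   the Taylor coefficients [a] of [f],
     [(n+1) a_(n+m) + (n+m+1) (beta a_n + alpha a_(n-m)) = 0],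
   whose solutions are determined by [a_0, ..., a_(m-1)]. Conversely the
   recurrence says that replacing [conj z ^ m] by [r^(-2m) conj z ^ m] in the
   symbol gives a function orthogonal to the Bergman space on the disk of radius
   [r]; letting [r] tend to 1 puts [f] in the kernel, with no estimate on [a].
   With [w = z^m] and [c = beta/2] one has [quad = (1 + c w)^2], and each [h_j]
   is a function holomorphic and bounded on the disk satisfying
   [(z quad h)' = m h - e z^(j-2)] with [e = 0] or [1]; comparing coefficients
   gives the recurrence, and the first [m] coefficients of [h_1, ..., h_m] form
   a triangular matrix.
   Taylor expansions of functions that are merely complex differentiable come
   from Goursat's theorem for rectangles, transported to circles by [exp]. *)

Set Implicit Arguments.
Unset Strict Implicit.
Unset Printing Implicit Defensive.

(** * Complex moduli and derivatives *)

(** The projection in [toeplitz] is selected by [xget], so the kernel condition is recast as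
    orthogonality of [symbol * f] to the Bergman space. On the disk of radius r the integral of
    [|z| ^ (2 q)] carries the factor [r ^ (2 q)]; in the pairing with [z ^ n] the term with
    [conj z ^ m] has an extra [r ^ (2 m)], which the weight [r ^ (-2 m)] removes. At r < 1 all
    series converge uniformly, and the passage to r = 1 rests on integrability of products of two
    L^2 functions. The moments of the disk come from Green's formula, carried out by Fubini along
    chords in place of polar coordinates. The condition |beta| < 2 says |c| < 1: then [1 + c w] has
    no zero on some disk of radius larger than 1, the integrated series is analytic there, and the
    h_j are bounded, hence in L^2. The branch [S] is [s (1 + c w)^3] with s = 1 or s = -1; the sign
    scales h_1 and cancels in the others. In the exponent, [beta / (2 alpha) = 1 / c] and
    [z^m - z_0^m = (1 + c w) / c], so G_1 contains [exp (1 / (1 + c w))]. *)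

Section ComplexModulus.
Context {R : realType}.
Implicit Types (z w : R[i]) (x y : R).

(** The norm on [R[i]] takes its values in [R[i]]; a modulus in [R] lets the tactics for real fields
    act on estimates. *)
Definition cabs z : R := Re `|z|.

Lemma cabsE z : `|z| = (cabs z)%:C.
Proof. by rewrite /cabs normc_def. Qed.

Lemma cabs_ge0 z : 0 <= cabs z.
Proof. by rewrite -ler0c -cabsE. Qed.

Lemma cabsM z w : cabs (z * w) = cabs z * cabs w.
Proof. by apply: complexI; rewrite rmorphM -!cabsE normrM. Qed.

Lemma cabs0 : cabs 0 = 0.
Proof. by rewrite /cabs normr0. Qed.

Lemma cabs1 : cabs 1 = 1.
Proof. by rewrite /cabs normr1. Qed.

Lemma cabsN z : cabs (- z) = cabs z.
Proof. by rewrite /cabs normrN. Qed.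

Lemma cabs_eq0 z : (cabs z == 0) = (z == 0).
Proof. by rewrite -(inj_eq (@complexI R)) -cabsE normr_eq0. Qed.

Lemma cabs_gt0 z : (0 < cabs z) = (z != 0).
Proof. by rewrite lt_def cabs_eq0 cabs_ge0 andbT. Qed.

Lemma cabsB z w : cabs (z - w) = cabs (w - z).
Proof. by rewrite -cabsN opprB. Qed.

Lemma cabsD z w : cabs (z + w) <= cabs z + cabs w.
Proof. by rewrite -lecR rmorphD -!cabsE ler_normD. Qed.

Lemma cabsDB z w : cabs (z - w) <= cabs z + cabs w.
Proof. by rewrite -(cabsN w) cabsD. Qed.

Lemma cabs_sub z w : cabs z - cabs w <= cabs (z - w).
Proof. by rewrite lerBlDr -{1}(subrK w z) cabsD. Qed.

Lemma cabsX z n : cabs (z ^+ n) = cabs z ^+ n.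
Proof. by apply: complexI; rewrite rmorphXn -!cabsE normrX. Qed.

Lemma cabsV z : cabs z^-1 = (cabs z)^-1.
Proof. by apply: complexI; rewrite fmorphV -!cabsE normfV. Qed.

Lemma cabs_real x : cabs x%:C = `|x|.
Proof. by rewrite /cabs normc_def /= expr0n addr0 sqrtr_sqr. Qed.

Lemma cabs_nat n : cabs n%:R = n%:R.
Proof. by rewrite -(rmorph_nat (real_complex R)) cabs_real ger0_norm. Qed.

Lemma cabs_i : cabs 'i = 1.
Proof. by rewrite /cabs normc_def /= expr0n add0r expr1n sqrtr1. Qed.

Lemma cabs_conj z : cabs z^*%C = cabs z.
Proof. by rewrite /cabs normcJ. Qed.

Lemma cabs_Re z : `|Re z| <= cabs z.
Proof. by rewrite -lecR -cabsE normc_ge_Re. Qed.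

Lemma cabs_Im z : `|Im z| <= cabs z.
Proof.
rewrite /cabs normc_def /= -sqrtr_sqr ler_sqrt ?lerDr ?sqr_ge0//.
by rewrite addr_ge0 ?sqr_ge0.
Qed.

Lemma cabs_sqr z : cabs z ^+ 2 = Re z ^+ 2 + Im z ^+ 2.
Proof. by rewrite /cabs normc_def /= sqr_sqrtr// addr_ge0 ?sqr_ge0. Qed.

Lemma cabs_ReIm z : cabs z <= `|Re z| + `|Im z|.
Proof.
rewrite -(@ler_pXn2r _ 2) ?nnegrE ?cabs_ge0 ?addr_ge0// cabs_sqr sqrrD.
by rewrite !real_normK ?num_real// lerD2r lerDl mulrn_wge0// mulr_ge0.
Qed.

Lemma cabs_sum (I : Type) (r : seq I) (P : pred I) (F : I -> R[i]) :
  cabs (\sum_(i <- r | P i) F i) <= \sum_(i <- r | P i) cabs (F i).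
Proof.
elim/big_ind2: _ => [|z x w y zx wy|//]; first by rewrite cabs0.
exact: le_trans (cabsD _ _) (lerD zx wy).
Qed.

Lemma mulJ_cabs z : z * z^*%C = (cabs z ^+ 2)%:C.
Proof. by rewrite -sqr_normc cabsE rmorphXn. Qed.

Lemma unit_diskE z : unit_disk z <-> cabs z < 1.
Proof. by rewrite /unit_disk /= cabsE -(rmorph1 (real_complex R)) ltcR. Qed.

(** A positive element of [R[i]] is real, so complex tolerances reduce to real ones. *)
Lemma cvg_cabsP (T : Type) (F : set_system T) (FF : Filter F) (u : T -> R[i])
    (l : R[i]) :
  ((u : T -> R[i]^o) @ F --> (l : R[i]^o)) <->
  (forall e : R, 0 < e -> \forall t \near F, cabs (l - u t) < e).
Proof.
rewrite (cvgrPdist_lt (V := R[i]^o)); split=> H e e0.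
  have := H e%:C; rewrite -(rmorph0 (real_complex R)) ltcR => /(_ e0).
  by apply: filterS => t; rewrite cabsE ltcR.
have eE : e = (Re e)%:C.
  by rewrite RRe_real// ger0_real// ltW.
have e0' : 0 < Re e by rewrite -ltcR -eE.
apply: filterS (H _ e0') => t; rewrite cabsE eE /= ltcR.
by [].
Qed.

Lemma nbhs_cabsP (z : R[i]) (A : set R[i]) :
  nbhs (z : R[i]^o) A <->
  (exists2 e : R, 0 < e & forall w, cabs (w - z) < e -> A w).
Proof.
split.
  move=> /nbhs_ballP[e /= e0 He].
  have eE : e = (Re e)%:C by rewrite RRe_real// ger0_real// ltW.
  have e0' : 0 < Re e by rewrite -ltcR -eE.
  exists (Re e) => // w wz; apply: He; rewrite -ball_normE /= distrC.
  by rewrite cabsE eE /= ltcR.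
move=> [e e0 He]; apply/nbhs_ballP; exists e%:C => /=.
  by rewrite -(rmorph0 (real_complex R)) ltcR.
move=> w; rewrite -ball_normE /= distrC cabsE ltcR; exact: He.
Qed.

End ComplexModulus.

Arguments cabs : simpl never.

Section ComplexDerivative.
Context {R : realType}.
Implicit Types (z w h d : R[i]) (f g : R[i] -> R[i]).

(** The scalars are [R[i]], so the derivative in direction 1 is the complex derivative, in the form
    used by [holomorphic_on_disk]. *)
Definition has_deriv f z d : Prop :=
  is_derive (z : R[i]^o) (1 : R[i]^o) (f : R[i]^o -> R[i]^o) (d : R[i]^o).

Lemma has_derivP f z d :
  has_deriv f z d <->
  (forall e : R, 0 < e -> exists2 delta : R, 0 < delta &
    forall h, cabs h < delta ->
      cabs (f (z + h) - f z - h * d) <= e * cabs h).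
Proof.
have key : has_deriv f z d <->
    ((fun h => h^-1 * (f (h + z) - f z) : R[i]^o) @ (0 : R[i]^o)^' --> (d : R[i]^o)).
  have E : (fun h : R[i]^o => h^-1 *:
      (((f : R[i]^o -> R[i]^o) \o shift (z : R[i]^o)) (h *: (1 : R[i]^o)) - f z))
      = (fun h => h^-1 * (f (h + z) - f z)).
    by apply/funext => h /=; rewrite /GRing.scale /= mulr1.
  split=> [[fd fE]|H].
    by move: fd; rewrite /derivable /cvg_to -fE /derive E.
  split; first by rewrite /derivable E; apply/cvg_ex; exists d.
  by rewrite /derive E; apply/cvg_lim.
rewrite key cvg_cabsP; split=> H e e0.
  have /nbhs_cabsP[delta delta0 Hd] := H _ e0.
  exists delta => // h hd; have [->|h0] := eqVneq h 0.
    by rewrite addr0 subrr mul0r subrr cabs0 mulr0.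
  have := Hd h; rewrite subr0 => /(_ hd h0) /ltW hb.
  have -> : f (z + h) - f z - h * d = (- h) * (d - h^-1 * (f (h + z) - f z)).
    by rewrite [h + z]addrC; field.
  by rewrite cabsM cabsN mulrC ler_wpM2r// cabs_ge0.
have e2 : 0 < e / 2 by rewrite divr_gt0.
have [delta delta0 Hd] := H _ e2.
apply/nbhs_cabsP; exists delta => // h.
rewrite subr0 => /Hd hb h0.
have -> : d - h^-1 * (f (h + z) - f z) = - h^-1 * (f (z + h) - f z - h * d).
  by rewrite [h + z]addrC; field.
rewrite cabsM cabsN cabsV mulrC ltr_pdivrMr ?cabs_gt0//.
apply: le_lt_trans hb _; rewrite ltr_pM2r ?cabs_gt0//.
by rewrite ltr_pdivrMr// ltr_pMr// ltr1n.
Qed.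

Lemma has_deriv_derivable f z d :
  has_deriv f z d -> derivable (f : R[i]^o -> R[i]^o) (z : R[i]^o) (1 : R[i]^o).
Proof. by case. Qed.

Lemma derivable_has_deriv f z :
  derivable (f : R[i]^o -> R[i]^o) (z : R[i]^o) (1 : R[i]^o) -> exists d, has_deriv f z d.
Proof. by move=> H; exists ('D_1 (f : R[i]^o -> R[i]^o) z); exact: derivableP. Qed.

Lemma has_deriv_unique f z d d' : has_deriv f z d -> has_deriv f z d' -> d = d'.
Proof. by move=> [_ <-] [_ <-]. Qed.

Lemma has_deriv_eq f z d d' : d = d' -> has_deriv f z d -> has_deriv f z d'.
Proof. by move->. Qed.

Lemma near_has_deriv f g z d (r : R) : 0 < r ->
  (forall w, cabs (w - z) < r -> f w = g w) -> has_deriv f z d -> has_deriv g z d.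
Proof.
move=> r0 fg /has_derivP H; apply/has_derivP => e /H[delta delta0 Hd].
exists (Num.min delta r); first by rewrite lt_min delta0.
move=> h; rewrite lt_min => /andP[hd hr].
by rewrite -!fg ?Hd// ?subrr ?cabs0// addrAC subrr add0r.
Qed.

Lemma has_deriv_cst (c : R[i]) z : has_deriv (fun=> c) z 0.
Proof. exact: is_derive_cst. Qed.

Lemma has_deriv_id z : has_deriv id z 1.
Proof. exact: is_derive_id. Qed.

Lemma has_derivD f g z df dg : has_deriv f z df -> has_deriv g z dg ->
  has_deriv (fun w => f w + g w) z (df + dg).
Proof. by move=> H1 H2; apply: is_deriveD. Qed.

Lemma has_derivN f z df : has_deriv f z df -> has_deriv (fun w => - f w) z (- df).
Proof. by move=> H1; apply: is_deriveN. Qed.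

Lemma has_derivB f g z df dg : has_deriv f z df -> has_deriv g z dg ->
  has_deriv (fun w => f w - g w) z (df - dg).
Proof. by move=> H1 H2; apply: has_derivD => //; exact: has_derivN. Qed.

Lemma has_derivM f g z df dg : has_deriv f z df -> has_deriv g z dg ->
  has_deriv (fun w => f w * g w) z (f z * dg + g z * df).
Proof. by move=> H1 H2; apply: is_deriveM. Qed.

Lemma has_derivZ (c : R[i]) f z df : has_deriv f z df ->
  has_deriv (fun w => c * f w) z (c * df).
Proof.
move=> H; have := has_derivM (has_deriv_cst c z) H.
by rewrite mulr0 addr0.
Qed.

Lemma has_derivX n z : has_deriv (fun w => w ^+ n) z (n%:R * z ^+ n.-1).
Proof.
split; first exact: exprn_derivable.
by rewrite exp_derive /GRing.scale /= mulr1.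
Qed.

Lemma has_derivV f z df : f z != 0 -> has_deriv f z df ->
  has_deriv (fun w => (f w)^-1) z (- df / f z ^+ 2).
Proof.
move=> fz [H1 H2]; split; first exact: derivableV.
by rewrite deriveV// H2 /GRing.scale /= !mulNr mulrC.
Qed.

Lemma has_deriv_comp f g z df dg : has_deriv f z df -> has_deriv g (f z) dg ->
  has_deriv (fun w => g (f w)) z (dg * df).
Proof.
move=> /has_derivP Hf /has_derivP Hg; apply/has_derivP => e e0.
have M0 : 0 < cabs df + 1 by rewrite ltr_wpDl ?cabs_ge0.
have [d1 d10 H1] := Hg (e / 2 / (cabs df + 1)) ltac:(by rewrite !divr_gt0).
have N0 : 0 < cabs dg + 1 by rewrite ltr_wpDl ?cabs_ge0.
(* The bound 1 keeps the increment of [f] below [cabs h * (cabs df + 1)]; the other one makes its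
   error, multiplied by [dg], cost at most half of [e]. *)
set e' := Num.min 1 (e / 2 / (cabs dg + 1)).
have e'0 : 0 < e' by rewrite lt_min ltr01 !divr_gt0.
have [d2 d20 H2] := Hf e' e'0.
exists (Num.min d2 (d1 / (cabs df + 1))); first by rewrite lt_min d20 divr_gt0.
move=> h; rewrite lt_min => /andP[hd2]; rewrite ltr_pdivlMr// => hd1.
have {}H2 := H2 h hd2.
set k := f (z + h) - f z in H2.
have kb : cabs k <= cabs h * (cabs df + 1).
  have -> : k = (k - h * df) + h * df by rewrite subrK.
  apply: le_trans (cabsD _ _) _; rewrite cabsM mulrDr mulr1 addrC lerD2l.
  by apply: le_trans H2 _; rewrite ler_piMl ?cabs_ge0// /e' ge_min lexx.
have fk : f (z + h) = f z + k by rewrite /k; ring.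
clearbody k.
have := H1 k (le_lt_trans kb hd1); rewrite -fk => {}H1.
have -> : g (f (z + h)) - g (f z) - h * (dg * df) =
   (g (f (z + h)) - g (f z) - k * dg) + dg * (k - h * df) by ring.
apply: le_trans (cabsD _ _) _; rewrite [e]splitr mulrDl lerD//.
  apply: le_trans H1 _.
  rewrite -[X in X <= _]mulrA ler_pM2l ?divr_gt0//.
  by rewrite ler_pdivrMl// mulrC.
rewrite cabsM; have : e' <= e / 2 / (cabs dg + 1) by rewrite ge_min lexx orbT.
rewrite ler_pdivlMr// => e'b.
apply: (@le_trans _ _ ((cabs dg + 1) * (e' * cabs h))).
  by rewrite ler_pM ?cabs_ge0// lerDl.
by rewrite mulrA ler_wpM2r ?cabs_ge0// mulrC.
Qed.

Lemma has_deriv_cont f z d : has_deriv f z d ->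
  forall e : R, 0 < e -> exists2 delta : R, 0 < delta &
    forall w, cabs (w - z) < delta -> cabs (f w - f z) < e.
Proof.
move=> /has_derivP/(_ 1 ltr01)[d1 d10 H] e e0.
have M0 : 0 < cabs d + 1 by rewrite ltr_wpDl ?cabs_ge0.
exists (Num.min d1 (e / (cabs d + 1))); first by rewrite lt_min d10 divr_gt0.
move=> w; rewrite lt_min => /andP[/H]; rewrite [z + _]addrC subrK mul1r => H1.
rewrite ltr_pdivlMr//; apply: le_lt_trans.
have -> : f w - f z = (f w - f z - (w - z) * d) + (w - z) * d by ring.
apply: le_trans (cabsD _ _) _; rewrite cabsM mulrDr mulr1 addrC lerD2l.
exact: H1.
Qed.

End ComplexDerivative.

(** * Series and power series *)

Section Series.
Context {R : realType}.
Implicit Types (z w l : R[i]) (u v a : nat -> R[i]) (q M e : R).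

Definition clim u l : Prop := forall e, 0 < e ->
  exists N0, forall n, (N0 <= n)%N -> cabs (l - u n) < e.

Definition has_sum u l : Prop := clim (fun N => \sum_(k < N) u k) l.

Lemma has_sumP u l :
  has_sum u l <-> (series (u : nat -> R[i]^o) @ \oo --> (l : R[i]^o)).
Proof.
rewrite cvg_cabsP; split=> H e /H.
  move=> [N0 HN]; exists N0 => // N /= NN; rewrite /series /= big_mkord.
  exact: HN.
move=> [N0 _ HN]; exists N0 => N NN; have := HN N NN.
by rewrite /series /= big_mkord.
Qed.

Lemma cabs_le_eps z (C : R) : (forall e, 0 < e -> cabs z <= C + e) -> cabs z <= C.
Proof. by move=> H; apply/ler_addgt0Pr. Qed.

Lemma cabs_eps0 z : (forall e, 0 < e -> cabs z <= e) -> z = 0.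
Proof.
move=> H; apply/eqP; rewrite -cabs_eq0 eq_le cabs_ge0 andbT.
by apply: cabs_le_eps => e /H; rewrite add0r.
Qed.

Lemma clim_unique u l l' : clim u l -> clim u l' -> l = l'.
Proof.
move=> H H'; apply/eqP; rewrite -subr_eq0; apply/eqP/cabs_eps0 => e e0.
have e2 : 0 < e / 2 by rewrite divr_gt0.
have [N HN] := H _ e2; have [N' HN'] := H' _ e2.
have := HN _ (leq_maxl N N'); have := HN' _ (leq_maxr N N').
move: (u _) => x h1 h2; have -> : l - l' = (l - x) - (l' - x) by ring.
by rewrite [e]splitr (le_trans (cabsDB _ _))// lerD// ltW.
Qed.

Lemma climD u v l l' : clim u l -> clim v l' -> clim (fun n => u n + v n) (l + l').
Proof.
move=> H H' e e0; have e2 : 0 < e / 2 by rewrite divr_gt0.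
have [N HN] := H _ e2; have [N' HN'] := H' _ e2.
exists (maxn N N') => n; rewrite geq_max => /andP[/HN h1 /HN' h2].
rewrite opprD addrACA [e]splitr.
by rewrite (le_lt_trans (cabsD _ _))// ltrD.
Qed.

Lemma has_sum_unique u l l' : has_sum u l -> has_sum u l' -> l = l'.
Proof. exact: clim_unique. Qed.

Lemma eq_has_sum u v l : u =1 v -> has_sum u l -> has_sum v l.
Proof. by move=> /funext ->. Qed.

Lemma has_sum0 : has_sum (fun=> 0) 0.
Proof. by move=> e e0; exists 0%N => N _; rewrite big1// subr0 cabs0. Qed.

Lemma has_sumD u v l l' : has_sum u l -> has_sum v l' ->
  has_sum (fun k => u k + v k) (l + l').
Proof.
move=> H H' e e0; have [N HN] := climD H H' e0.
by exists N => n /HN; rewrite big_split.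
Qed.

Lemma has_sumZ (c : R[i]) u l : has_sum u l -> has_sum (fun k => c * u k) (c * l).
Proof.
move=> H e e0; have c0 : 0 < cabs c + 1 by rewrite ltr_wpDl ?cabs_ge0.
have [|N HN] := H (e / (cabs c + 1)); first by rewrite divr_gt0.
exists N => n /HN; rewrite -mulr_sumr -mulrBr cabsM ltr_pdivlMr// => h.
apply: le_lt_trans h; rewrite mulrDr mulr1 mulrC lerDl; exact: cabs_ge0.
Qed.

Lemma has_sumB u v l l' : has_sum u l -> has_sum v l' ->
  has_sum (fun k => u k - v k) (l - l').
Proof.
move=> H H'; rewrite -[- l']mulN1r.
by apply: eq_has_sum (has_sumD H (has_sumZ (-1) H')) => k; rewrite mulN1r.
Qed.

Lemma has_sum_big n (u : 'I_n -> nat -> R[i]) (l : 'I_n -> R[i]) :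
  (forall i, has_sum (u i) (l i)) ->
  has_sum (fun k => \sum_(i < n) u i k) (\sum_(i < n) l i).
Proof.
elim: n u l => [|n IH] u l H.
  rewrite big_ord0; apply: eq_has_sum has_sum0 => k; by rewrite big_ord0.
rewrite big_ord_recr /=.
apply: eq_has_sum (has_sumD (IH _ _ (fun i => H (widen_ord (leqnSn n) i))) (H ord_max)).
by move=> k; rewrite big_ord_recr.
Qed.

Lemma has_sum_shift u l : has_sum u l <-> has_sum (fun k => u k.+1) (l - u 0%N).
Proof.
split=> H e /H[N HN].
  exists N => n Nn; have := HN n.+1 (leq_trans Nn (leqnSn n)).
  by rewrite big_ord_recl opprD addrA.
exists N.+1 => -[//|n] /HN; by rewrite big_ord_recl opprD addrA.
Qed.

Lemma has_sum_bounded u l : has_sum u l -> exists2 M, 0 <= M & forall n, cabs (u n) <= M.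
Proof.
move=> /(_ _ ltr01)[N HN].
exists (\sum_(k < N) cabs (u k) + 2); first by rewrite addr_ge0// sumr_ge0// => *; exact: cabs_ge0.
move=> n; have [nN|Nn] := ltnP n N.
  rewrite (bigD1 (Ordinal nN)) //= -addrA lerDl addr_ge0// sumr_ge0// => *; exact: cabs_ge0.
apply: (@le_trans _ _ 2); last by rewrite lerDr sumr_ge0// => *; exact: cabs_ge0.
have h1 := HN _ Nn; have h2 := HN _ (leq_trans Nn (leqnSn n)).
have -> : u n = (l - \sum_(k < n) u k) - (l - \sum_(k < n.+1) u k).
  by rewrite big_ord_recr /=; ring.
by rewrite (le_trans (cabsDB _ _))// (_ : 2 = 1 + 1)// lerD// ltW.
Qed.

Lemma geom_small q M e : 0 <= q < 1 -> 0 < e ->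
  exists N0, forall N, (N0 <= N)%N -> M * q ^+ N < e.
Proof.
move=> /andP[q0 q1] e0; have : `|q| < 1 by rewrite ger0_norm.
move=> /(cvg_geometric M)/cvgrPdist_lt/(_ _ e0)[N _ HN].
exists N => n /HN; rewrite /geometric /= sub0r normrN => h.
exact: le_lt_trans (ler_norm _) h.
Qed.

Lemma geom_sum_le q N : 0 <= q < 1 -> \sum_(k < N) q ^+ k <= (1 - q)^-1.
Proof.
move=> /andP[q0 q1]; rewrite -[leRHS]mul1r ler_pdivlMr ?subr_gt0//.
rewrite mulrC -opprB mulNr -subrX1 opprB lerBlDr lerDl exprn_ge0//.
Qed.

Lemma geom_tail_le u M q N n : 0 <= q < 1 -> (forall k, cabs (u k) <= M * q ^+ k) ->
  (N <= n)%N ->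
  cabs (\sum_(k < n) u k - \sum_(k < N) u k) <= M * q ^+ N / (1 - q).
Proof.
move=> q01 Hu /subnKC <-; rewrite big_split_ord /= addrAC subrr add0r.
apply: le_trans (cabs_sum _ _ _) _.
have M0 : 0 <= M by have := Hu 0%N; rewrite expr0 mulr1; exact: le_trans (cabs_ge0 _).
apply: le_trans (ler_wpM2l _ (geom_sum_le (n - N) q01)); last first.
  by rewrite mulr_ge0// exprn_ge0//; case/andP: q01.
rewrite mulr_sumr ler_sum// => i _.
by rewrite -mulrA -exprD Hu.
Qed.

Lemma has_sum_tail u M q l N : 0 <= q < 1 -> (forall k, cabs (u k) <= M * q ^+ k) ->
  has_sum u l -> cabs (l - \sum_(k < N) u k) <= M * q ^+ N / (1 - q).
Proof.
move=> q01 Hu Hl; apply: cabs_le_eps => e /Hl[N' HN].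
have := HN _ (leq_maxl N' N) => h1.
have h2 := geom_tail_le q01 Hu (leq_maxr N' N).
rewrite -[l](subrK (\sum_(k < maxn N' N) u k)) -addrA addrC.
by rewrite (le_trans (cabsD _ _))// lerD// ltW.
Qed.

Lemma has_sum_bound u M q l : 0 <= q < 1 -> (forall k, cabs (u k) <= M * q ^+ k) ->
  has_sum u l -> cabs l <= M / (1 - q).
Proof.
by move=> q01 Hu /(has_sum_tail 0 q01 Hu); rewrite big_ord0 subr0 expr0 mulr1.
Qed.

(** Completeness is applied to real and imaginary parts, each dominated by the geometric series. *)
Lemma geom_has_sum u M q : 0 <= q < 1 -> (forall k, cabs (u k) <= M * q ^+ k) ->
  exists l, has_sum u l.
Proof.
move=> q01 Hu.
have q1 : `|q| < 1 by case/andP: q01 => ? ?; rewrite ger0_norm.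
have M0 : 0 <= M by have := Hu 0%N; rewrite expr0 mulr1; exact: le_trans (cabs_ge0 _).
have cv (g : R[i] -> R) : (forall z, `|g z| <= cabs z) ->
    cvgn (series (fun k => g (u k))).
  move=> Hg; apply: normed_cvg.
  apply: (series_le_cvg _ _ _ (is_cvg_geometric_series (a := M) q1)) => n.
  - by rewrite /= normr_ge0.
  - by rewrite /geometric /= mulr_ge0// exprn_ge0//; case/andP: q01.
  - exact: le_trans (Hg _) (Hu n).
have /cvg_ex[x /cvgrPdist_lt Hx] := cv _ (@cabs_Re R).
have /cvg_ex[y /cvgrPdist_lt Hy] := cv _ (@cabs_Im R).
exists (x +i* y) => e e0; have e2 : 0 < e / 2 by rewrite divr_gt0.
have [N _ HN] := Hx _ e2; have [N' _ HN'] := Hy _ e2.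
exists (maxn N N') => n; rewrite geq_max => /andP[/HN h1 /HN' h2].
apply: le_lt_trans (cabs_ReIm _) _; rewrite [e]splitr ltrD//.
  move: h1; rewrite /series /= big_mkord.
  by rewrite raddfB /= -(raddf_sum (@Re R : {additive Rcomplex R -> R})).
move: h2; rewrite /series /= big_mkord.
by rewrite raddfB /= -(raddf_sum (@Im R : {additive Rcomplex R -> R})).
Qed.

End Series.

(** * Power series: uniform convergence, termwise derivative, uniqueness of coefficients *)

Section PowerSeries.
Context {R : realType}.
Implicit Types (z w l h : R[i]) (a b : nat -> R[i]) (f g : R[i] -> R[i])
  (r rho q M e : R).

(** Only pointwise convergence on the open disk is asked; geometric bounds are recovered from the
    boundedness of the terms at a radius between the point and [r]. *)
Definition pser a f r : Prop :=
  forall z, cabs z < r -> has_sum (fun n => a n * z ^+ n) (f z).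

Lemma eq_pser a b f g r : (forall n, a n = b n) ->
  (forall z, cabs z < r -> f z = g z) -> pser a f r -> pser b g r.
Proof.
move=> ab fg H z zr; rewrite -fg//.
by apply: eq_has_sum (H z zr) => n; rewrite ab.
Qed.

Lemma pserD a b f g r : pser a f r -> pser b g r ->
  pser (fun n => a n + b n) (fun z => f z + g z) r.
Proof.
move=> H H' z zr; apply: eq_has_sum (has_sumD (H z zr) (H' z zr)) => n.
by rewrite mulrDl.
Qed.

Lemma pserZ (c : R[i]) a f r : pser a f r ->
  pser (fun n => c * a n) (fun z => c * f z) r.
Proof.
move=> H z zr; apply: eq_has_sum (has_sumZ c (H z zr)) => n.
by rewrite mulrA.
Qed.

Lemma pserB a b f g r : pser a f r -> pser b g r ->
  pser (fun n => a n - b n) (fun z => f z - g z) r.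
Proof.
move=> H H' z zr; apply: eq_has_sum (has_sumB (H z zr) (H' z zr)) => n.
by rewrite mulrBl.
Qed.

Lemma pser_big n (a : 'I_n -> nat -> R[i]) (f : 'I_n -> R[i] -> R[i]) r :
  (forall i, pser (a i) (f i) r) ->
  pser (fun k => \sum_(i < n) a i k) (fun z => \sum_(i < n) f i z) r.
Proof.
move=> H z zr; apply: eq_has_sum (has_sum_big (fun i => H i z zr)) => k.
by rewrite mulr_suml.
Qed.

Lemma pser_shift a f r : pser a f r ->
  pser (fun n => if n is n'.+1 then a n' else 0) (fun z => z * f z) r.
Proof.
move=> H z zr; apply/has_sum_shift; rewrite mul0r subr0.
by apply: eq_has_sum (has_sumZ z (H z zr)) => n; rewrite exprS mulrCA.
Qed.

Lemma pser_Xn m a f r : pser a f r ->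
  pser (fun n => if (m <= n)%N then a (n - m)%N else 0) (fun z => z ^+ m * f z) r.
Proof.
move=> H; elim: m => [|m IH].
  by apply: eq_pser H => [n|z _]; rewrite ?subn0// expr0 mul1r.
apply: eq_pser (pser_shift IH) => [[//|n]|z _]; last by rewrite exprS mulrA.
by rewrite ltnS subSS.
Qed.

Lemma pser_monomial (c : R[i]) (l : nat) r :
  pser (fun n => if n == l then c else 0) (fun z => c * z ^+ l) r.
Proof.
move=> z zr e e0; exists l.+1 => N lN.
rewrite (bigD1 (Ordinal lN)) //= eqxx big1 ?addr0 ?subrr ?cabs0// => i.
by rewrite -val_eqE /= => /negPf ->; rewrite mul0r.
Qed.

Lemma pser_bounded a f r rho : pser a f r -> 0 < rho < r ->
  exists2 M, 0 <= M & forall n, cabs (a n) * rho ^+ n <= M.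
Proof.
move=> H /andP[r0 rr]; have crho : cabs rho%:C = rho by rewrite cabs_real gtr0_norm.
have [M M0 HM] := has_sum_bounded (H rho%:C ltac:(by rewrite crho)).
by exists M => // n; have := HM n; rewrite cabsM cabsX crho.
Qed.

(** Each of the n terms [q ^+ k] with k < n is at least [q ^+ n]. *)
Lemma nat_geom_bounded q n : 0 <= q < 1 -> n%:R * q ^+ n <= (1 - q)^-1.
Proof.
move=> q01; apply: le_trans (geom_sum_le n q01).
have -> : n%:R * q ^+ n = \sum_(k < n) q ^+ n.
  by rewrite sumr_const card_ord mulr_natl.
case/andP: q01 => q0 q1; rewrite ler_sum// => i _.
by rewrite ler_wiXn2l ?(ltW q1)// ltnW.
Qed.

(** Shrinking the radius pays for a factor [n]; used once per differentiation. *)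
Lemma coef_nat_bounded a r rho M : 0 < r < rho ->
  (forall n, cabs (a n) * rho ^+ n <= M) ->
  exists M', forall n, n%:R * cabs (a n) * r ^+ n <= M'.
Proof.
move=> /andP[r0 rrho] Ha; have rho0 : 0 < rho by exact: lt_trans rrho.
have q01 : 0 <= r / rho < 1 by rewrite divr_ge0 ?ltW//= ltr_pdivrMr// mul1r.
exists (M * (1 - r / rho)^-1) => n.
have -> : n%:R * cabs (a n) * r ^+ n =
    (cabs (a n) * rho ^+ n) * (n%:R * (r / rho) ^+ n).
  by rewrite expr_div_n; field; rewrite expf_neq0// gt_eqF.
apply: ler_pM; rewrite ?nat_geom_bounded ?Ha// mulr_ge0 ?cabs_ge0 ?exprn_ge0 ?divr_ge0 ?ler0n// ltW//.
Qed.

Lemma term_le a r rho M z n : 0 < rho -> (forall n, cabs (a n) * rho ^+ n <= M) ->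
  cabs z <= r -> cabs (a n * z ^+ n) <= M * (r / rho) ^+ n.
Proof.
move=> rho0 Ha zr; rewrite cabsM cabsX expr_div_n.
have -> : M * (r ^+ n / rho ^+ n) = (M / rho ^+ n) * r ^+ n by ring.
apply: ler_pM; rewrite ?cabs_ge0 ?exprn_ge0 ?cabs_ge0//.
  by rewrite ler_pdivlMr ?exprn_gt0.
by rewrite lerXn2r ?nnegrE ?cabs_ge0// (le_trans _ zr) ?cabs_ge0.
Qed.

Lemma pser_uniform a f r r' : pser a f r -> 0 < r' < r ->
  exists2 M, 0 <= M & exists2 q, 0 <= q < 1 &
   forall z N, cabs z <= r' -> cabs (f z - \sum_(k < N) a k * z ^+ k) <= M * q ^+ N.
Proof.
move=> H /andP[r0 rr]; set rho := (r' + r) / 2.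
have rhor : r' < rho by rewrite /rho midf_lt.
have rhor' : rho < r by rewrite /rho midf_lt.
have rho0 : 0 < rho by exact: lt_trans rhor.
have [|M M0 HM] := pser_bounded H (rho := rho); first by rewrite rho0.
have q01 : 0 <= r' / rho < 1 by rewrite divr_ge0 ?ltW//= ltr_pdivrMr// mul1r.
exists (M / (1 - r' / rho)).
  by rewrite divr_ge0// subr_ge0 ltW//; case/andP: q01.
exists (r' / rho) => // z N zr.
have := has_sum_tail N q01 (fun n => term_le n rho0 HM zr) (H z (le_lt_trans zr rr)).
by rewrite mulrAC.
Qed.

Lemma pser_exists a rho M : 0 < rho -> (forall n, cabs (a n) * rho ^+ n <= M) ->
  exists f, pser a f rho.
Proof.
move=> rho0 Ha.
have H z : exists l, cabs z < rho -> has_sum (fun n => a n * z ^+ n) l.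
  have [zr|zr] := ltP (cabs z) rho; last by exists 0.
  have q01 : 0 <= cabs z / rho < 1.
    by rewrite divr_ge0 ?cabs_ge0 ?ltW//= ltr_pdivrMr// mul1r.
  have [l Hl] := geom_has_sum q01 (fun n => term_le n rho0 Ha (lexx _)).
  by exists l.
by have [f Hf] := choice H; exists f.
Qed.

Definition deriv_coef a : nat -> R[i] := fun n => n.+1%:R * a n.+1.

(** The factor [r ^+ 2] on the left avoids the exponent n - 2, which would be truncated for small n.
    In the induction the remainder is multiplied by z and increased by
    [n%:R * w ^+ n.-1 * (z - w) ^+ 2], and n^2 + n is at most (n + 1)^2. *)
Lemma taylor2_le z w r n : cabs z <= r -> cabs w <= r ->
  r ^+ 2 * cabs (z ^+ n - w ^+ n - n%:R * w ^+ n.-1 * (z - w))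
    <= n%:R ^+ 2 * r ^+ n * cabs (z - w) ^+ 2.
Proof.
move=> zr wr; have r0 : 0 <= r by exact: le_trans (cabs_ge0 z) zr.
elim: n => [|n IH].
  by rewrite !expr0 !mul0r subrr subr0 cabs0 mulr0 expr0n /= !mul0r.
have -> : z ^+ n.+1 - w ^+ n.+1 - n.+1%:R * w ^+ n.+1.-1 * (z - w) =
   z * (z ^+ n - w ^+ n - n%:R * w ^+ n.-1 * (z - w)) +
   n%:R * w ^+ n.-1 * (z - w) ^+ 2.
  case: n {IH} => [|n] /=; first by rewrite !expr1 !expr0; ring.
  by rewrite -(natr1 n.+1) !exprS; ring.
apply: (@le_trans _ _ ((n%:R ^+ 2 + n%:R) * r ^+ n.+1 * cabs (z - w) ^+ 2)); last first.
  rewrite ler_wpM2r ?exprn_ge0 ?cabs_ge0// ler_wpM2r ?exprn_ge0//.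
  by rewrite -natr1; have := ler0n R n; nra.
apply: le_trans (ler_wpM2l (exprn_ge0 _ r0) (cabsD _ _)) _.
rewrite mulrDr 2!mulrDl lerD//.
  rewrite cabsM mulrCA.
  have -> : n%:R ^+ 2 * r ^+ n.+1 * cabs (z - w) ^+ 2 =
     r * (n%:R ^+ 2 * r ^+ n * cabs (z - w) ^+ 2) by rewrite [r ^+ n.+1]exprS; ring.
  by apply: ler_pM => //; rewrite ?cabs_ge0// mulr_ge0 ?exprn_ge0 ?cabs_ge0.
rewrite [X in _ * X <= _]cabsM cabsX [cabs (_%:R * _)]cabsM cabsX cabs_nat.
case: n {IH} => [|n] /=; first by rewrite !mul0r mulr0.
rewrite mulrA ler_wpM2r ?exprn_ge0 ?cabs_ge0// mulrCA.
rewrite ler_wpM2l// (_ : r ^+ n.+2 = r ^+ 2 * r ^+ n); last by rewrite -exprD.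
by rewrite ler_wpM2l ?exprn_ge0// lerXn2r ?nnegrE ?cabs_ge0.
Qed.

Lemma pser_deriv a f r : pser a f r ->
  exists2 f', pser (deriv_coef a) f' r & forall z, cabs z < r -> has_deriv f z (f' z).
Proof.
move=> H.
have ex w : exists l, cabs w < r ->
    has_sum (fun n => deriv_coef a n * w ^+ n) l /\ has_deriv f w l.
  have [wr|wr] := ltP (cabs w) r; last by exists 0.
  (* Four radii between [cabs w] and [r]: the coefficients are bounded at r4, passing to r3 and then
     to r2 absorbs one factor [n] each, and the disk of radius r1 contains [w + h], with geometric
     ratio r1 / r2. *)
  set r4 := (cabs w + r) / 2; set r3 := (cabs w + r4) / 2.
  set r2 := (cabs w + r3) / 2; set r1 := (cabs w + r2) / 2.
  have w0 := cabs_ge0 w.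
  have [h4 h4'] : cabs w < r4 /\ r4 < r by rewrite /r4 !midf_lt.
  have [h3 h3'] : cabs w < r3 /\ r3 < r4 by rewrite /r3 !midf_lt.
  have [h2 h2'] : cabs w < r2 /\ r2 < r3 by rewrite /r2 !midf_lt.
  have [h1 h1'] : cabs w < r1 /\ r1 < r2 by rewrite /r1 !midf_lt.
  have [p1 p2 p3 p4] : [/\ 0 < r1, 0 < r2, 0 < r3 & 0 < r4].
    by split; apply: le_lt_trans w0 _.
  clearbody r1 r2 r3 r4.
  have [|M M0 HM] := pser_bounded H (rho := r4); first by rewrite p4.
  have [|M1 HM1] := coef_nat_bounded _ HM (r := r3); first by rewrite p3.
  have HM1' n : cabs (n%:R * a n) * r3 ^+ n <= M1 by rewrite cabsM cabs_nat.
  have [|M2 HM2] := coef_nat_bounded _ HM1' (r := r2); first by rewrite p2.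
  have HM2' n : cabs (n%:R ^+ 2 * a n) * r2 ^+ n <= M2.
    by rewrite cabsM cabsX cabs_nat (le_trans _ (HM2 n))// cabsM cabs_nat expr2 !mulrA.
  have q01 : 0 <= r1 / r2 < 1 by rewrite divr_ge0 ?ltW//= ltr_pdivrMr// mul1r.
  have Hd n : cabs (deriv_coef a n) * r3 ^+ n <= M1 / r3.
    rewrite ler_pdivlMr// (le_trans _ (HM1' n.+1))//.
    by rewrite /deriv_coef exprSr mulrA.
  have [g Hg] := pser_exists p3 Hd.
  exists (g w) => _; split; first exact: Hg.
  apply/has_derivP => e e0.
  set C := M2 / (1 - r1 / r2) / r1 ^+ 2.
  have M20 : 0 <= M2.
    apply: le_trans (HM2' 0%N); by rewrite expr0 mulr1 cabs_ge0.
  have C0 : 0 <= C.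
    by case/andP: q01 => _ q1; rewrite /C !divr_ge0 ?exprn_ge0 ?subr_ge0// ltW.
  have C1 : 0 < C + 1 by rewrite ltr_wpDl.
  exists (Num.min (r1 - cabs w) (e / (C + 1))).
    by rewrite lt_min subr_gt0 h1 divr_gt0.
  move=> h; rewrite lt_min => /andP[hr hd].
  have whr : cabs (w + h) <= r1.
    by rewrite (le_trans (cabsD _ _))// addrC -lerBrDr ltW.
  have S1 : has_sum (fun n => a n * (w + h) ^+ n - a n * w ^+ n
                 - h * (n%:R * a n * w ^+ n.-1)) (f (w + h) - f w - h * g w).
    apply: has_sumB; first apply: has_sumB; try (apply: H => //).
      by apply: le_lt_trans whr _; rewrite (lt_trans h1')// (lt_trans h2')// (lt_trans h3').
    apply: has_sumZ; apply/has_sum_shift; rewrite !mul0r subr0.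
    exact: Hg.
  have hb n : cabs (a n * (w + h) ^+ n - a n * w ^+ n - h * (n%:R * a n * w ^+ n.-1))
     <= (M2 / r1 ^+ 2 * cabs h ^+ 2) * (r1 / r2) ^+ n.
    have -> : a n * (w + h) ^+ n - a n * w ^+ n - h * (n%:R * a n * w ^+ n.-1) =
        a n * ((w + h) ^+ n - w ^+ n - n%:R * w ^+ n.-1 * ((w + h) - w)) by ring.
    have := taylor2_le n whr (ltW h1).
    have -> : w + h - w = h by ring.
    set D := _ - _ - _ => HD.
    rewrite cabsM -(ler_pM2l (exprn_gt0 2 p1)).
    have -> : r1 ^+ 2 * (M2 / r1 ^+ 2 * cabs h ^+ 2 * (r1 / r2) ^+ n) =
        M2 / r2 ^+ n * (r1 ^+ n * cabs h ^+ 2).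
      by rewrite expr_div_n; field; rewrite expf_neq0 ?gt_eqF.
    rewrite mulrCA; apply: le_trans (ler_wpM2l (cabs_ge0 _) HD) _.
    have -> : cabs (a n) * (n%:R ^+ 2 * r1 ^+ n * cabs h ^+ 2) =
       (n%:R ^+ 2 * cabs (a n)) * (r1 ^+ n * cabs h ^+ 2) by ring.
    apply: ler_wpM2r; first by rewrite mulr_ge0 ?exprn_ge0 ?cabs_ge0 ?(ltW p1).
    rewrite ler_pdivlMr ?exprn_gt0// (le_trans _ (HM2' n))//.
    by rewrite cabsM cabsX cabs_nat.
  apply: le_trans (has_sum_bound q01 hb S1) _.
  have -> : M2 / r1 ^+ 2 * cabs h ^+ 2 / (1 - r1 / r2) = C * cabs h * cabs h.
    by rewrite /C; ring.
  rewrite ler_wpM2r ?cabs_ge0//.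
  move: hd; rewrite ltr_pdivlMr// => hd; apply: le_trans (ltW hd).
  by rewrite mulrC ler_wpM2l ?cabs_ge0// lerDl.
have [f' Hf'] := choice ex.
by exists f' => z zr; have [] := Hf' z zr.
Qed.

Lemma pser_deriv_eq a f f' r : pser a f r -> (forall z, cabs z < r -> has_deriv f z (f' z)) ->
  pser (deriv_coef a) f' r.
Proof.
move=> /pser_deriv[g Hg Dg] Df; apply: eq_pser Hg => // z zr.
exact: has_deriv_unique (Dg z zr) (Df z zr).
Qed.

(** The point 0 is excluded so that Laurent expansions on the punctured disk are covered. Once the
    coefficients below n vanish, division by [t ^+ n.+1] leaves [- (a n / t)] as the value of a
    power series that stays bounded as t tends to 0, so [a n] is at most a constant times t. *)
Lemma pser0_coef a r : 0 < r ->
  (forall z, z != 0 -> cabs z < r -> has_sum (fun n => a n * z ^+ n) 0) ->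
  forall n, a n = 0.
Proof.
move=> r0 H n; have [k] := ubnP n; elim: k n => // k IH n; rewrite ltnS => nk.
have {IH nk} Ha j : (j < n)%N -> a j = 0 by move=> jn; apply: IH; exact: leq_trans jn nk.
apply: cabs_eps0 => e e0.
set rho := r / 2; have rho0 : 0 < rho by rewrite divr_gt0.
have rr : rho < r by rewrite /rho ltr_pdivrMr// ltr_pMr// ltr1n.
clearbody rho.
have crho : cabs rho%:C = rho by rewrite cabs_real gtr0_norm.
have rn0 : (rho%:C : R[i]) != 0 by rewrite -cabs_gt0 crho.
have [M M0 HM] := has_sum_bounded (H rho%:C rn0 ltac:(by rewrite crho)).
have {}HM j : cabs (a j) * rho ^+ j <= M.
  by have := HM j; rewrite cabsM cabsX crho.
pose b j := a (j + n.+1)%N.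
have Hb j : cabs (b j) * rho ^+ j <= M / rho ^+ n.+1.
  by rewrite ler_pdivlMr ?exprn_gt0// -mulrA -exprD; exact: HM.
have M1 : 0 < 2 * M / rho ^+ n.+1 + 1.
  by rewrite ltr_wpDl// !mulr_ge0// invr_ge0 exprn_ge0// ltW.
(* The first bound makes the ratio [t / rho] at most 1/2, so the tail sums to at most twice its
   constant; the second brings the product with t below [e]. *)
set t := Num.min (rho / 2) (e / (2 * M / rho ^+ n.+1 + 1)).
have t0 : 0 < t by rewrite lt_min !divr_gt0.
have t2 : t <= rho / 2 by rewrite ge_min lexx.
have te : t <= e / (2 * M / rho ^+ n.+1 + 1) by rewrite ge_min lexx orbT.
have ct : cabs t%:C = t by rewrite cabs_real gtr0_norm.
have tn0 : (t%:C : R[i]) != 0 by rewrite -cabs_gt0 ct.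
have tr : t < r.
  by apply: le_lt_trans t2 _; rewrite (lt_trans _ rr)// ltr_pdivrMr// ltr_pMr// ltr1n.
have Ht := H t%:C tn0 ltac:(by rewrite ct).
have shiftn m : (forall j, (j < m)%N -> a j = 0) ->
   has_sum (fun j => a (j + m)%N * t%:C ^+ (j + m)) 0.
  elim: m => [|m IH] Hj.
    by apply: eq_has_sum Ht => j; rewrite addn0.
  have /has_sum_shift := IH (fun j jm => Hj j (leq_trans jm (leqnSn m))).
  rewrite add0n Hj// mul0r subr0; apply: eq_has_sum => j.
  by rewrite addSnnS.
have /has_sum_shift := shiftn n Ha; rewrite add0n sub0r => Hs.
have {}Hs : has_sum (fun j => b j * t%:C ^+ j) (- (a n / t%:C)).
  have := has_sumZ (t%:C ^- n.+1) Hs.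
  have -> : t%:C ^- n.+1 * - (a n * t%:C ^+ n) = - (a n / t%:C).
    by rewrite exprS; field; rewrite ?expf_neq0 ?tn0.
  apply: eq_has_sum => j; rewrite /b addSnnS exprD.
  by field; rewrite expf_neq0.
have q01 : 0 <= (1/2 : R) < 1 by apply/andP; split; lra.
have := has_sum_bound q01 (M := M / rho ^+ n.+1) _ Hs.
rewrite cabsN cabsM cabsV ct ler_pdivrMr// => hb.
apply: le_trans (hb _) _; last first.
  move: te; rewrite ler_pdivlMr// => te; apply: le_trans te.
  rewrite mulrC; apply: ler_wpM2l; first exact: ltW.
  have -> : M / rho ^+ n.+1 / (1 - 1 / 2) = 2 * M / rho ^+ n.+1.
    by field; rewrite gt_eqF ?exprn_gt0.
  by rewrite lerDl.
move=> j; have := term_le j rho0 Hb (z := t%:C) (r := t); rewrite ct lexx => /(_ isT) h.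
apply: le_trans h _; rewrite ler_wpM2l//.
  by rewrite mulr_ge0// invr_ge0 exprn_ge0// ltW.
have tr' : t / rho <= 1 / 2 by rewrite ler_pdivrMr//; lra.
rewrite lerXn2r// nnegrE; last by lra.
by rewrite divr_ge0 ?(ltW t0) ?(ltW rho0).
Qed.

Lemma pser_unique a b f r : 0 < r -> pser a f r -> pser b f r -> forall n, a n = b n.
Proof.
move=> r0 Ha Hb n; apply/eqP; rewrite -subr_eq0; apply/eqP.
apply: (pser0_coef (a := fun n => a n - b n) r0) => z _ zr.
by have := pserB Ha Hb zr; rewrite subrr.
Qed.

End PowerSeries.

(** * Complex-valued integrals *)

Section ReIm.
Context {R : realType}.
Implicit Types z w : R[i].
Lemma re_add z w : Re (z + w) = Re z + Re w. Proof. by case: z; case: w. Qed.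
Lemma im_add z w : Im (z + w) = Im z + Im w. Proof. by case: z; case: w. Qed.
Lemma re_opp z : Re (- z) = - Re z. Proof. by case: z. Qed.
Lemma im_opp z : Im (- z) = - Im z. Proof. by case: z. Qed.
Lemma re_mul z w : Re (z * w) = Re z * Re w - Im z * Im w.
Proof. by case: z; case: w. Qed.
Lemma im_mul z w : Im (z * w) = Re z * Im w + Im z * Re w.
Proof. by case: z; case: w. Qed.
Lemma re_conj z : Re z^*%C = Re z. Proof. by case: z. Qed.
Lemma im_conj z : Im z^*%C = - Im z. Proof. by case: z. Qed.
Lemma complex_ext z w : Re z = Re w -> Im z = Im w -> z = w.
Proof. by case: z => a b; case: w => c d /= -> ->. Qed.
End ReIm.

Section ComplexIntegral.
Context d {T : measurableType d} {R : realType}.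
Variable mu : {measure set T -> \bar R}.
Implicit Types (D : set T) (f g : T -> R[i]).

Definition cmeasurable D f : Prop :=
  measurable_fun D (fun x => Re (f x)) /\ measurable_fun D (fun x => Im (f x)).

Definition cintegrable D f : Prop :=
  mu.-integrable D (EFin \o (fun x => Re (f x))) /\
  mu.-integrable D (EFin \o (fun x => Im (f x))).

(** Componentwise, in the shape of [disk_integral], so that [inner] unfolds to it. *)
Definition cint D f : R[i] :=
  Rintegral mu D (fun x => Re (f x)) +i* Rintegral mu D (fun x => Im (f x)).

Lemma cmeasurable_cst D (c : R[i]) : cmeasurable D (fun=> c).
Proof. by split; exact: measurable_cst. Qed.

Lemma cmeasurableD D f g : cmeasurable D f -> cmeasurable D g ->
  cmeasurable D (fun x => f x + g x).
Proof.
move=> [f1 f2] [g1 g2]; split.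
  by under eq_fun do rewrite re_add; exact: measurable_funD.
by under eq_fun do rewrite im_add; exact: measurable_funD.
Qed.

Lemma cmeasurableM D f g : cmeasurable D f -> cmeasurable D g ->
  cmeasurable D (fun x => f x * g x).
Proof.
move=> [f1 f2] [g1 g2]; split.
  under eq_fun do rewrite re_mul.
  by apply: measurable_funB; apply: measurable_funM.
under eq_fun do rewrite im_mul.
by apply: measurable_funD; apply: measurable_funM.
Qed.

Lemma cmeasurableX D f n : cmeasurable D f -> cmeasurable D (fun x => f x ^+ n).
Proof.
move=> H; elim: n => [|n IH]; first exact: cmeasurable_cst.
under eq_fun do rewrite exprS; exact: cmeasurableM.
Qed.

Lemma cmeasurableJ D f : cmeasurable D f -> cmeasurable D (fun x => (f x)^*%C).
Proof.
move=> [f1 f2]; split; first by under eq_fun do rewrite re_conj.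
under eq_fun do rewrite im_conj; exact: measurable_funN.
Qed.

Lemma cmeasurable_sum D n (f : 'I_n -> T -> R[i]) :
  (forall i, cmeasurable D (f i)) -> cmeasurable D (fun x => \sum_(i < n) f i x).
Proof.
elim: n f => [|n IH] f H.
  by under eq_fun do rewrite big_ord0; exact: cmeasurable_cst.
under eq_fun do rewrite big_ord_recr /=.
apply: cmeasurableD; last exact: H.
by apply: IH => i; exact: H.
Qed.

Lemma eq_cint D f g : (forall x, D x -> f x = g x) -> cint D f = cint D g.
Proof.
by move=> fg; congr Complex; apply: eq_Rintegral => x /set_mem Dx; rewrite fg.
Qed.

Lemma cintegrable_dominated D f (g : T -> R) : measurable D -> cmeasurable D f ->
  (forall x, D x -> cabs (f x) <= g x) -> mu.-integrable D (EFin \o g) ->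
  cintegrable D f.
Proof.
move=> mD [f1 f2] fg ig; split.
  apply: le_integrable ig => //; first exact/measurable_EFinP.
  move=> x Dx /=; rewrite lee_fin (le_trans (cabs_Re _))// (le_trans (fg x Dx))//.
  exact: ler_norm.
apply: le_integrable ig => //; first exact/measurable_EFinP.
move=> x Dx /=; rewrite lee_fin (le_trans (cabs_Im _))// (le_trans (fg x Dx))//.
exact: ler_norm.
Qed.

Lemma cintegrable_bounded D f (M : R) : measurable D -> (mu D < +oo)%E ->
  cmeasurable D f -> (forall x, D x -> cabs (f x) <= M) -> cintegrable D f.
Proof.
move=> mD Doo mf fM; apply: (cintegrable_dominated (g := fun=> M)) => //.
apply: measurable_bounded_integrable => //.
by exists `|M|; split; [exact: num_real|move=> x Mx y _; exact: ltW].
Qed.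

Lemma cintegrable_cst D (c : R[i]) : measurable D -> (mu D < +oo)%E ->
  cintegrable D (fun=> c).
Proof.
by move=> mD Doo; apply: (cintegrable_bounded (M := cabs c)) => //; exact: cmeasurable_cst.
Qed.

Lemma cintegrableD D f g : measurable D -> cintegrable D f -> cintegrable D g ->
  cintegrable D (fun x => f x + g x).
Proof.
move=> mD [f1 f2] [g1 g2]; split.
  have := integrableD mD f1 g1; apply: eq_integrable => // x _ /=.
  by rewrite re_add EFinD.
have := integrableD mD f2 g2; apply: eq_integrable => // x _ /=.
by rewrite im_add EFinD.
Qed.

Lemma cintegrableZ D f (c : R[i]) : measurable D -> cintegrable D f ->
  cintegrable D (fun x => c * f x).
Proof.
move=> mD [f1 f2]; split.
  have := integrableB mD (integrableZl mD (Re c) f1) (integrableZl mD (Im c) f2).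
  by apply: eq_integrable => // x _ /=; rewrite re_mul EFinB !EFinM.
have := integrableD mD (integrableZl mD (Re c) f2) (integrableZl mD (Im c) f1).
by apply: eq_integrable => // x _ /=; rewrite im_mul EFinD !EFinM.
Qed.

Lemma cintegrableB D f g : measurable D -> cintegrable D f -> cintegrable D g ->
  cintegrable D (fun x => f x - g x).
Proof.
move=> mD If Ig; have := cintegrableD mD If (cintegrableZ (-1) mD Ig).
by congr cintegrable; apply/funext => x; rewrite mulN1r.
Qed.

Lemma cintD D f g : measurable D -> cintegrable D f -> cintegrable D g ->
  cint D (fun x => f x + g x) = cint D f + cint D g.
Proof.
move=> mD [f1 f2] [g1 g2]; apply: complex_ext => /=.
  by rewrite -RintegralD//; apply: eq_Rintegral => x _; rewrite re_add.
by rewrite -RintegralD//; apply: eq_Rintegral => x _; rewrite im_add.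
Qed.

Lemma cintZ D f (c : R[i]) : measurable D -> cintegrable D f ->
  cint D (fun x => c * f x) = c * cint D f.
Proof.
move=> mD [f1 f2]; have I1 (g : T -> R) (r : R) : mu.-integrable D (EFin \o g) ->
    mu.-integrable D (EFin \o (fun x => r * g x)).
  by move=> ig; have := integrableZl mD r ig; apply: eq_integrable.
apply: complex_ext; rewrite ?re_mul ?im_mul /=.
  rewrite -!RintegralZl// -RintegralB ?I1//.
  by apply: eq_Rintegral => x _; rewrite re_mul.
rewrite -!RintegralZl// -RintegralD ?I1//.
by apply: eq_Rintegral => x _; rewrite im_mul.
Qed.

Lemma cintB D f g : measurable D -> cintegrable D f -> cintegrable D g ->
  cint D (fun x => f x - g x) = cint D f - cint D g.
Proof.
move=> mD If Ig; rewrite -[- cint D g]mulN1r -cintZ// -cintD//; last exact: cintegrableZ.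
by apply: eq_cint => x _; rewrite mulN1r.
Qed.

Lemma cintegrable_sum D n (f : 'I_n -> T -> R[i]) : measurable D -> (mu D < +oo)%E ->
  (forall i, cintegrable D (f i)) -> cintegrable D (fun x => \sum_(i < n) f i x).
Proof.
move=> mD Doo; elim: n f => [|n IH] f H.
  by under eq_fun do rewrite big_ord0; exact: cintegrable_cst.
under eq_fun do rewrite big_ord_recr /=.
apply: cintegrableD => //; by apply: IH => i; exact: H.
Qed.

Lemma cint_cst D (c : R[i]) : measurable D -> cint D (fun=> c) = c * (fine (mu D))%:C.
Proof.
move=> mD; rewrite /cint !Rintegral_cst//; apply: complex_ext; rewrite ?re_mul ?im_mul /=.
  by rewrite mulr0 subr0.
by rewrite mulr0 add0r.
Qed.

Lemma cint_sum D n (f : 'I_n -> T -> R[i]) : measurable D -> (mu D < +oo)%E ->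
  (forall i, cintegrable D (f i)) ->
  cint D (fun x => \sum_(i < n) f i x) = \sum_(i < n) cint D (f i).
Proof.
move=> mD Doo; elim: n f => [|n IH] f H.
  under eq_fun do rewrite big_ord0.
  by rewrite big_ord0 cint_cst// mul0r.
under eq_fun do rewrite big_ord_recr /=.
rewrite cintD//; last by apply: cintegrable_sum.
by rewrite big_ord_recr /= IH.
Qed.

Lemma cintJ D f : measurable D -> cintegrable D f ->
  cint D (fun x => (f x)^*%C) = (cint D f)^*%C.
Proof.
move=> mD [f1 f2]; apply: complex_ext => /=.
  by apply: eq_Rintegral => x _; rewrite re_conj.
under eq_Rintegral do rewrite im_conj -mulN1r.
by rewrite RintegralZl// mulN1r.
Qed.

Lemma cintegrableJ D f : measurable D -> cintegrable D f ->
  cintegrable D (fun x => (f x)^*%C).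
Proof.
move=> mD [f1 f2]; split; first by under eq_fun do rewrite re_conj.
have := integrableZl mD (-1) f2; apply: eq_integrable => // x _ /=.
by rewrite im_conj -EFinM mulN1r.
Qed.

(** The factor 2 comes from estimating real and imaginary parts separately; the limit arguments
    below tolerate it. *)
Lemma cint_bound D f (M : R) : measurable D -> (mu D < +oo)%E -> cintegrable D f ->
  (forall x, D x -> cabs (f x) <= M) ->
  cabs (cint D f) <= 2 * (M * fine (mu D)).
Proof.
move=> mD Doo [f1 f2] fM.
have key (g : T -> R) : mu.-integrable D (EFin \o g) ->
    (forall x, D x -> `|g x| <= M) -> `|Rintegral mu D g| <= M * fine (mu D).
  move=> ig gM; apply: le_trans (le_normr_Rintegral mD ig) _.
  rewrite -Rintegral_cst//; apply: le_Rintegral => //.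
    exact: integrable_norm.
  apply: measurable_bounded_integrable => //.
  by exists `|M|; split; [exact: num_real|move=> x Mx y _; exact: ltW].
apply: le_trans (cabs_ReIm _) _; rewrite mulr_natl mulr2n lerD//.
  by apply: key => // x Dx; exact: le_trans (cabs_Re _) (fM x Dx).
by apply: key => // x Dx; exact: le_trans (cabs_Im _) (fM x Dx).
Qed.

Lemma cint_cvg D f (g : nat -> T -> R[i]) : measurable D -> (mu D < +oo)%E ->
  cintegrable D f -> (forall n, cintegrable D (g n)) ->
  (forall e : R, 0 < e -> exists N0, forall n, (N0 <= n)%N ->
     forall x, D x -> cabs (f x - g n x) <= e) ->
  forall e : R, 0 < e -> exists N0, forall n, (N0 <= n)%N ->
    cabs (cint D f - cint D (g n)) < e.
Proof.
move=> mD Doo If Ig H e e0.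
have m0 : 0 <= fine (mu D) by rewrite fine_ge0.
have c0 : 0 < 2 * fine (mu D) + 1 by rewrite ltr_wpDl// mulr_ge0.
have [|N HN] := H (e / (2 * fine (mu D) + 1)); first by rewrite divr_gt0.
exists N => n /HN fgn; rewrite -cintB//.
apply: le_lt_trans (cint_bound mD Doo (cintegrableB mD If (Ig n)) fgn) _.
rewrite mulrCA mulrAC ltr_pdivrMr// ltr_pM2l//.
by rewrite ltrDl.
Qed.

End ComplexIntegral.

(** * Goursat's theorem for rectangles *)

Section IntervalIntegral.
Context {R : realType}.
Implicit Types (a b c d s t e : R) (u v : R -> R[i]).

(** The point [s] is not confined to the interval: this is continuity of [u] itself at the points of
    the interval, which passes to subintervals at once. *)
Definition cont_on a b u : Prop := forall t, a <= t <= b ->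
  forall e, 0 < e -> exists2 delta, 0 < delta &
    forall s, `|s - t| < delta -> cabs (u s - u t) < e.

Definition iint a b u : R[i] := cint (@lebesgue_measure R) `[a, b] u.

Lemma cont_onS a b a' b' u : a <= a' -> b' <= b -> cont_on a b u -> cont_on a' b' u.
Proof.
move=> aa bb H t /andP[h1 h2]; apply: H.
by rewrite (le_trans aa h1) (le_trans h2 bb).
Qed.

Lemma cont_onD a b u v : cont_on a b u -> cont_on a b v ->
  cont_on a b (fun t => u t + v t).
Proof.
move=> Hu Hv t tab e e0; have e2 : 0 < e / 2 by rewrite divr_gt0.
have [d1 d10 H1] := Hu t tab _ e2; have [d2 d20 H2] := Hv t tab _ e2.
exists (Num.min d1 d2); first by rewrite lt_min d10.
move=> s; rewrite lt_min => /andP[/H1 h1 /H2 h2].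
by rewrite opprD addrACA [e]splitr (le_lt_trans (cabsD _ _))// ltrD.
Qed.

Lemma cont_onZ a b u (k : R[i]) : cont_on a b u -> cont_on a b (fun t => k * u t).
Proof.
move=> Hu t tab e e0; have k0 : 0 < cabs k + 1 by rewrite ltr_wpDl ?cabs_ge0.
have [|d1 d10 H1] := Hu t tab (e / (cabs k + 1)); first by rewrite divr_gt0.
exists d1 => // s /H1; rewrite -mulrBr cabsM ltr_pdivlMr// => h.
by apply: le_lt_trans h; rewrite mulrDr mulr1 mulrC lerDl cabs_ge0.
Qed.

Lemma cont_onB a b u v : cont_on a b u -> cont_on a b v ->
  cont_on a b (fun t => u t - v t).
Proof.
move=> Hu Hv; have := cont_onD Hu (cont_onZ (-1) Hv).
by congr cont_on; apply/funext => t; rewrite mulN1r.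
Qed.

Lemma cont_on_within a b u (g : R[i] -> R) :
  (forall z w, `|g z - g w| <= cabs (z - w)) -> cont_on a b u ->
  {within `[a, b], continuous (fun t => g (u t))}.
Proof.
move=> Hg Hu; apply: continuous_in_subspaceT => t.
rewrite inE /= in_itv /= => tab; apply/cvgrPdist_lt => e e0.
have [d0 d00 H] := Hu t tab _ e0; apply/nbhs_ballP; exists d0 => //= s.
rewrite /ball /= distrC => /H h; rewrite distrC; exact: le_lt_trans (Hg _ _) h.
Qed.

Lemma dist_Re (z w : R[i]) : `|Re z - Re w| <= cabs (z - w).
Proof. by rewrite -re_opp -re_add cabs_Re. Qed.

Lemma dist_Im (z w : R[i]) : `|Im z - Im w| <= cabs (z - w).
Proof. by rewrite -im_opp -im_add cabs_Im. Qed.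

Lemma dist_cabs (z w : R[i]) : `|cabs z - cabs w| <= cabs (z - w).
Proof.
rewrite ler_norml cabs_sub andbT lerNl opprB cabsB; exact: cabs_sub.
Qed.

Lemma cont_on_bounded a b u : cont_on a b u ->
  exists M, forall t, a <= t <= b -> cabs (u t) <= M.
Proof.
move=> Hu; have [ab|ba] := leP a b; last first.
  by exists 0 => t /andP[at_ tb]; have := le_trans at_ tb; rewrite leNgt ba.
have [c _ Hc] := EVT_max ab (cont_on_within dist_cabs Hu).
by exists (cabs (u c)) => t tab; apply: Hc; rewrite in_itv.
Qed.

Lemma cont_on_cintegrable a b u : cont_on a b u ->
  cintegrable (@lebesgue_measure R) `[a, b] u.
Proof.
move=> Hu; split; apply: continuous_compact_integrable; try exact: segment_compact.
  exact: (cont_on_within dist_Re).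
exact: (cont_on_within dist_Im).
Qed.

Lemma lebesgue_segment a b : a <= b ->
  (@lebesgue_measure R `[a, b]) = (b - a)%:E.
Proof.
move=> ab; rewrite lebesgue_measure_itv /= lte_fin.
have [//|ba] := ltP a b.
have -> : b = a by apply: le_anti; rewrite ba ab.
by rewrite subrr.
Qed.

Lemma iintB a b u v : cont_on a b u -> cont_on a b v ->
  iint a b (fun t => u t - v t) = iint a b u - iint a b v.
Proof. by move=> Hu Hv; rewrite /iint cintB//; exact: cont_on_cintegrable. Qed.

Lemma iintZ a b u (k : R[i]) : cont_on a b u ->
  iint a b (fun t => k * u t) = k * iint a b u.
Proof. by move=> Hu; rewrite /iint cintZ//; exact: cont_on_cintegrable. Qed.

Lemma cont_on_cst a b (k : R[i]) : cont_on a b (fun=> k).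
Proof. by move=> t _ e e0; exists 1 => // s _; rewrite subrr cabs0. Qed.

Lemma iint_cst a b (k : R[i]) : a <= b -> iint a b (fun=> k) = k * (b - a)%:C.
Proof. by move=> ab; rewrite /iint cint_cst//= lebesgue_segment. Qed.

Lemma eq_iint a b u v : (forall t, a <= t <= b -> u t = v t) -> iint a b u = iint a b v.
Proof. by move=> uv; apply: eq_cint => t /=; rewrite in_itv; exact: uv. Qed.

Lemma iint_bound a b u M : a <= b -> cont_on a b u ->
  (forall t, a <= t <= b -> cabs (u t) <= M) ->
  cabs (iint a b u) <= 2 * (M * (b - a)).
Proof.
move=> ab Hu HM.
have mab := lebesgue_segment ab.
have -> : M * (b - a) = M * fine (@lebesgue_measure R `[a, b]) by rewrite mab.
have mfin : (@lebesgue_measure R `[a, b] < +oo)%E by rewrite mab ltry.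
by apply: cint_bound => //; exact: cont_on_cintegrable.
Qed.

Lemma iint_near_cst a b u (k : R[i]) M : a <= b -> cont_on a b u ->
  (forall t, a <= t <= b -> cabs (u t - k) <= M) ->
  cabs (iint a b u - k * (b - a)%:C) <= 2 * (M * (b - a)).
Proof.
move=> ab Hu HM; rewrite -(iint_cst k ab) -iintB//; last exact: cont_on_cst.
by apply: iint_bound => //; apply: cont_onB => //; exact: cont_on_cst.
Qed.

Lemma iint_split a m b u : a <= m -> m <= b -> cont_on a b u ->
  iint a b u = iint a m u + iint m b u.
Proof.
move=> am mb Hu; have [I1 I2] := cont_on_cintegrable Hu.
have I3 (g : R -> R) : (@lebesgue_measure R).-integrable `[a, b] (EFin \o g) ->
    (@lebesgue_measure R).-integrable `]m, b] (EFin \o g).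
  apply: integrableS => //; apply: subset_itv => //; by rewrite bnd_simp.
apply: complex_ext; rewrite ?re_add ?im_add /=; apply/eqP;
  rewrite addrC -subr_eq; apply/eqP; rewrite Rintegral_itvB ?bnd_simp//;
  by rewrite Rintegral_itv_obnd_cbnd//; exact: I3.
Qed.

End IntervalIntegral.

Section Goursat.
Context {R : realType}.
Implicit Types (a b c d x y : R) (F : R[i] -> R[i]).

(** The contour integral of [F] counterclockwise along the boundary, with opposite sides merged:
    lower minus upper, plus i times right minus left. *)
Definition rect_int F a b c d : R[i] :=
  iint a b (fun x => F (x +i* c) - F (x +i* d)) +
  'i * iint c d (fun y => F (b +i* y) - F (a +i* y)).

Definition deriv_on_rect F a b c d : Prop :=
  forall x y, a <= x <= b -> c <= y <= d -> exists D, has_deriv F (x +i* y) D.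

Lemma deriv_on_rectS F a b c d a' b' c' d' : a <= a' -> b' <= b -> c <= c' -> d' <= d ->
  deriv_on_rect F a b c d -> deriv_on_rect F a' b' c' d'.
Proof.
move=> aa bb cc dd H x y /andP[h1 h2] /andP[h3 h4]; apply: H.
  by rewrite (le_trans aa h1) (le_trans h2 bb).
by rewrite (le_trans cc h3) (le_trans h4 dd).
Qed.

Lemma cont_on_hor F a b y :
  (forall x, a <= x <= b -> exists D, has_deriv F (x +i* y) D) ->
  cont_on a b (fun x => F (x +i* y)).
Proof.
move=> H x xab e e0; have [D HD] := H x xab.
have [d0 d00 Hd] := has_deriv_cont HD e0; exists d0 => // s sx; apply: Hd.
have -> : (s +i* y) - (x +i* y) = (s - x)%:C by apply: complex_ext; rewrite ?re_add ?im_add ?re_opp ?im_opp //= subrr.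
by rewrite cabs_real.
Qed.

Lemma cont_on_ver F c d x :
  (forall y, c <= y <= d -> exists D, has_deriv F (x +i* y) D) ->
  cont_on c d (fun y => F (x +i* y)).
Proof.
move=> H y ycd e e0; have [D HD] := H y ycd.
have [d0 d00 Hd] := has_deriv_cont HD e0; exists d0 => // s sx; apply: Hd.
have -> : (x +i* s) - (x +i* y) = 'i * (s - y)%:C.
  by apply: complex_ext; rewrite ?re_mul ?im_mul ?re_add ?im_add ?re_opp ?im_opp /=; ring.
by rewrite cabsM cabs_i mul1r cabs_real.
Qed.

Lemma rect_split_hor F a m b c d : a <= m -> m <= b -> c <= d ->
  deriv_on_rect F a b c d ->
  rect_int F a b c d = rect_int F a m c d + rect_int F m b c d.
Proof.
move=> am mb cd H; have ab := le_trans am mb.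
have hc y : c <= y <= d -> cont_on a b (fun x => F (x +i* y)).
  by move=> ycd; apply: cont_on_hor => x xab; exact: H.
have vc x : a <= x <= b -> cont_on c d (fun y => F (x +i* y)).
  by move=> xab; apply: cont_on_ver => y ycd; exact: H.
have h1 := hc _ (introT andP (conj (lexx c) cd)).
have h2 := hc _ (introT andP (conj cd (lexx d))).
have v1 := vc _ (introT andP (conj (lexx a) ab)).
have v2 := vc _ (introT andP (conj ab (lexx b))).
have v3 := vc _ (introT andP (conj am mb)).
have [h1a h1b] := (cont_onS (lexx a) mb h1, cont_onS am (lexx b) h1).
have [h2a h2b] := (cont_onS (lexx a) mb h2, cont_onS am (lexx b) h2).
rewrite /rect_int (iint_split am mb (cont_onB h1 h2)).
by rewrite !iintB//; ring.
Qed.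

Lemma rect_split_ver F a b c m d : a <= b -> c <= m -> m <= d ->
  deriv_on_rect F a b c d ->
  rect_int F a b c d = rect_int F a b c m + rect_int F a b m d.
Proof.
move=> ab cm md H; have cd := le_trans cm md.
have hc y : c <= y <= d -> cont_on a b (fun x => F (x +i* y)).
  by move=> ycd; apply: cont_on_hor => x xab; exact: H.
have vc x : a <= x <= b -> cont_on c d (fun y => F (x +i* y)).
  by move=> xab; apply: cont_on_ver => y ycd; exact: H.
have h1 := hc _ (introT andP (conj (lexx c) cd)).
have h2 := hc _ (introT andP (conj cd (lexx d))).
have h3 := hc _ (introT andP (conj cm md)).
have v1 := vc _ (introT andP (conj (lexx a) ab)).
have v2 := vc _ (introT andP (conj ab (lexx b))).
have [v1a v1b] := (cont_onS (lexx c) md v1, cont_onS cm (lexx d) v1).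
have [v2a v2b] := (cont_onS (lexx c) md v2, cont_onS cm (lexx d) v2).
rewrite /rect_int (iint_split cm md (cont_onB v2 v1)).
by rewrite !iintB//; ring.
Qed.

Lemma nested_point (x w : nat -> R) : (forall n, 0 <= w n) ->
  (forall n, x n <= x n.+1) -> (forall n, x n.+1 + w n.+1 <= x n + w n) ->
  exists l, forall n, x n <= l <= x n + w n.
Proof.
move=> w0 x1 x2.
have xmon n k : x n <= x (n + k)%N.
  by elim: k => [|k IH]; rewrite ?addn0// addnS (le_trans IH).
have xwmon n k : x (n + k)%N + w (n + k)%N <= x n + w n.
  by elim: k => [|k IH]; rewrite ?addn0// addnS (le_trans _ IH).
have cross n k : x k <= x n + w n.
  apply: le_trans (xmon k n) _; apply: le_trans (xwmon n k).
  by rewrite addnC lerDl.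
have hs n : ubound (range x) (x n + w n) by move=> _ [k _ <-].
exists (sup (range x)) => n; apply/andP; split.
  by apply: ub_le_sup; [exists (x 0%N + w 0%N)|exists n].
by apply: ge_sup => //; exists (x 0%N), 0%N.
Qed.

(** The affine part of [F] at the base point contributes [- 'i * (d - c) * D * (b - a)] along the
    horizontal sides and the opposite along the vertical ones. What remains is at most e times the
    half-perimeter; the 4 collects the factor 2 of [iint_bound] and the two sides of each
    difference. *)
Lemma rect_local_bound F a b c d x y (D : R[i]) (e delta : R) :
  a <= x <= b -> c <= y <= d -> deriv_on_rect F a b c d ->
  (b - a) + (d - c) < delta -> 0 <= e ->
  (forall h, cabs h < delta ->
     cabs (F ((x +i* y) + h) - F (x +i* y) - h * D) <= e * cabs h) ->
  cabs (rect_int F a b c d) <= 4 * e * ((b - a) + (d - c)) ^+ 2.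
Proof.
move=> /andP[ax xb] /andP[cy yd] HF sd e0 Hd.
have ab := le_trans ax xb; have cd := le_trans cy yd.
set s := (b - a) + (d - c).
pose rho z := F z - F (x +i* y) - (z - (x +i* y)) * D.
have Hrho s' t' : a <= s' <= b -> c <= t' <= d -> cabs (rho (s' +i* t')) <= e * s.
  move=> /andP[h1 h2] /andP[h3 h4].
  have hb : cabs ((s' +i* t') - (x +i* y)) <= s.
    apply: le_trans (cabs_ReIm _) _; rewrite re_add im_add re_opp im_opp /= lerD//.
      by rewrite ler_norml; apply/andP; split; lra.
    by rewrite ler_norml; apply/andP; split; lra.
  have := Hd _ (le_lt_trans hb sd); rewrite [(x +i* y) + _]addrC subrK => h.
  by apply: le_trans h _; rewrite ler_wpM2l.
have Frho z : F z = F (x +i* y) + (z - (x +i* y)) * D + rho z by rewrite /rho; ring.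
have hc y' : c <= y' <= d -> cont_on a b (fun x => F (x +i* y')).
  by move=> ycd; apply: cont_on_hor => x' xab; exact: HF.
have vc x' : a <= x' <= b -> cont_on c d (fun y => F (x' +i* y)).
  by move=> xab; apply: cont_on_ver => y' ycd; exact: HF.
have [cc dd] : c <= c <= d /\ c <= d <= d by rewrite !lexx cd.
have [aa bb] : a <= a <= b /\ a <= b <= b by rewrite !lexx ab.
have e2 : e * s + e * s = 2 * e * s by ring.
have E1 := iint_near_cst (k := - ('i * (d - c)%:C * D)) (M := 2 * e * s) ab
  (cont_onB (hc _ cc) (hc _ dd)).
have E2 := iint_near_cst (k := (b - a)%:C * D) (M := 2 * e * s) cd
  (cont_onB (vc _ bb) (vc _ aa)).
rewrite /rect_int.
set I1 := iint a b _ in E1 *; set I2 := iint c d _ in E2 *.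
have -> : I1 + 'i * I2 = (I1 - - ('i * (d - c)%:C * D) * (b - a)%:C) +
   'i * (I2 - (b - a)%:C * D * (d - c)%:C) by ring.
apply: (@le_trans _ _ (2 * (2 * e * s * (b - a)) + 2 * (2 * e * s * (d - c)))); last first.
  by rewrite le_eqVlt; apply/orP; left; apply/eqP; rewrite /s; ring.
apply: le_trans (cabsD _ _) _; rewrite cabsM cabs_i mul1r; apply: lerD.
  apply: E1 => t tab; rewrite (Frho (t +i* c)) (Frho (t +i* d)).
  have -> : F (x +i* y) + ((t +i* c) - (x +i* y)) * D + rho (t +i* c) -
    (F (x +i* y) + ((t +i* d) - (x +i* y)) * D + rho (t +i* d)) -
    - ('i * (d - c)%:C * D) = rho (t +i* c) - rho (t +i* d) +
     ((t +i* c) - (t +i* d) + 'i * (d - c)%:C) * D by ring.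
  have -> : (t +i* c) - (t +i* d) + 'i * (d - c)%:C = 0.
    by apply: complex_ext; rewrite !(re_add, im_add, re_opp, im_opp, re_mul, im_mul) /=; ring.
  rewrite mul0r addr0 -e2; apply: le_trans (cabsDB _ _) _.
  by apply: lerD; apply: Hrho.
apply: E2 => t tab; rewrite (Frho (b +i* t)) (Frho (a +i* t)).
have -> : F (x +i* y) + ((b +i* t) - (x +i* y)) * D + rho (b +i* t) -
    (F (x +i* y) + ((a +i* t) - (x +i* y)) * D + rho (a +i* t)) -
    (b - a)%:C * D = rho (b +i* t) - rho (a +i* t) +
     ((b +i* t) - (a +i* t) - (b - a)%:C) * D by ring.
have -> : (b +i* t) - (a +i* t) - (b - a)%:C = 0.
  by apply: complex_ext; rewrite !(re_add, im_add, re_opp, im_opp, re_mul, im_mul) /=; ring.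
rewrite mul0r addr0 -e2; apply: le_trans (cabsDB _ _) _.
by apply: lerD; apply: Hrho.
Qed.

Lemma half_segment a b x x' (w W : R) : 0 <= w -> W = w + w -> a <= x -> x + W <= b ->
  x' = x \/ x' = x + w -> [/\ a <= x', x' + w <= b, x <= x' & x' + w <= x + W].
Proof. by move=> w0 -> ax xb [->|->]; split; lra. Qed.

(** Goursat's bisection: a nonzero integral is inherited, up to the factor 1/4, by one of the four
    quarters, and the quadratic local bound at the common point contradicts this. *)
Lemma goursat F a b c d : a <= b -> c <= d -> deriv_on_rect F a b c d ->
  rect_int F a b c d = 0.
Proof.
move=> ab cd HF; apply/eqP; rewrite -cabs_eq0; apply/negP => /negP eta_n0.
set eta := cabs _ in eta_n0.
have eta0 : 0 < eta by rewrite lt_def eta_n0 cabs_ge0.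
pose W n : R := (b - a) / 2 ^+ n; pose H n : R := (d - c) / 2 ^+ n.
have W0 n : 0 <= W n by rewrite /W divr_ge0 ?exprn_ge0 ?subr_ge0.
have H0 n : 0 <= H n by rewrite /H divr_ge0 ?exprn_ge0 ?subr_ge0.
have WS n : W n = W n.+1 + W n.+1 by rewrite /W exprS; field; rewrite expf_neq0.
have HS n : H n = H n.+1 + H n.+1 by rewrite /H exprS; field; rewrite expf_neq0.
pose In n (p : R * R) :=
  [/\ a <= p.1, p.1 + W n <= b, c <= p.2 & p.2 + H n <= d].
pose Bad n (p : R * R) := In n p /\
  eta / 4 ^+ n <= cabs (rect_int F p.1 (p.1 + W n) p.2 (p.2 + H n)).
(* Stated for every pair, with [Bad] as a premise, so that [choice] returns a total successor
   function on lower left corners. *)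
have step (np : nat * (R * R)) : exists p' : R * R, Bad np.1 np.2 ->
   [/\ Bad np.1.+1 p', np.2.1 <= p'.1, p'.1 + W np.1.+1 <= np.2.1 + W np.1,
       np.2.2 <= p'.2 & p'.2 + H np.1.+1 <= np.2.2 + H np.1].
  case: np => n [x y] /=; have [B|nB] := pselect (Bad n (x, y)); last by exists (0, 0).
  case: B => -[/= i1 i2 i3 i4] B.
  have w0 := W0 n.+1; have h0 := H0 n.+1; have ws := WS n; have hs := HS n.
  set w := W n.+1 in w0 ws *; set h := H n.+1 in h0 hs *.
  have HF' : deriv_on_rect F x (x + W n) y (y + H n) by apply: deriv_on_rectS HF.
  have q : rect_int F x (x + W n) y (y + H n) =
     rect_int F x (x + w) y (y + h) + rect_int F x (x + w) (y + h) (y + h + h) +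
     (rect_int F (x + w) (x + w + w) y (y + h) +
      rect_int F (x + w) (x + w + w) (y + h) (y + h + h)).
    have {}HF' : deriv_on_rect F x (x + w + w) y (y + h + h).
      by move: HF'; rewrite ws hs !addrA.
    have [w1 w2] : x <= x + w /\ x + w <= x + w + w by rewrite !lerDl.
    have [h1 h2] : y <= y + h /\ y + h <= y + h + h by rewrite !lerDl.
    have HF1 : deriv_on_rect F x (x + w) y (y + h + h) by apply: deriv_on_rectS HF'.
    have HF2 : deriv_on_rect F (x + w) (x + w + w) y (y + h + h).
      by apply: deriv_on_rectS HF'.
    rewrite ws hs [x + (w + w)]addrA [y + (h + h)]addrA (rect_split_hor w1 w2 (le_trans h1 h2) HF').
    by rewrite (rect_split_ver w1 h1 h2 HF1) (rect_split_ver w2 h1 h2 HF2).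
  have e4 : eta / 4 ^+ n = eta / 4 ^+ n.+1 + eta / 4 ^+ n.+1 +
      (eta / 4 ^+ n.+1 + eta / 4 ^+ n.+1).
    by rewrite exprS; field; rewrite expf_neq0.
  have : exists p' : R * R, [/\ (p'.1 = x \/ p'.1 = x + w), (p'.2 = y \/ p'.2 = y + h)
     & eta / 4 ^+ n.+1 <= cabs (rect_int F p'.1 (p'.1 + w) p'.2 (p'.2 + h))].
    (* If all four quarters were below [eta / 4 ^+ n.+1], the whole would be below
       [eta / 4 ^+ n]. *)
    apply: contrapT => nex.
    have lt p1 p2 : (p1 = x \/ p1 = x + w) -> (p2 = y \/ p2 = y + h) ->
      cabs (rect_int F p1 (p1 + w) p2 (p2 + h)) < eta / 4 ^+ n.+1.
      move=> h1 h2; rewrite ltNge; apply/negP => h3; apply: nex.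
      by exists (p1, p2).
    move: B; rewrite leNgt => /negP; apply; rewrite q e4.
    apply: le_lt_trans (cabsD _ _) _; apply: ltrD; apply: le_lt_trans (cabsD _ _) _;
      apply: ltrD; apply: lt; by [left|right].
  move=> [[x' y'] /= [hx hy hB]]; exists (x', y') => _ /=.
  have [k1 k2 k3 k4] := half_segment w0 ws i1 i2 hx.
  by have [l1 l2 l3 l4] := half_segment h0 hs i3 i4 hy.
have [nxt Hnxt] := choice step.
pose s := fix s n := if n is n'.+1 then nxt (n', s n') else (a, c).
have Bs n : Bad n (s n).
  elim: n => [|n IH]; last by have [] := Hnxt (n, s n) IH.
  rewrite /Bad /In /W /H /= !expr0 !divr1 lexx; split.
    by split => //; lra.
  by rewrite [a + _]addrC subrK [c + _]addrC subrK.
have [x Hx] := nested_point (x := fun n => (s n).1) W0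
  (fun n => let: And5 _ h _ _ _ := Hnxt (n, s n) (Bs n) in h)
  (fun n => let: And5 _ _ h _ _ := Hnxt (n, s n) (Bs n) in h).
have [y Hy] := nested_point (x := fun n => (s n).2) H0
  (fun n => let: And5 _ _ _ h _ := Hnxt (n, s n) (Bs n) in h)
  (fun n => let: And5 _ _ _ _ h := Hnxt (n, s n) (Bs n) in h).
have [D HD] : exists D, has_deriv F (x +i* y) D.
  have [[i1 i2 i3 i4] _] := Bs 0%N; apply: HF.
    by have /andP[] := Hx 0%N; move=> h1 h2; apply/andP; split; lra.
  by have /andP[] := Hy 0%N; move=> h1 h2; apply/andP; split; lra.
set S := (b - a) + (d - c).
have S0 : 0 <= S by rewrite /S addr_ge0 ?subr_ge0.
(* Then [4 * e * S ^+ 2] is less than half of [eta]; the summand 1 covers degenerate rectangles with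
   S = 0. *)
set e := eta / (8 * (S ^+ 2 + 1)).
have S1 : 0 < S ^+ 2 + 1 by rewrite ltr_wpDl ?exprn_ge0.
have e0 : 0 < e by rewrite divr_gt0 ?mulr_gt0.
have /has_derivP/(_ _ e0)[delta delta0 Hd] := HD.
have [|N HN] := geom_small (q := 1 / 2) S _ delta0; first by apply/andP; split; lra.
have [[i1 i2 i3 i4] B] := Bs N.
have WH : W N + H N = S / 2 ^+ N by rewrite /W /H /S; ring.
have := @rect_local_bound F (s N).1 ((s N).1 + W N) (s N).2 ((s N).2 + H N) x y D e delta
  (Hx N) (Hy N) (deriv_on_rectS i1 i2 i3 i4 HF) _ (ltW e0) Hd.
have -> : (s N).1 + W N - (s N).1 + ((s N).2 + H N - (s N).2) = S / 2 ^+ N.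
  by rewrite -WH; ring.
have -> : S / 2 ^+ N < delta by have := HN N (leqnn N); rewrite expr_div_n expr1n mul1r.
move=> /(_ isT) /(le_trans B); apply/negP; rewrite -ltNge.
have -> : 4 * e * (S / 2 ^+ N) ^+ 2 = (4 * e * S ^+ 2) / 4 ^+ N.
  have -> : (4 : R) = 2 ^+ 2 by rewrite expr2; ring.
  rewrite -exprM mulnC exprM; field; rewrite expf_neq0//; exact: expf_neq0.
rewrite ltr_pM2r ?invr_gt0 ?exprn_gt0// /e.
have -> : 4 * (eta / (8 * (S ^+ 2 + 1))) * S ^+ 2 = eta * (S ^+ 2 / (2 * (S ^+ 2 + 1))).
  by field; rewrite gt_eqF.
rewrite gtr_pMr// ltr_pdivrMr ?mulr_gt0// mul1r.
have : 0 <= S ^+ 2 by rewrite exprn_ge0.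
lra.
Qed.

End Goursat.

(** * Cauchy's theorem and Taylor expansions *)

Section ComplexExponential.
Context {R : realType}.
Implicit Types (z w h : R[i]) (x y e : R).

Lemma real_derivP (f : R -> R) x (d : R) : is_derive x 1 f d ->
  forall e, 0 < e -> exists2 delta : R, 0 < delta &
    forall h : R, `|h| < delta -> `|f (x + h) - f x - h * d| <= e * `|h|.
Proof.
move=> [fd fE] e e0.
have E : (fun h : R => h^-1 *: ((f \o shift x) (h *: (1 : R)) - f x))
      = (fun h : R => h^-1 * (f (h + x) - f x)).
  by apply/funext => h /=; rewrite /GRing.scale /= mulr1.
move: fd; rewrite /derivable /cvg_to -/(derive f x 1) fE E.
move=> /cvgrPdist_lt/(_ _ e0)/nbhs_ballP[delta /= delta0 Hd].
exists delta => // h hd; have [->|h0] := eqVneq h 0.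
  by rewrite addr0 subrr mul0r subrr normr0 mulr0.
have /ltW hb : `|d - h^-1 * (f (h + x) - f x)| < e.
  by apply: Hd => //; rewrite /ball /= sub0r normrN.
have -> : f (x + h) - f x - h * d = (- h) * (d - h^-1 * (f (h + x) - f x)).
  by rewrite [h + x]addrC; field.
by rewrite normrM normrN mulrC ler_wpM2r.
Qed.

Lemma cexpD z w : cexp (z + w) = cexp z * cexp w.
Proof.
rewrite /cexp re_add im_add expRD cosD sinD.
by apply: complex_ext; rewrite !(re_mul, im_mul) /=; ring.
Qed.

Lemma cexp0 : cexp 0 = 1 :> R[i].
Proof.
rewrite /cexp /= expR0 cos0 sin0; apply: complex_ext; rewrite ?re_mul ?im_mul /=; ring.
Qed.

Lemma cexpN z : cexp (- z) * cexp z = 1.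
Proof. by rewrite -cexpD addNr cexp0. Qed.

Lemma cexp_neq0 z : cexp z != 0.
Proof. by apply/eqP => e0; have := cexpN z; rewrite e0 mulr0 => /eqP; rewrite eq_sym oner_eq0. Qed.

Lemma cexpNV z : cexp (- z) = (cexp z)^-1.
Proof. by apply: (mulIf (cexp_neq0 z)); rewrite cexpN mulVf// cexp_neq0. Qed.

Lemma cabs_cexp z : cabs (cexp z) = expR (Re z).
Proof.
rewrite /cexp cabsM cabs_real ger0_norm ?expR_ge0// -[RHS]mulr1; congr (_ * _).
by rewrite /cabs normc_def /= cos2Dsin2 sqrtr1.
Qed.

(** At 0 the expansion is assembled from the real derivatives of [expR], [cos] and [sin]; the
    addition formula moves it to z. *)
Lemma has_deriv_cexp z : has_deriv cexp z (cexp z).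
Proof.
have H0 : has_deriv cexp (0 : R[i]) 1.
  apply/has_derivP => e e0.
  (* The real part costs 4 and the imaginary part 5 multiples of [e1]; the bound 1 serves to get
     [expR x <= 3]. *)
  set e1 := Num.min 1 (e / 10).
  have e10 : 0 < e1 by rewrite lt_min ltr01 divr_gt0.
  have e11 : e1 <= 1 by rewrite ge_min lexx.
  have e12 : 10 * e1 <= e.
    by rewrite mulrC -ler_pdivlMr// ge_min lexx orbT.
  clearbody e1.
  have [d1 d10 H1] := real_derivP (is_derive_expR 0) e10.
  have [d2 d20 H2] := real_derivP (is_derive_cos 0) e10.
  have [d3 d30 H3] := real_derivP (is_derive_sin 0) e10.
  exists (Num.min (Num.min d1 d2) (Num.min d3 e1)); first by rewrite !lt_min d10 d20 d30 e10.
  move=> h; rewrite !lt_min => /andP[/andP[h1 h2] /andP[h3 h4]].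
  set x := Re h; set y := Im h.
  have xh : `|x| <= cabs h := cabs_Re h.
  have yh : `|y| <= cabs h := cabs_Im h.
  have := H1 x (le_lt_trans xh h1); rewrite add0r expR0 mulr1 => {}H1.
  have := H2 y (le_lt_trans yh h2); rewrite add0r cos0 sin0 oppr0 mulr0 subr0 => {}H2.
  have := H3 y (le_lt_trans yh h3); rewrite add0r cos0 sin0 mulr1 subr0 => {}H3.
  rewrite add0r cexp0 mulr1.
  have c0 := cabs_ge0 h.
  have E1 : expR x <= 3.
    have : expR x - 1 - x <= e1 * `|x| := le_trans (ler_norm _) H1.
    have := ler_norm x; nra.
  have Ege := expR_ge0 x.
  have x0 := normr_ge0 x; have y0 := normr_ge0 y.
  have R1 : `|Re (cexp h - 1 - h)| <= 4 * e1 * cabs h.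
    have -> : Re (cexp h - 1 - h) = (expR x - 1 - x) + expR x * (cos y - 1).
      by rewrite /cexp !re_add !re_opp !re_mul /= -/x -/y; ring.
    apply: le_trans (ler_normD _ _) _; rewrite normrM (ger0_norm Ege).
    have : expR x * `|cos y - 1| <= 3 * (e1 * `|y|) by apply: ler_pM.
    nra.
  have I1 : `|Im (cexp h - 1 - h)| <= 5 * e1 * cabs h.
    have -> : Im (cexp h - 1 - h) = expR x * (sin y - y) + ((expR x - 1 - x) + x) * y.
      by rewrite /cexp !im_add !im_opp !im_mul /= -/x -/y; ring.
    apply: le_trans (ler_normD _ _) _; rewrite !normrM (ger0_norm Ege).
    have B1 : expR x * `|sin y - y| <= 3 * (e1 * `|y|) by apply: ler_pM.
    have B2 : `|expR x - 1 - x + x| <= 2 * e1.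
      apply: le_trans (ler_normD _ _) _; nra.
    have : `|expR x - 1 - x + x| * `|y| <= 2 * e1 * cabs h by apply: ler_pM.
    nra.
  apply: le_trans (cabs_ReIm _) _; nra.
apply/has_derivP => e e0; have /has_derivP H := H0.
have z0 : 0 < cabs (cexp z) by rewrite cabs_gt0 cexp_neq0.
have [|d d0 Hd] := H (e / cabs (cexp z)); first by rewrite divr_gt0.
exists d => // h /Hd; rewrite add0r cexp0 mulr1 cexpD => hb.
have -> : cexp z * cexp h - cexp z - h * cexp z = cexp z * (cexp h - 1 - h) by ring.
rewrite cabsM mulrC -ler_pdivlMr//; apply: le_trans hb _.
by rewrite le_eqVlt; apply/orP; left; apply/eqP; ring.
Qed.

Lemma cexp_period x : cexp (x +i* (2 * pi)) = cexp (x +i* (0 : R)).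
Proof.
rewrite /cexp /= cos0 sin0 mulr_natl.
by rewrite cos2pi sin2pi.
Qed.

End ComplexExponential.

(** * Integrals over circles centred at 0 *)

Section CircleMeans.
Context {R : realType}.
Implicit Types (z w zeta : R[i]) (f g G : R[i] -> R[i]) (s t theta e r : R).

Lemma twopi_gt0 : 0 < 2 * pi :> R.
Proof. by rewrite mulr_gt0// pi_gt0. Qed.

(** The circle has radius [expR s] and the measure is d(theta) = dz / (i z); the contour integral of
    g is therefore, up to i, the case of [G z = g z * z]. *)
Definition circle_int G s : R[i] := iint 0 (2 * pi) (fun theta => G (cexp (s +i* theta))).

Lemma cabs_circle s theta : cabs (cexp (s +i* theta)) = expR s.
Proof. by rewrite cabs_cexp. Qed.

Lemma circle_cont G s :
  (forall z, cabs z = expR s -> exists D, has_deriv G z D) ->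
  cont_on 0 (2 * pi) (fun theta => G (cexp (s +i* theta))).
Proof.
move=> H; apply: (@cont_on_ver _ (fun u => G (cexp u))) => y _.
have [D HD] := H _ (cabs_circle s y).
by exists (D * cexp (s +i* y)); apply: has_deriv_comp => //; exact: has_deriv_cexp.
Qed.

(** The exponential maps the rectangle [s, s'] x [0, 2 pi] onto the annulus; its horizontal sides
    cancel by periodicity, and Goursat's theorem equates the vertical ones. *)
Lemma circle_int_const G s s' : s <= s' ->
  (forall z, expR s <= cabs z <= expR s' -> exists D, has_deriv G z D) ->
  circle_int G s = circle_int G s'.
Proof.
move=> ss H.
have cd : 0 <= 2 * pi :> R by exact: ltW twopi_gt0.
have HF : deriv_on_rect (fun u => G (cexp u)) s s' 0 (2 * pi).
  move=> x y /andP[sx xs] _; have [|D HD] := H (cexp (x +i* y)).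
    by rewrite cabs_circle !ler_expR sx.
  by exists (D * cexp (x +i* y)); apply: has_deriv_comp => //; exact: has_deriv_cexp.
have := goursat ss cd HF; rewrite /rect_int.
rewrite [X in X + _](_ : _ = 0); last first.
  rewrite -[RHS](mul0r (s' - s)%:C) -(iint_cst 0 ss).
  by apply: eq_iint => x _; rewrite cexp_period subrr.
rewrite add0r => /eqP.
have i0 : ('i : R[i]) != 0 by rewrite -cabs_gt0 cabs_i.
have CC t : s <= t <= s' -> cont_on 0 (2 * pi) (fun y => G (cexp (t +i* y))).
  move=> /andP[st ts]; apply: circle_cont => z zt; apply: H.
  by rewrite zt !ler_expR st.
have B1 : cont_on 0 (2 * pi) (fun y => G (cexp (s +i* y))) by apply: CC; rewrite lexx.
have B2 : cont_on 0 (2 * pi) (fun y => G (cexp (s' +i* y))) by apply: CC; rewrite lexx ss.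
rewrite mulf_eq0 (negPf i0) /= (iintB B2 B1) subr_eq0 => /eqP.
exact: esym.
Qed.

Definition cont_at g z : Prop := forall e, 0 < e ->
  exists2 delta : R, 0 < delta & forall w, cabs (w - z) < delta -> cabs (g w - g z) < e.

Lemma cont_at_mul g h z : cont_at g z -> cont_at h z -> cont_at (fun w => g w * h w) z.
Proof.
move=> Hg Hh e e0.
have h0 : 0 < cabs (h z) + 1 by rewrite ltr_wpDl ?cabs_ge0.
have g0 : 0 < cabs (g z) + 1 by rewrite ltr_wpDl ?cabs_ge0.
have [|d1 d10 H1] := Hg (e / 2 / (cabs (h z) + 1)); first by rewrite !divr_gt0.
have [|d2 d20 H2] := Hh (Num.min 1 (e / 2 / (cabs (g z) + 1))).
  by rewrite lt_min ltr01 !divr_gt0.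
exists (Num.min d1 d2); first by rewrite lt_min d10.
move=> w; rewrite lt_min => /andP[/H1 h1 /H2]; rewrite lt_min => /andP[h2 h3].
have hw : cabs (h w) <= cabs (h z) + 1.
  rewrite -[h w](subrK (h z)) (le_trans (cabsD _ _))// addrC lerD2l; exact: ltW.
have -> : g w * h w - g z * h z = (g w - g z) * h w + g z * (h w - h z) by ring.
apply: le_lt_trans (cabsD _ _) _; rewrite [e]splitr !cabsM; apply: ltr_leD.
  apply: le_lt_trans (ler_wpM2l (cabs_ge0 _) hw) _.
  by move: h1; rewrite ltr_pdivlMr.
apply: (@le_trans _ _ ((cabs (g z) + 1) * cabs (h w - h z))).
  by rewrite ler_wpM2r ?cabs_ge0// lerDl.
by rewrite mulrC -ler_pdivlMr// ltW.
Qed.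

Lemma has_deriv_cont_at g z D : has_deriv g z D -> cont_at g z.
Proof. exact: has_deriv_cont. Qed.

(** Compactness of the range of theta makes the pointwise continuity of [G] along the circle
    uniform. *)
Lemma circle_int_cont G s : (forall z, cabs z = expR s -> cont_at G z) ->
  (exists2 d0 : R, 0 < d0 & forall t, `|t - s| < d0 -> t != s ->
     cont_on 0 (2 * pi) (fun theta => G (cexp (t +i* theta)))) ->
  cont_on 0 (2 * pi) (fun theta => G (cexp (s +i* theta))) ->
  forall e, 0 < e -> exists2 d : R, 0 < d & forall t, `|t - s| < d ->
    cabs (circle_int G t - circle_int G s) <= e.
Proof.
move=> HG [d0 d00 Hd0] Hs e e0.
have cpt := @segment_compact R 0 (2 * pi).
set e1 := e / (2 * (2 * pi)).
have e10 : 0 < e1 by rewrite divr_gt0// !mulr_gt0// pi_gt0.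
have : \forall t \near s, forall theta, `[0, 2 * pi]%classic theta ->
    cabs (G (cexp (t +i* theta)) - G (cexp (s +i* theta))) < e1.
  move/compact_near_coveringP: cpt => /(_ _ (nbhs s) (fun t theta =>
    cabs (G (cexp (t +i* theta)) - G (cexp (s +i* theta))) < e1)); apply => theta _.
  have e2 : 0 < e1 / 2 by rewrite divr_gt0.
  have [d1 d10 H1] := HG _ (cabs_circle s theta) _ e2.
  have [d2 d20 H2] := has_deriv_cont_at (has_deriv_cexp (s +i* theta)) d10.
  have K t th : `|t - s| < d2 / 2 -> `|th - theta| < d2 / 2 ->
      cabs (G (cexp (t +i* th)) - G (cexp (s +i* theta))) < e1 / 2.
    move=> h1 h2; apply: H1; apply: H2; apply: le_lt_trans (cabs_ReIm _) _.
    by rewrite re_add im_add re_opp im_opp /= [d2]splitr ltrD.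
  exists ([set th | `|th - theta| < d2 / 2], [set t | `|t - s| < d2 / 2]) => /=.
    split; apply/nbhs_ballP; exists (d2 / 2) => /=; rewrite ?divr_gt0// => u;
      by rewrite /ball /= distrC.
  move=> [th t] /= [h1 h2]; rewrite [e1]splitr.
  have -> : G (cexp (t +i* th)) - G (cexp (s +i* th)) =
     (G (cexp (t +i* th)) - G (cexp (s +i* theta))) -
     (G (cexp (s +i* th)) - G (cexp (s +i* theta))) by ring.
  apply: le_lt_trans (cabsDB _ _) _; apply: ltrD; apply: K => //.
  by rewrite subrr normr0 divr_gt0.
move=> /nbhs_ballP[d /= dgt0 Hd].
exists (Num.min d d0); first by rewrite lt_min dgt0.
move=> t; rewrite lt_min => /andP[td td0].
have [->|ts] := eqVneq t s; first by rewrite subrr cabs0 ltW.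
rewrite /circle_int -iintB//; last exact: Hd0.
have cd : 0 <= 2 * pi :> R by exact: ltW twopi_gt0.
have -> : e = 2 * (e1 * (2 * pi - 0)).
  have pi0 : pi != 0 :> R by rewrite gt_eqF// pi_gt0.
  by rewrite /e1 subr0; move: (@pi R) pi0 => p p0; field.
apply: iint_bound => //; first by apply: cont_onB => //; exact: Hd0.
move=> theta th; apply/ltW/Hd; first by rewrite /ball /= distrC.
by rewrite /= in_itv.
Qed.

(* The exceptional point [zeta] is bypassed by the continuity in the radius of
   the integral over circles. *)
Lemma circle_int_eq0 g zeta s : cabs zeta < 1 -> s < 0 ->
  (forall z, cabs z < 1 -> z != zeta -> exists D, has_deriv g z D) ->
  cont_at g zeta -> expR s != cabs zeta ->
  circle_int (fun z => g z * z) s = 0.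
Proof.
move=> zeta1 s0 Hg cg sz.
set G := fun z => g z * z.
have HG z : cabs z < 1 -> cabs z != cabs zeta -> exists D, has_deriv G z D.
  move=> z1 zz; have [|D HD] := Hg z z1; first by apply: contraNneq zz => ->.
  by eexists; apply: has_derivM HD (has_deriv_id z).
have e1 t : t < 0 -> expR t < 1 by rewrite expR_lt1.
have cont z : cabs z < 1 -> cont_at g z.
  move=> z1; have [->//|zz] := eqVneq z zeta.
  by have [D HD] := Hg z z1 zz; exact: has_deriv_cont_at HD.
have cG z : cabs z < 1 -> cont_at G z.
  move=> z1; apply: cont_at_mul; [exact: cont|exact: has_deriv_cont_at (has_deriv_id z)].
have CC t : t < 0 -> cont_on 0 (2 * pi) (fun theta => G (cexp (t +i* theta))).
  move=> t0 y _ e e0.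
  have [d1 d10 H1] := cG (cexp (t +i* y)) ltac:(by rewrite cabs_circle e1) _ e0.
  have [d2 d20 H2] := has_deriv_cont_at (has_deriv_cexp (t +i* y)) d10.
  exists d2 => // y' yy; apply: H1; apply: H2.
  have -> : (t +i* y') - (t +i* y) = 'i * (y' - y)%:C.
    by apply: complex_ext; rewrite ?re_mul ?im_mul ?re_add ?im_add ?re_opp ?im_opp /=; ring.
  by rewrite cabsM cabs_i mul1r cabs_real.
(* Such a circle can be shrunk towards 0 without meeting [zeta], and near 0 the function [G] is at
   most a constant times the radius. *)
have inner t : t < 0 -> (cabs zeta = 0 \/ expR t < cabs zeta) -> circle_int G t = 0.
  move=> t0 tz; apply: cabs_eps0 => e e0.
  have [d d0 Hd] := cont 0 ltac:(by rewrite cabs0) _ ltr01.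
  set M := cabs (g 0) + 1.
  have M0 : 0 < M by rewrite ltr_wpDl ?cabs_ge0.
  (* The three bounds keep the small circle inside the given one, keep [g] below [M] on it, and
     bring the integral below [e]. *)
  set rho := Num.min (expR t) (Num.min (d / 2) (e / (2 * M * (2 * pi)))).
  have rho0 : 0 < rho.
    by rewrite !lt_min expR_gt0 !divr_gt0// !mulr_gt0// pi_gt0.
  have [u Hu] := expR_total rho0.
  have ut : u <= t by rewrite -ler_expR Hu ge_min lexx.
  rewrite -(circle_int_const ut); last first.
    move=> z /andP[z1 z2]; apply: HG; first exact: le_lt_trans z2 (e1 _ t0).
    case: tz => [->|tz]; first by rewrite gt_eqF// (lt_le_trans (expR_gt0 u)).
    by rewrite lt_eqF// (le_lt_trans z2).
  have cd : 0 <= 2 * pi :> R by exact: ltW twopi_gt0.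
  have u0 : u < 0 by exact: le_lt_trans ut t0.
  apply: le_trans (iint_bound (M := M * rho) cd (CC _ u0) _) _.
    move=> theta _; rewrite /G cabsM cabs_circle Hu ler_wpM2r ?(ltW rho0)//.
    rewrite -[g _](subrK (g 0)) (le_trans (cabsD _ _))// /M addrC lerD2l ltW//.
    apply: Hd; rewrite subr0 cabs_circle Hu.
    have : rho <= d / 2 by rewrite /rho !ge_min lexx !orbT.
    by move=> h; apply: le_lt_trans h _; rewrite ltr_pdivrMr// ltr_pMr// ltr1n.
  rewrite subr0; have : rho <= e / (2 * M * (2 * pi)) by rewrite /rho !ge_min lexx !orbT.
  rewrite ler_pdivlMr ?mulr_gt0 ?pi_gt0// => h; apply: le_trans h.
  by rewrite le_eqVlt; apply/orP; left; apply/eqP; ring.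
have [z0|z0] := eqVneq (cabs zeta) 0; first by apply: inner => //; left.
have zp : 0 < cabs zeta by rewrite lt_def z0 cabs_ge0.
have [lt|gt|/eqP] := ltgtP (expR s) (cabs zeta); last by rewrite (negPf sz).
  by apply: inner => //; right.
(* Here the circle encloses [zeta]. The radius crosses [cabs zeta = expR sg]: the integral just
   outside, which equals the one at [s], and the one just inside, which is 0, both differ from the
   one at [sg] by at most e/2. *)
have [sg Hsg] := expR_total zp.
have sgs : sg < s by rewrite -ltr_expR Hsg.
have sg0 : sg < 0 by exact: lt_trans sgs s0.
apply: cabs_eps0 => e e0; have e2 : 0 < e / 2 by rewrite divr_gt0.
have [|||d d0 Hd] := @circle_int_cont G sg _ _ _ _ e2.
- by move=> z zE; apply: cG; rewrite zE; exact: e1.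
- exists (- sg); rewrite ?oppr_gt0// => t ts _; apply: CC.
  by have := le_lt_trans (ler_norm _) ts; lra.
- exact: CC.
set u := Num.min s (sg + d / 2).
have us : u <= s by rewrite ge_min lexx.
have sgu : sg < u by rewrite lt_min sgs ltrDl divr_gt0.
rewrite -(circle_int_const us); last first.
  move=> z /andP[z1 z2]; apply: HG; first exact: le_lt_trans z2 (e1 _ s0).
  by rewrite gt_eqF// (lt_le_trans _ z1)// -Hsg ltr_expR.
have h1 : circle_int G (sg - d / 2) = 0.
  have sgd : sg - d / 2 < sg by rewrite ltrBlDr ltrDl divr_gt0.
  apply: inner; first exact: lt_trans sgd sg0.
  by right; rewrite -Hsg ltr_expR.
have h2 : cabs (circle_int G (sg - d / 2) - circle_int G sg) <= e / 2.
  by apply: Hd; rewrite addrAC subrr add0r normrN gtr0_norm ?divr_gt0//; lra.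
have h3 : cabs (circle_int G u - circle_int G sg) <= e / 2.
  apply: Hd; rewrite gtr0_norm ?subr_gt0//.
  have : u <= sg + d / 2 by rewrite ge_min lexx orbT.
  lra.
move: (circle_int G u) (circle_int G sg) (circle_int G (sg - d / 2)) h1 h2 h3.
move=> A B C C0 h2 h3; have -> : A = (A - B) - (C - B) by rewrite C0; ring.
by rewrite [e]splitr (le_trans (cabsDB _ _))// lerD.
Qed.

End CircleMeans.

(** * Taylor expansion of complex differentiable functions *)

Section CauchyTaylor.
Context {R : realType}.
Implicit Types (z w zeta : R[i]) (f g G : R[i] -> R[i]) (s t theta e r : R).

(** On the circle [w ^- n] is a constant multiple of the conjugate of [w ^+ n], so the negative
    powers follow from the vanishing for positive powers. *)
Lemma circle_int_pow s n : s < 0 ->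
  circle_int (fun z => z ^- n) s = if n == 0%N then (2 * pi)%:C else 0.
Proof.
move=> s0; case: n => [|n] /=.
  rewrite /circle_int; under [fun theta => _]eq_fun do rewrite expr0 invr1.
  by rewrite iint_cst ?(ltW twopi_gt0)// subr0 mul1r.
have H : circle_int (fun z => z ^+ n * z) s = 0.
  apply: (@circle_int_eq0 _ _ 0) => //; rewrite ?cabs0// ?gt_eqF ?expR_gt0//.
    by move=> z _ _; eexists; exact: has_derivX.
  exact: has_deriv_cont_at (has_derivX n 0).
have C : cont_on 0 (2 * pi) (fun theta => cexp (s +i* theta) ^+ n.+1).
  by apply: (circle_cont (G := fun z => z ^+ n.+1)) => z _; eexists; exact: has_derivX.
have E theta : cexp (s +i* theta) ^- n.+1 =
    (expR s ^- 2)%:C ^+ n.+1 * (cexp (s +i* theta) ^+ n.+1)^*%C.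
  have w0 := cexp_neq0 (s +i* theta).
  have es0 : (expR s)%:C != 0 :> R[i] by rewrite -cabs_gt0 cabs_real normr_gt0 gt_eqF ?expR_gt0.
  have := mulJ_cabs (cexp (s +i* theta)); rewrite cabs_circle.
  move: (cexp (s +i* theta)) w0 => w w0 hw.
  rewrite rmorphXn -exprMn -exprVn; congr (_ ^+ _).
  by apply: (mulfI w0); rewrite mulrCA hw -rmorphM /= mulVf ?expf_neq0 ?gt_eqF ?expR_gt0// divff.
rewrite /circle_int; under [fun theta => _]eq_fun do rewrite E.
have IC := cont_on_cintegrable C.
rewrite /iint cintZ//; last exact: cintegrableJ.
rewrite cintJ//; move: H; rewrite /circle_int /iint.
under [fun theta => _]eq_fun do rewrite -exprSr.
by move=> ->; rewrite conjc0 mulr0.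
Qed.

(** Only continuity is known at [zeta], whence the exceptional point in [circle_int_eq0]. *)
Definition diff_quotient f (D : R[i]) zeta : R[i] -> R[i] :=
  fun z => if z == zeta then D else (f z - f zeta) / (z - zeta).

Lemma diff_quotientE f D zeta z : (z - zeta) * diff_quotient f D zeta z = f z - f zeta.
Proof.
rewrite /diff_quotient; have [->|zz] := eqVneq z zeta; first by rewrite !subrr mul0r.
by rewrite mulrCA divff ?mulr1// subr_eq0.
Qed.

Lemma diff_quotient_cont f D zeta : has_deriv f zeta D ->
  cont_at (diff_quotient f D zeta) zeta.
Proof.
move=> /has_derivP H e e0; have e2 : 0 < e / 2 by rewrite divr_gt0.
have [d d0 Hd] := H _ e2; exists d => // w wz.
rewrite {2}/diff_quotient eqxx; have [->|wn] := eqVneq w zeta.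
  by rewrite /diff_quotient eqxx subrr cabs0.
have w0 : 0 < cabs (w - zeta) by rewrite cabs_gt0 subr_eq0.
have := Hd _ wz; rewrite [zeta + _]addrC subrK -(diff_quotientE f D) -mulrBr cabsM mulrC.
by rewrite ler_pM2r// => h; apply: le_lt_trans h _; rewrite ltr_pdivrMr// ltr_pMr// ltr1n.
Qed.

Lemma diff_quotient_deriv f D zeta z D' : z != zeta -> has_deriv f z D' ->
  exists D'', has_deriv (diff_quotient f D zeta) z D''.
Proof.
move=> zz Hf; eexists; apply: (near_has_deriv (r := cabs (z - zeta))); last first.
- apply: has_derivM; first exact: (has_derivB Hf (has_deriv_cst (f zeta) z)).
  apply: has_derivV; last exact: has_derivB (has_deriv_id z) (has_deriv_cst zeta z).
  by rewrite subr_eq0.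
- move=> w; rewrite /diff_quotient; have [->|//] := eqVneq w zeta.
  by rewrite cabsB ltxx.
- by rewrite cabs_gt0 subr_eq0.
Qed.

(** The coefficients are Cauchy's. Instead of expanding a Cauchy kernel, the relation
    [(z - zeta) * g z = f z - f zeta] is iterated: the remainder after N terms is a circle integral
    of size (|zeta| / r)^N. *)
Lemma holomorphic_pser_lt f r : 0 < r < 1 ->
  (forall z, cabs z < 1 -> exists D, has_deriv f z D) -> exists a, pser a f r.
Proof.
move=> /andP[r0 r1] Hf.
have [s Es] := expR_total r0; have s0 : s < 0 by rewrite -expR_lt1 Es.
have p0 := @twopi_gt0 R.
have pn0 : (2 * pi)%:C != 0 :> R[i] by rewrite -cabs_gt0 cabs_real gtr0_norm.
exists (fun n => circle_int (fun z => f z * z ^- n) s / (2 * pi)%:C).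
move=> zeta zr; have z1 : cabs zeta < 1 by exact: lt_trans r1.
have [D HD] := Hf _ z1.
set g := diff_quotient f D zeta.
have Hg z : cabs z < 1 -> z != zeta -> exists D', has_deriv g z D'.
  move=> /Hf[D' HD'] zz; exact: diff_quotient_deriv HD'.
have I0 : circle_int (fun z => g z * z) s = 0.
  apply: (circle_int_eq0 z1) => //; first exact: diff_quotient_cont.
  by rewrite Es gt_eqF.
have circ z : cabs z = expR s -> cabs z < 1 by move=> ->; rewrite Es.
have circn0 z : cabs z = expR s -> z != 0 by move=> h; rewrite -cabs_gt0 h expR_gt0.
have Dg z : cabs z = expR s -> exists D', has_deriv g z D'.
  move=> h; apply: Hg; first exact: circ.
  by apply/eqP => zz; move: zr; rewrite -zz h Es ltxx.
have Dpow n z : cabs z = expR s -> has_deriv (fun w => w ^- n) z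
     (- (n%:R * z ^+ n.-1) / (z ^+ n) ^+ 2).
  move=> h; apply: (has_derivV (f := fun w => w ^+ n)); last exact: has_derivX.
  by rewrite expf_neq0// circn0.
have Cf n : cont_on 0 (2 * pi) (fun theta => f (cexp (s +i* theta)) * cexp (s +i* theta) ^- n).
  apply: (circle_cont (G := fun z => f z * z ^- n)) => z h.
  by have [D' HD'] := Hf _ (circ _ h); eexists; apply: has_derivM HD' (Dpow n z h).
have Cp n : cont_on 0 (2 * pi) (fun theta => cexp (s +i* theta) ^- n).
  apply: (circle_cont (G := fun z => z ^- n)) => z h.
  by eexists; apply: (Dpow n z h).
have Cg n : cont_on 0 (2 * pi) (fun theta => g (cexp (s +i* theta)) *
     cexp (s +i* theta) * cexp (s +i* theta) ^- n).
  apply: (circle_cont (G := fun z => g z * z * z ^- n)) => z h.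
  have [D' HD'] := Dg _ h; eexists; apply: has_derivM (Dpow n z h).
  exact: has_derivM HD' (has_deriv_id z).
have Jn n : circle_int (fun z => (f z - f zeta) * z ^- n) s =
    circle_int (fun z => f z * z ^- n) s - f zeta * (if n == 0%N then (2 * pi)%:C else 0).
  rewrite -(circle_int_pow n s0) /circle_int -iintZ// -iintB//; last exact: cont_onZ.
  by apply: eq_iint => theta _; rewrite mulrBl.
have Cd n : cont_on 0 (2 * pi) (fun theta => (f (cexp (s +i* theta)) - f zeta) *
     cexp (s +i* theta) ^- n).
  have := cont_onB (Cf n) (cont_onZ (f zeta) (Cp n)).
  by congr cont_on; apply/funext => theta; rewrite mulrBl.
(* The induction step is [zeta * g z = z * g z - (f z - f zeta)] multiplied by [z ^- N]; the base
   case is [I0]. *)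
have rem N : circle_int (fun z => g z * z * z ^- N) s * zeta ^+ N =
   - \sum_(n < N) circle_int (fun z => (f z - f zeta) * z ^- n) s * zeta ^+ n.
  elim: N => [|N IH].
    rewrite big_ord0 oppr0 expr0 mulr1 -[RHS]I0; apply: eq_iint => theta _.
    by rewrite expr0 divr1.
  rewrite big_ord_recr /= opprD -IH -mulNr -mulrDl exprS mulrA; congr (_ * _).
  rewrite mulrC /circle_int -iintZ// -iintB//; apply: eq_iint => theta _.
  have wn0 := cexp_neq0 (s +i* theta); rewrite -(diff_quotientE f D) -/g.
  move: (cexp _) wn0 => w w0; rewrite exprSr; field.
  by rewrite w0 expf_neq0.
have [M HM] := cont_on_bounded (Cg 0%N).
have M0 : 0 <= M.
  by apply: le_trans (cabs_ge0 _) (HM 0 _); rewrite lexx (ltW p0).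
set q := cabs zeta / r.
have q01 : 0 <= q < 1 by rewrite /q divr_ge0 ?cabs_ge0 ?(ltW r0)//= ltr_pdivrMr// mul1r.
move=> e e0.
have [N0 HN0] := geom_small (2 * M) q01 e0.
(* The partial sum must contain the term of index 0, since that term produces [f zeta]. *)
exists N0.+1 => -[//|N] NN.
have -> : f zeta - \sum_(k < N.+1) circle_int (fun z => f z * z ^- k) s / (2 * pi)%:C *
    zeta ^+ k = circle_int (fun z => g z * z * z ^- N.+1) s * zeta ^+ N.+1 / (2 * pi)%:C.
  have -> : circle_int (fun z => g z * z * z ^- N.+1) s * zeta ^+ N.+1 =
      f zeta * (2 * pi)%:C - \sum_(k < N.+1) circle_int (fun z => f z * z ^- k) s * zeta ^+ k.
    rewrite rem; under eq_bigr do rewrite Jn mulrBl.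
    rewrite sumrB opprB; congr (_ - _).
    by rewrite big_ord_recl /= expr0 mulr1 big1 ?addr0// => i _; rewrite mulr0 mul0r.
  rewrite mulrBl mulfK//; congr (_ - _); rewrite mulr_suml.
  by apply: eq_bigr => k _; rewrite mulrAC.
have B : cabs (circle_int (fun z => g z * z * z ^- N.+1) s) <= 2 * ((M / r ^+ N.+1) * (2 * pi - 0)).
  apply: iint_bound => //; first exact: ltW.
  move=> theta th; rewrite cabsM cabsV cabsX cabs_circle Es.
  rewrite ler_wpM2r ?invr_ge0 ?exprn_ge0 ?(ltW r0)//.
  by have := HM theta th; rewrite expr0 divr1.
rewrite cabsM cabsV cabs_real (gtr0_norm p0) ltr_pdivrMr// cabsM cabsX.
apply: le_lt_trans (ler_wpM2r (exprn_ge0 _ (cabs_ge0 _)) B) _.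
have -> : 2 * (M / r ^+ N.+1 * (2 * pi - 0)) * cabs zeta ^+ N.+1 =
   2 * M * q ^+ N.+1 * (2 * pi).
  by rewrite /q expr_div_n; ring.
by rewrite ltr_pM2r//; apply: HN0; rewrite (leq_trans _ NN).
Qed.

Lemma pserS a f r r' : r' <= r -> pser a f r -> pser a f r'.
Proof. by move=> rr H z zr; apply: H; exact: lt_le_trans rr. Qed.

(** Expansions obtained at different radii agree by uniqueness on the disk of radius 1/2, so one
    sequence serves for all points. *)
Lemma holomorphic_pser f : (forall z, cabs z < 1 -> exists D, has_deriv f z D) ->
  exists a, pser a f 1.
Proof.
move=> Hf; have [|a Ha] := holomorphic_pser_lt (r := 1 / 2) _ Hf.
  by apply/andP; split; lra.
exists a => zeta z1; set r := Num.max (1 / 2) ((cabs zeta + 1) / 2).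
have rz : cabs zeta < r by rewrite lt_max midf_lt ?orbT.
have r2 : 1 / 2 <= r by rewrite le_max lexx.
have r1 : r < 1 by rewrite gt_max midf_lt// andbT; lra.
have [|b Hb] := holomorphic_pser_lt (r := r) _ Hf.
  by rewrite r1 andbT; lra.
have ab := pser_unique (r := 1 / 2) ltac:(lra) (pserS r2 Hb) Ha.
by apply: eq_has_sum (Hb _ rz) => n; rewrite ab.
Qed.

End CauchyTaylor.

(** * Integrals of monomials over disks *)

Section LineFTC.
Context {R : realType}.
Implicit Types (P Q : R[i] -> R[i]) (a b x : R).

(** [g] stands for [Re] or [Im]; real linearity and the bound by the modulus are what the two
    share. *)
Lemma has_deriv_line (g : R[i] -> R) P x (D : R[i]) :
  (forall z w, g (z - w) = g z - g w) -> (forall z, `|g z| <= cabs z) ->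
  (forall (k : R) z, g (k%:C * z) = k * g z) ->
  has_deriv P x%:C D -> is_derive x 1 (fun t : R => g (P t%:C)) (g D).
Proof.
move=> gB gle gZ /has_derivP H.
have K : (fun h : R => h^-1 *: (((fun t : R => g (P t%:C)) \o shift x) (h *: (1 : R)) - g (P x%:C)))
   @ (0 : R)^' --> g D.
  apply/cvgrPdist_lt => e e0; have e2 : 0 < e / 2 by rewrite divr_gt0.
  have [d d0 Hd] := H _ e2; apply/nbhs_ballP; exists d => //= h.
  rewrite /ball /= sub0r normrN => hd h0.
  have := Hd h%:C; rewrite cabs_real => /(_ hd) hb.
  rewrite /GRing.scale /= mulr1 rmorphD /= [h%:C + _]addrC -gB.
  have -> : g D - h^-1 * g (P (x%:C + h%:C) - P x%:C) =
     - (h^-1 * g (P (x%:C + h%:C) - P x%:C - h%:C * D)).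
    by rewrite (gB (P _ - P _)) gZ; field.
  rewrite normrN normrM normfV mulrC ltr_pdivrMr ?normr_gt0//.
  apply: le_lt_trans (le_trans (gle _) hb) _.
  by rewrite ltr_pM2r ?normr_gt0// ltr_pdivrMr// ltr_pMr// ltr1n.
split; first by apply/cvg_ex; exists (g D).
by apply/cvg_lim.
Qed.

Lemma iint_deriv P Q a b : a < b -> (forall t : R, has_deriv P t%:C (Q t%:C)) ->
  (forall t : R, exists D, has_deriv Q t%:C D) ->
  iint a b (fun t => Q t%:C) = P b%:C - P a%:C.
Proof.
move=> ab HP HQ.
have CQ : cont_on a b (fun t => Q t%:C).
  apply: (@cont_on_hor _ Q a b 0) => x _; exact: HQ.
have key (g : R[i] -> R) :
  (forall z w, g (z - w) = g z - g w) -> (forall z, `|g z| <= cabs z) ->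
  (forall (k : R) z, g (k%:C * z) = k * g z) ->
  Rintegral (@lebesgue_measure R) `[a, b] (fun t => g (Q t%:C)) = g (P b%:C) - g (P a%:C).
  move=> gB gle gZ.
  have D t := has_deriv_line gB gle gZ (HP t).
  have cD t : {for t, continuous (fun t : R => g (P t%:C))}.
    by apply: differentiable_continuous; apply/derivable1_diffP; case: (D t).
  rewrite /Rintegral (@continuous_FTC2 _ _ (fun t : R => g (P t%:C)))//.
  - by apply: cont_on_within CQ => z w; rewrite -gB.
  - split; first by move=> t _; case: (D t).
    + by apply: cvg_at_right_filter; exact: cD.
    + by apply: cvg_at_left_filter; exact: cD.
  - by move=> t _; rewrite derive1E; case: (D t).
apply: complex_ext; rewrite ?re_add ?im_add ?re_opp ?im_opp /=.
  apply: key => [z w|z|k z]; rewrite ?re_add ?re_opp ?cabs_Re//.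
  by rewrite re_mul /= mul0r subr0.
apply: key => [z w|z|k z]; rewrite ?im_add ?im_opp ?cabs_Im//.
by rewrite im_mul /= mul0r addr0.
Qed.

End LineFTC.

Lemma mscale_integral0 d (T : measurableType d) (R : realType)
    (m : {measure set T -> \bar R}) (k : {nonneg R}) (h : T -> \bar R) :
  m.-integrable setT h -> (\int[m]_x h x = 0)%E -> (\int[mscale k m]_x h x = 0)%E.
Proof.
move=> ih z; have mh : measurable_fun setT h by case/integrableP: ih.
rewrite integralE !ge0_integral_mscale//; first last.
- exact: measurable_funepos.
- exact: measurable_funeneg.
have f1 := integrable_pos_fin_num measurableT ih.
have f2 := integrable_neg_fin_num measurableT ih.
move: z; rewrite integralE -(fineK f1) -(fineK f2) -EFinB => -[] /subr0_eq ->.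
by rewrite subee.
Qed.

Section AreaIntegral.
Context {R : realType}.
Implicit Types (r x y : R) (f g : R[i] -> R[i]).

Definition pdisk r : set (measurableTypeR R * measurableTypeR R) :=
  [set p | cabs (plane_pt p) < r].

Lemma plane_diskE : @plane_disk R = pdisk 1.
Proof. by apply/seteqP; split => p /= /unit_diskE. Qed.

Lemma cabs_lt_sqr r x y : 0 < r -> (cabs (x +i* y) < r) = (x ^+ 2 + y ^+ 2 < r ^+ 2).
Proof.
move=> r0; rewrite -(@ltr_pXn2r _ 2) ?nnegrE ?cabs_ge0 ?(ltW r0)//.
by rewrite cabs_sqr.
Qed.

Lemma measurable_pdisk r : measurable (pdisk r).
Proof.
have [r0|r0] := ltP 0 r; last first.
  rewrite (_ : pdisk r = set0)//; apply/seteqP; split => // p /= h.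
  by have := lt_le_trans h r0; rewrite ltNge cabs_ge0.
have mf : measurable_fun [set: measurableTypeR R * measurableTypeR R]
    (fun p : measurableTypeR R * measurableTypeR R => p.1 ^+ 2 + p.2 ^+ 2 : R).
  by apply: measurable_funD; apply: measurable_funX;
    [exact: measurable_fst|exact: measurable_snd].
have := mf measurableT _ (measurable_itv `]-oo, (r ^+ 2)[).
rewrite setTI; congr measurable; apply/seteqP; split => -[x y] /=;
  by rewrite in_itv /pdisk /= /plane_pt /= cabs_lt_sqr.
Qed.

Lemma cmeasurable_plane_pt D : cmeasurable D (@plane_pt R).
Proof.
by split; apply: measurable_funTS; [exact: measurable_fst|exact: measurable_snd].
Qed.

Local Notation leb2 := ((@lebesgue_measure R) \x (@lebesgue_measure R))%E.

Lemma leb2_pdisk r : (leb2 (pdisk r) < +oo)%E.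
Proof.
apply: (@le_lt_trans _ _ (leb2 (`[- r, r]%classic `*` `[- r, r]%classic))).
  apply: le_measure; rewrite ?inE; first exact: measurable_pdisk.
    exact: measurableX.
  move=> [x y] /= h; rewrite !in_itv /= -!ler_norml; split.
    exact: le_trans (cabs_Re (x +i* y)) (ltW h).
  exact: le_trans (cabs_Im (x +i* y)) (ltW h).
have m1 : (@lebesgue_measure R `[(- r)%R, r]%classic < +oo)%E.
  by rewrite lebesgue_measure_itv /=; case: ifP; rewrite ?ltry.
by rewrite product_measure1E//; apply: lte_mul_pinfty => //; rewrite ge0_fin_numE.
Qed.

Lemma area_pdisk_lty r : (@area_measure R (pdisk r) < +oo)%E.
Proof.
rewrite /area_measure /= /mscale /=.
by apply: lte_mul_pinfty (leb2_pdisk r) => //; rewrite lee_fin invpi_ge0.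
Qed.

Lemma area_pdisk_gt0 r : 0 < r -> 0 < fine (@area_measure R (pdisk r)).
Proof.
move=> r0; apply: fine_gt0; rewrite area_pdisk_lty andbT.
rewrite /area_measure /= /mscale /=.
apply: mule_gt0; first by rewrite lte_fin invr_gt0 pi_gt0.
apply: (@lt_le_trans _ _ (leb2 (`[0, r / 2]%classic `*` `[0, r / 2]%classic))); last first.
  apply: le_measure; rewrite ?inE; [exact: measurableX|exact: measurable_pdisk|].
  move=> [x y] /=; rewrite !in_itv /= => -[/andP[x0 xr] /andP[y0 yr]].
  rewrite /pdisk /= /plane_pt /= cabs_lt_sqr//; nra.
have m1 : (0 < @lebesgue_measure R `[0%R, (r / 2)%R]%classic)%E.
  by rewrite lebesgue_measure_itv /= lte_fin divr_gt0// lte_fin subr0 divr_gt0.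
by rewrite product_measure1E// mule_gt0.
Qed.

(** Extended by 0, the function is integrable on the plane, so vanishing of the inner integrals in
    either order is enough. *)
Lemma fubini_zero r (f : R * R -> R) (M : R) :
  measurable_fun (pdisk r) f -> (forall p, pdisk r p -> `|f p| <= M) ->
  (forall y, \int[@lebesgue_measure R]_x ((f \_ (pdisk r)) (x, y))%:E = 0)%E \/
  (forall x, \int[@lebesgue_measure R]_y ((f \_ (pdisk r)) (x, y))%:E = 0)%E ->
  Rintegral (@area_measure R) (pdisk r) f = 0.
Proof.
move=> mf fM H0; have mD := measurable_pdisk r.
rewrite Rintegral_mkcond /Rintegral.
set h : measurableTypeR R * measurableTypeR R -> \bar R := fun p => ((f \_ (pdisk r)) p)%:E.
have ih : leb2.-integrable setT h.
  have -> : h = (EFin \o f) \_ (pdisk r) by apply/funext => p; rewrite /h /patch; case: ifP.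
  apply/integrable_restrict => //; rewrite setTI.
  apply: measurable_bounded_integrable => //; first exact: leb2_pdisk.
  by exists `|M|; split; [exact: num_real|move=> x Mx y Dy; exact: le_trans (fM _ Dy) (ltW (le_lt_trans (ler_norm _) Mx))].
have z : (\int[leb2]_p h p = 0)%E.
  case: H0 => H0.
    rewrite -integral21_prod_meas1//; under eq_integral do rewrite /fubini_G H0.
    by rewrite integral0.
  rewrite -integral12_prod_meas1//; under eq_integral do rewrite /fubini_F H0.
  by rewrite integral0.
by rewrite (_ : (\int[area_measure]_x h x)%E = 0%E)//; exact: mscale_integral0.
Qed.

End AreaIntegral.

Section BoundedMeasurable.
Context {R : realType}.
Implicit Types (r : R) (f g : R * R -> R[i]).

(** Unlike integrability, this property is stable under products, and it implies integrability on
    the disk. *)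
Definition bmeas r f : Prop :=
  cmeasurable (pdisk r) f /\ exists M, forall p, pdisk r p -> cabs (f p) <= M.

Lemma bmeas_cst r (c : R[i]) : bmeas r (fun=> c).
Proof. by split; [exact: cmeasurable_cst|exists (cabs c)]. Qed.

Lemma bmeas_pt r : bmeas r (@plane_pt R).
Proof. by split; [exact: cmeasurable_plane_pt|exists r => p /ltW]. Qed.

Lemma bmeasD r f g : bmeas r f -> bmeas r g -> bmeas r (fun p => f p + g p).
Proof.
move=> [mf [M HM]] [mg [N HN]]; split; first exact: cmeasurableD.
exists (M + N) => p pr; apply: le_trans (cabsD _ _) _.
by apply: lerD; [exact: HM|exact: HN].
Qed.

Lemma bmeasM r f g : bmeas r f -> bmeas r g -> bmeas r (fun p => f p * g p).
Proof.
move=> [mf [M HM]] [mg [N HN]]; split; first exact: cmeasurableM.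
exists (M * N) => p pr; rewrite cabsM.
by apply: ler_pM; rewrite ?cabs_ge0//; [exact: HM|exact: HN].
Qed.

Lemma bmeasB r f g : bmeas r f -> bmeas r g -> bmeas r (fun p => f p - g p).
Proof.
move=> Hf Hg; have := bmeasD Hf (bmeasM (bmeas_cst r (-1)) Hg).
by congr bmeas; apply/funext => q; rewrite mulN1r.
Qed.

Lemma bmeasJ r f : bmeas r f -> bmeas r (fun p => (f p)^*%C).
Proof.
move=> [mf [M HM]]; split; first exact: cmeasurableJ.
by exists M => p /HM; rewrite cabs_conj.
Qed.

Lemma bmeasX r f n : bmeas r f -> bmeas r (fun p => f p ^+ n).
Proof.
move=> H; elim: n => [|n IH]; first exact: bmeas_cst.
by under eq_fun do rewrite exprS; exact: bmeasM.
Qed.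

Lemma bmeas_cintegrable r f : bmeas r f -> cintegrable (@area_measure R) (pdisk r) f.
Proof.
move=> [mf [M HM]]; apply: (cintegrable_bounded (M := M)) => //;
  [exact: measurable_pdisk|exact: area_pdisk_lty].
Qed.

End BoundedMeasurable.

(** * Green's formula on disks, chord by chord *)

Section DiskGreen.
Context {R : realType}.
Implicit Types (r x y s t : R) (P Q : R[i] -> R[i]).

(** On the chord at height [y] the integrand has the primitive [P], which takes equal values at the
    two endpoints; outside the chord [F] is 0. *)
Lemma chord_integral0 (g : R[i] -> R) P Q r y (F : R -> R) :
  (forall z w, `|g z - g w| <= cabs (z - w)) ->
  (forall a b u, cont_on a b u ->
     Rintegral (@lebesgue_measure R) `[a, b] (fun t => g (u t)) = g (iint a b u)) ->
  g 0 = 0 ->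
  (forall t : R, has_deriv P t%:C (Q t%:C)) ->
  (forall t : R, exists D, has_deriv Q t%:C D) ->
  (forall s, s ^+ 2 + y ^+ 2 = r ^+ 2 -> P s%:C = P (- s)%:C) ->
  (forall x, F x = if x ^+ 2 + y ^+ 2 < r ^+ 2 then g (Q x%:C) else 0) ->
  (\int[@lebesgue_measure R]_x (F x)%:E = 0)%E.
Proof.
move=> glip gint g0 HP HQ HE HF.
have [ry|yr] := leP (r ^+ 2) (y ^+ 2).
  apply: integral0_eq => x _; rewrite HF ltNge.
  by have -> : r ^+ 2 <= x ^+ 2 + y ^+ 2 by rewrite (le_trans ry)// lerDr sqr_ge0.
pose s := Num.sqrt (r ^+ 2 - y ^+ 2).
have s2 : s ^+ 2 = r ^+ 2 - y ^+ 2 by rewrite sqr_sqrtr// subr_ge0 ltW.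
have s0 : 0 < s by rewrite sqrtr_gt0 subr_gt0.
have ss : - s < s by lra.
have CQ : cont_on (- s) s (fun t => Q t%:C).
  by apply: (@cont_on_hor _ Q _ _ 0) => x _; exact: HQ.
have iQ : (@lebesgue_measure R).-integrable `[- s, s] (EFin \o (fun t => g (Q t%:C))).
  by apply: continuous_compact_integrable; [exact: segment_compact|exact: cont_on_within CQ].
have -> : (fun x => (F x)%:E) = ((EFin \o (fun t => g (Q t%:C))) \_ `]- s, s[).
  apply/funext => x; rewrite HF /patch mem_setE in_itv /= -ltr_norml.
  have -> : (x ^+ 2 + y ^+ 2 < r ^+ 2) = (`|x| < s).
    rewrite -ltrBrDr -s2 -(@real_normK _ x) ?num_real//.
    by rewrite ltr_pXn2r// nnegrE ?normr_ge0// ltW.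
  by case: ifP.
rewrite -integral_mkcond integral_itv_bndoo; last first.
  have iQ' : (@lebesgue_measure R).-integrable `]- s, s[ (EFin \o (fun t => g (Q t%:C))).
    by apply: integrableS iQ => //; exact: subset_itv_oo_cc.
  exact: measurable_int iQ'.
rewrite -(integral_itv_bndoo (x := - s) (y := s) true false); last first.
  have iQ' : (@lebesgue_measure R).-integrable `]- s, s[ (EFin \o (fun t => g (Q t%:C))).
    by apply: integrableS iQ => //; exact: subset_itv_oo_cc.
  exact: measurable_int iQ'.
have := gint _ _ _ CQ; rewrite (iint_deriv ss HP HQ).
rewrite rmorphN /= -rmorphN /= -HE; last by rewrite s2 subrK.
rewrite subrr g0 /Rintegral => H.
by rewrite -[LHS]fineK ?H//; exact: integrable_fin_num iQ.
Qed.

Lemma Re_chord_integral0 P Q r y (F : R -> R) :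
  (forall t : R, has_deriv P t%:C (Q t%:C)) ->
  (forall t : R, exists D, has_deriv Q t%:C D) ->
  (forall s, s ^+ 2 + y ^+ 2 = r ^+ 2 -> P s%:C = P (- s)%:C) ->
  (forall x, F x = if x ^+ 2 + y ^+ 2 < r ^+ 2 then Re (Q x%:C) else 0) ->
  (\int[@lebesgue_measure R]_x (F x)%:E = 0)%E.
Proof. by move=> *; apply: (@chord_integral0 (@Re R) P Q r y) => //; exact: dist_Re. Qed.

Lemma Im_chord_integral0 P Q r y (F : R -> R) :
  (forall t : R, has_deriv P t%:C (Q t%:C)) ->
  (forall t : R, exists D, has_deriv Q t%:C D) ->
  (forall s, s ^+ 2 + y ^+ 2 = r ^+ 2 -> P s%:C = P (- s)%:C) ->
  (forall x, F x = if x ^+ 2 + y ^+ 2 < r ^+ 2 then Im (Q x%:C) else 0) ->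
  (\int[@lebesgue_measure R]_x (F x)%:E = 0)%E.
Proof. by move=> *; apply: (@chord_integral0 (@Im R) P Q r y) => //; exact: dist_Im. Qed.

Lemma pdiskE r x y : 0 < r -> ((x, y) \in pdisk r) = (x ^+ 2 + y ^+ 2 < r ^+ 2).
Proof.
move=> r0; rewrite -cabs_lt_sqr//.
by apply/idP/idP => [/set_mem|h]; [|apply/mem_set].
Qed.

(** The integral of an x-derivative reduces to boundary values. For fixed [y] the primitive is a
    function of a complex variable t restricted to real t, so that complex differentiation rules
    apply. *)
Lemma disk_integral_dx r (g : R * R -> R[i]) (P Q : R -> R[i] -> R[i]) :
  0 < r -> bmeas r g ->
  (forall y t, has_deriv (P y) t%:C (Q y t%:C)) ->
  (forall y t, exists D, has_deriv (Q y) t%:C D) ->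
  (forall y s, s ^+ 2 + y ^+ 2 = r ^+ 2 -> P y s%:C = P y (- s)%:C) ->
  (forall x y, g (x, y) = Q y x%:C) ->
  cint (@area_measure R) (pdisk r) g = 0.
Proof.
move=> r0 [[m1 m2] [M gM]] HP HQ HE Hg; apply: complex_ext => /=;
  apply: (fubini_zero (M := M)) => //.
- by move=> p /gM; apply: le_trans; exact: cabs_Re.
- left => y; apply: (Re_chord_integral0 (HP y) (HQ y) (HE y)) => x.
  by rewrite /patch pdiskE// Hg.
- by move=> p /gM; apply: le_trans; exact: cabs_Im.
- left => y; apply: (Im_chord_integral0 (HP y) (HQ y) (HE y)) => x.
  by rewrite /patch pdiskE// Hg.
Qed.

Lemma disk_integral_dy r (g : R * R -> R[i]) (P Q : R -> R[i] -> R[i]) :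
  0 < r -> bmeas r g ->
  (forall x t, has_deriv (P x) t%:C (Q x t%:C)) ->
  (forall x t, exists D, has_deriv (Q x) t%:C D) ->
  (forall x s, s ^+ 2 + x ^+ 2 = r ^+ 2 -> P x s%:C = P x (- s)%:C) ->
  (forall x y, g (x, y) = Q x y%:C) ->
  cint (@area_measure R) (pdisk r) g = 0.
Proof.
move=> r0 [[m1 m2] [M gM]] HP HQ HE Hg; apply: complex_ext => /=;
  apply: (fubini_zero (M := M)) => //.
- by move=> p /gM; apply: le_trans; exact: cabs_Re.
- right => x; apply: (Re_chord_integral0 (HP x) (HQ x) (HE x)) => y.
  by rewrite /patch pdiskE// Hg addrC.
- by move=> p /gM; apply: le_trans; exact: cabs_Im.
- right => x; apply: (Im_chord_integral0 (HP x) (HQ x) (HE x)) => y.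
  by rewrite /patch pdiskE// Hg addrC.
Qed.

End DiskGreen.

Section MonomialIntegrals.
Context {R : realType}.
Implicit Types (r x y s : R) (t : R[i]).

Notation pt := (@plane_pt R).
Notation mu := (@area_measure R).

Definition mono (a b : nat) (p : R * R) : R[i] := pt p ^+ a * (pt p)^*%C ^+ b.

Lemma bmeas_mono r a b : bmeas r (mono a b).
Proof.
apply: bmeasM; apply: bmeasX; first exact: bmeas_pt.
by apply: bmeasJ; exact: bmeas_pt.
Qed.

Notation I r a b := (cint mu (pdisk r) (mono a b)).

(* The boundary-vanishing function behind both identities is
   [z ^+ p * (`|z| ^+ (2 * b) - r ^+ (2 * b))]. *)
Section Potential.
Variables (r : R) (p b : nat).
Hypothesis r0 : 0 < r.

Let rb : R[i] := (r ^+ 2)%:C ^+ b.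

Lemma potential_int :
  (cint mu (pdisk r) (fun q => p%:R * (mono (p.-1 + b) b q - rb * mono p.-1 0 q)
     + b%:R * (mono (p + b.-1) b.-1 q * (pt q + (pt q)^*%C))) = 0) /\
  (cint mu (pdisk r) (fun q => 'i * (p%:R * (mono (p.-1 + b) b q - rb * mono p.-1 0 q))
     + b%:R * (mono (p + b.-1) b.-1 q * ((pt q - (pt q)^*%C) * - 'i))) = 0).
Proof.
(* With [k = 1], [v = 0 +i* y], [w = y ^+ 2] this is the potential along a horizontal line, and with
   [k = 'i], [v = x], [w = x ^+ 2] along a vertical one; [t ^+ 2 + w] is the squared modulus, a
   polynomial in t. *)
pose P1 (k v w : R[i]) (t : R[i]) : R[i] :=
  (k * t + v) ^+ p * ((t ^+ 2 + w) ^+ b - rb).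
pose Q1 (k v w : R[i]) (t : R[i]) : R[i] :=
  (k * t + v) ^+ p * (b%:R * (t ^+ 2 + w) ^+ b.-1 * (2 * t)) +
  ((t ^+ 2 + w) ^+ b - rb) * (p%:R * (k * t + v) ^+ p.-1 * k).
have Dlin k v t : has_deriv (fun t => k * t + v) t k.
  apply: has_deriv_eq (has_derivD (has_derivZ k (has_deriv_id t)) (has_deriv_cst v t)).
  by rewrite mulr1 addr0.
have Dsq w t : has_deriv (fun t => t ^+ 2 + w) t (2 * t).
  apply: has_deriv_eq (has_derivD (has_derivX 2 t) (has_deriv_cst w t)).
  by rewrite addr0 expr1.
have DX (f : R[i] -> R[i]) n t d : has_deriv f t d ->
    has_deriv (fun t => f t ^+ n) t (n%:R * f t ^+ n.-1 * d).
  by move=> H; apply: (has_deriv_comp (g := fun u => u ^+ n)) H (has_derivX n (f t)).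
have DP k v w t : has_deriv (P1 k v w) t (Q1 k v w t).
  apply: has_derivM; first exact: DX.
  apply: has_deriv_eq (has_derivB (DX _ b t _ (Dsq w t)) (has_deriv_cst rb t)).
  by rewrite subr0.
have DQ k v w t : exists D, has_deriv (Q1 k v w) t D.
  eexists; apply: has_derivD.
    apply: has_derivM; first exact: DX.
    apply: has_derivM; last exact: has_derivZ (has_deriv_id t).
    by apply: has_derivZ; exact: DX.
  apply: has_derivM; first exact: has_derivB (DX _ b t _ (Dsq w t)) (has_deriv_cst rb t).
  apply: has_derivM; last exact: has_deriv_cst.
  by apply: has_derivZ; exact: DX.
have bm a c := bmeas_mono r a c; have bp := bmeas_pt r; have bc := bmeas_cst r.
have boundary (s w : R) : s ^+ 2 + w ^+ 2 = r ^+ 2 ->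
   forall k v, P1 k v (w ^+ 2)%:C s%:C = P1 k v (w ^+ 2)%:C (- s)%:C.
  move=> swr k v; have E (u : R) : u ^+ 2 = s ^+ 2 -> u%:C ^+ 2 + (w ^+ 2)%:C = (r ^+ 2)%:C.
    by move=> us; rewrite -rmorphXn -rmorphD /= us swr.
  by rewrite /P1 !E ?sqrrN// subrr !mulr0.
split.
  apply: (disk_integral_dx (P := fun y => P1 1 (0 +i* y) (y ^+ 2)%:C)
    (Q := fun y => Q1 1 (0 +i* y) (y ^+ 2)%:C) r0).
  - apply: bmeasD; apply: bmeasM => //.
      by apply: bmeasB => //; exact: bmeasM.
    by apply: bmeasM => //; apply: bmeasD => //; exact: bmeasJ.
  - by move=> y t; exact: DP.
  - by move=> y t; exact: DQ.
  - by move=> y s swr; apply: boundary.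
  - move=> x y; rewrite /Q1 /mono (_ : pt (x, y) = x +i* y)//.
    have E1 : 1 * x%:C + (0 +i* y) = x +i* y.
      by apply: complex_ext; rewrite !(re_add, im_add, re_mul, im_mul) /=; ring.
    have E2 : x%:C ^+ 2 + (y ^+ 2)%:C = (x +i* y) * (x +i* y)^*%C.
      by rewrite mulJ_cabs cabs_sqr -rmorphXn -rmorphD.
    have E3 : 2 * x%:C = (x +i* y) + (x +i* y)^*%C.
      by apply: complex_ext; rewrite ?(re_add, im_add, re_mul, im_mul) /=; ring.
    rewrite E1 E2 E3; move: (x +i* y) => z; rewrite expr0 !exprMn !exprD.
    ring.
apply: (disk_integral_dy (P := fun x => P1 'i x%:C (x ^+ 2)%:C)
  (Q := fun x => Q1 'i x%:C (x ^+ 2)%:C) r0).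
- apply: bmeasD; apply: bmeasM => //.
    by apply: bmeasM => //; apply: bmeasB => //; exact: bmeasM.
  apply: bmeasM => //; apply: bmeasM => //.
  by apply: bmeasB => //; exact: bmeasJ.
- by move=> y t; exact: DP.
- by move=> y t; exact: DQ.
- by move=> y s swr; apply: boundary.
- move=> x y; rewrite /Q1 /mono (_ : pt (x, y) = x +i* y)//.
  have E1 : 'i * y%:C + x%:C = x +i* y.
    by apply: complex_ext; rewrite !(re_add, im_add, re_mul, im_mul) /=; ring.
  have E2 : y%:C ^+ 2 + (x ^+ 2)%:C = (x +i* y) * (x +i* y)^*%C.
    by rewrite mulJ_cabs cabs_sqr addrC -rmorphXn -rmorphD.
  have E3 : 2 * y%:C = ((x +i* y) - (x +i* y)^*%C) * - 'i.
    by apply: complex_ext; rewrite ?(re_add, im_add, re_mul, im_mul, re_opp, im_opp) /=; ring.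
  rewrite E1 E2 E3; move: (x +i* y) => z; rewrite expr0 !exprMn !exprD.
  ring.
Qed.

End Potential.

End MonomialIntegrals.

Section MonomialValues.
Context {R : realType}.
Implicit Types (r : R).

Notation pt := (@plane_pt R).
Notation mu := (@area_measure R).
Notation I r f := (cint mu (pdisk r) f).

(** Kept as a symbol: a common nonzero factor of all moments, whose behaviour as r tends to 1
    follows from dominated convergence. *)
Definition disk_area r : R := fine (mu (pdisk r)).

Lemma bmeas_cintZ r (c : R[i]) f : bmeas r f -> I r (fun q => c * f q) = c * I r f.
Proof. by move=> Hf; rewrite cintZ//; [exact: measurable_pdisk|exact: bmeas_cintegrable]. Qed.

Lemma bmeas_cintD r f g : bmeas r f -> bmeas r g ->
  I r (fun q => f q + g q) = I r f + I r g.
Proof.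
move=> Hf Hg; rewrite cintD//; first exact: measurable_pdisk.
  exact: bmeas_cintegrable.
exact: bmeas_cintegrable.
Qed.

Lemma bmeas_cintB r f g : bmeas r f -> bmeas r g ->
  I r (fun q => f q - g q) = I r f - I r g.
Proof.
move=> Hf Hg; rewrite cintB//; first exact: measurable_pdisk.
  exact: bmeas_cintegrable.
exact: bmeas_cintegrable.
Qed.

(** The x- and y-derivatives of the potential are recombined into its Wirtinger derivatives: the
    first identity is the one in [conj z], the second the one in [z]. *)
Lemma potential_identities r p b : 0 < r ->
  b%:R * I r (fun q => mono (p + b.-1) b.-1 q * pt q) = 0 /\
  p%:R * (I r (mono (p.-1 + b) b) - (r ^+ 2)%:C ^+ b * I r (mono p.-1 0)) +
  b%:R * I r (fun q => mono (p + b.-1) b.-1 q * (pt q)^*%C) = 0.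
Proof.
move=> r0; have [E1 E2] := potential_int p b r0.
set A := fun q => p%:R * (mono (p.-1 + b) b q - (r ^+ 2)%:C ^+ b * mono p.-1 0 q).
set B := mono (p + b.-1) b.-1.
have bm a c := bmeas_mono r a c; have bp := bmeas_pt r; have bc := bmeas_cst r.
have bA : bmeas r A by apply: bmeasM => //; apply: bmeasB => //; exact: bmeasM.
have bZ : bmeas r (fun q => B q * pt q) := bmeasM (bm _ _) bp.
have bJ : bmeas r (fun q => B q * (pt q)^*%C) := bmeasM (bm _ _) (bmeasJ bp).
have F1 : I r A + b%:R * (I r (fun q => B q * pt q) + I r (fun q => B q * (pt q)^*%C)) = 0.
  rewrite -(bmeas_cintD bZ bJ) -(bmeas_cintZ _ (bmeasD bZ bJ)) -bmeas_cintD//; last first.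
    exact: bmeasM (bc _) (bmeasD bZ bJ).
  rewrite -[RHS]E1; apply: eq_cint => q _; rewrite /A /B; ring.
have ii : 'i * 'i = -1 :> R[i] by rewrite -expr2 sqr_i.
have F2 : 'i * I r A + b%:R * (- 'i * (I r (fun q => B q * pt q) - I r (fun q => B q * (pt q)^*%C))) = 0.
  have bb := bmeasB bZ bJ.
  rewrite -(bmeas_cintB bZ bJ) -(bmeas_cintZ _ bb) -(bmeas_cintZ _ (bmeasM (bc _) bb)).
  rewrite -(bmeas_cintZ _ bA) -bmeas_cintD//; last 2 first.
  - exact: bmeasM (bc _) bA.
  - exact: bmeasM (bc _) (bmeasM (bc _) bb).
  rewrite -[RHS]E2; apply: eq_cint => q _; rewrite /A /B; ring.
have AE : I r A = p%:R * (I r (mono (p.-1 + b) b) - (r ^+ 2)%:C ^+ b * I r (mono p.-1 0)).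
  rewrite bmeas_cintZ; last by apply: bmeasB => //; exact: bmeasM.
  by rewrite bmeas_cintB ?bmeas_cintZ//; exact: bmeasM.
rewrite -AE.
move: (I r A) (I r (fun q => B q * pt q)) (I r (fun q => B q * (pt q)^*%C)) F1 F2.
move=> a x y F1 F2.
have {F2}F2 : a - b%:R * (x - y) = 0.
  have -> : a - b%:R * (x - y) = - 'i * ('i * a + b%:R * (- 'i * (x - y))).
    have -> : - 'i * ('i * a + b%:R * (- 'i * (x - y))) =
      - ('i * 'i) * a + ('i * 'i) * (b%:R * (x - y)) by ring.
    by rewrite ii; ring.
  by rewrite F2 mulr0.
have n2 : (2 : R[i]) != 0 by rewrite pnatr_eq0.
split; apply: (mulfI n2); rewrite mulr0.
  by transitivity ((a + b%:R * (x + y)) - (a - b%:R * (x - y)));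
    [ring|rewrite F1 F2 subrr].
by transitivity ((a + b%:R * (x + y)) + (a - b%:R * (x - y)));
  [ring|rewrite F1 F2 addr0].
Qed.

Lemma mono_int_pow r n : 0 < r ->
  I r (mono n 0) = if n == 0%N then (disk_area r)%:C else 0.
Proof.
move=> r0; case: n => [|n] /=.
  have -> : mono 0 0 = (fun=> 1 : R[i]) by apply/funext => p; rewrite /mono !expr0 mul1r.
  by rewrite cint_cst ?mul1r//; exact: measurable_pdisk.
have [E _] := potential_identities n 1 r0; move: E; rewrite mul1r => E.
rewrite -[RHS]E; apply: eq_cint => q _.
by rewrite /mono /= addn0 !expr0 !mulr1 exprSr.
Qed.

(** For positive b, the second identity at [n.+1] and b expresses this integral through that of
    [mono n 0], which vanishes unless n = 0. *)
Lemma mono_int_ge r n b : 0 < r ->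
  I r (mono (n + b) b) =
  if n == 0%N then (r ^+ (2 * b) / b.+1%:R * disk_area r)%:C else 0.
Proof.
move=> r0; have E0 := mono_int_pow n r0.
case: b => [|b].
  by rewrite addn0 E0 muln0 expr0 divr1 mul1r.
have [_] := potential_identities n.+1 b.+1 r0; rewrite /=.
have -> : I r (fun q => mono (n.+1 + b) b q * (pt q)^*%C) = I r (mono (n + b.+1) b.+1).
  by apply: eq_cint => q _; rewrite /mono -mulrA -exprSr addSnnS.
rewrite E0 mulrBr addrAC -mulrDl -natrD => /eqP; rewrite subr_eq0 => /eqP E.
have c0 : ((n.+1 + b.+1)%:R : R[i]) != 0 by rewrite pnatr_eq0.
apply: (mulfI c0); rewrite E; case: n {E0 E c0} => [|n] /=; last by rewrite !mulr0.
have -> : (r ^+ (2 * b.+1) / b.+2%:R * disk_area r)%:C =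
    (r ^+ 2)%:C ^+ b.+1 / b.+2%:R * (disk_area r)%:C.
  by rewrite exprM -rmorphXn -[in RHS](rmorph_nat (real_complex R)) -fmorphV -!rmorphM.
by rewrite mul1r add1n [RHS]mulrA [_.+2%:R * _]mulrC mulfVK// pnatr_eq0.
Qed.

Lemma mono_int r a b : 0 < r ->
  I r (mono a b) =
  if a == b then (r ^+ (2 * b) / b.+1%:R * disk_area r)%:C else 0.
Proof.
move=> r0; have [ba|ab] := leqP b a.
  rewrite -{1}(subnK ba) mono_int_ge//.
  by rewrite subn_eq0 eqn_leq ba andbT.
have -> : I r (mono a b) = I r (fun p => (mono b a p)^*%C).
  apply: eq_cint => p _; rewrite /mono; move: (pt p) => z.
  have -> : (z ^+ b * z^*%C ^+ a)^*%C = z^*%C ^+ b * (z^*%C)^*%C ^+ a.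
    by rewrite -!rmorphXn -rmorphM.
  by rewrite conjcK mulrC.
rewrite cintJ; [|exact: measurable_pdisk|exact/bmeas_cintegrable/bmeas_mono].
rewrite -{1}(subnK (ltnW ab)) mono_int_ge//.
have -> : (b - a == 0)%N = false by rewrite subn_eq0 leqNgt ab.
by rewrite conjc0 ltn_eqF.
Qed.

End MonomialValues.

(** * Bergman functions and exhaustion by disks *)

Section ComplexLimits.
Context {R : realType}.
Implicit Types (u v : nat -> R[i]) (l : R[i]).

Lemma clim_cst l : clim (fun=> l) l.
Proof. by move=> e e0; exists 0%N => n _; rewrite subrr cabs0. Qed.

Lemma climM u v l l' : clim u l -> clim v l' -> clim (fun n => u n * v n) (l * l').
Proof.
move=> Hu Hv e e0.
have l0 : 0 < cabs l + 1 by rewrite ltr_wpDl ?cabs_ge0.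
have l1 : 0 < cabs l' + 1 by rewrite ltr_wpDl ?cabs_ge0.
have [|N HN] := Hu (e / 2 / (cabs l' + 1)); first by rewrite !divr_gt0.
have [|N' HN'] := Hv (Num.min 1 (e / 2 / (cabs l + 1))).
  by rewrite lt_min ltr01 !divr_gt0.
exists (maxn N N') => n; rewrite geq_max => /andP[/HN h1 /HN'].
rewrite lt_min => /andP[h2 h3].
have vb : cabs (v n) <= cabs l' + 1.
  rewrite -[v n](subrK l') (le_trans (cabsD _ _))// addrC lerD2l cabsB; exact: ltW.
have -> : l * l' - u n * v n = (l - u n) * v n + l * (l' - v n) by ring.
apply: le_lt_trans (cabsD _ _) _; rewrite [e]splitr !cabsM; apply: ltr_leD.
  apply: le_lt_trans (ler_wpM2l (cabs_ge0 _) vb) _.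
  by move: h1; rewrite ltr_pdivlMr.
apply: (@le_trans _ _ ((cabs l + 1) * cabs (l' - v n))).
  by rewrite ler_wpM2r ?cabs_ge0// lerDl.
by rewrite mulrC -ler_pdivlMr// ltW.
Qed.

Lemma climX u l k : clim u l -> clim (fun n => u n ^+ k) (l ^+ k).
Proof.
move=> H; elim: k => [|k IH]; first exact: clim_cst.
by under eq_fun do rewrite exprS; rewrite exprS; exact: climM.
Qed.

Lemma eq_clim u v l : (forall n, u n = v n) -> clim u l -> clim v l.
Proof. by move=> /funext ->. Qed.

Lemma clim_complex (x y : nat -> R) (a b : R) : x @ \oo --> a -> y @ \oo --> b ->
  clim (fun n => x n +i* y n) (a +i* b).
Proof.
move=> /cvgrPdist_lt Hx /cvgrPdist_lt Hy e e0.
have e2 : 0 < e / 2 by rewrite divr_gt0.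
have [N _ HN] := Hx _ e2; have [N' _ HN'] := Hy _ e2.
exists (maxn N N') => n; rewrite geq_max => /andP[/HN h1 /HN' h2].
apply: le_lt_trans (cabs_ReIm _) _.
by rewrite re_add im_add re_opp im_opp [e]splitr ltrD.
Qed.

(** Radii tending to 1; the division by 2 keeps the one at k = 0 positive. *)
Definition disk_radius (k : nat) : R := 1 - (k.+1%:R)^-1 / 2.

Lemma disk_radius_itv k : 0 < disk_radius k < 1.
Proof.
have k0 : 0 < (k.+1%:R : R)^-1 by rewrite invr_gt0 ltr0n.
have k1 : (k.+1%:R : R)^-1 <= 1 by rewrite invf_le1 ?ltr0n// ler1n.
by rewrite /disk_radius; move: (_^-1) k0 k1 => x x0 x1; apply/andP; split; lra.
Qed.

Lemma disk_radius_cvg : disk_radius @ \oo --> (1 : R).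
Proof.
have -> : (1 : R) = 1 - 0 / 2 by rewrite mul0r subr0.
apply: (@cvgB _ R^o); first exact: cvg_cst.
apply: (@cvgM _ _ _ _ (@harmonic R)); [exact: cvg_harmonic|exact: cvg_cst].
Qed.

Lemma clim_disk_radius : clim (fun k => (disk_radius k)%:C) 1.
Proof. exact: clim_complex disk_radius_cvg (cvg_cst _). Qed.

Lemma disk_radius_gt (x : R) : x < 1 -> \forall k \near \oo, x < disk_radius k.
Proof.
move=> x1; have d0 : 0 < 1 - x by rewrite subr_gt0.
have /cvgrPdist_lt/(_ _ d0) := disk_radius_cvg; apply: filterS => k.
have /andP[_ k1] := disk_radius_itv k.
by rewrite gtr0_norm ?subr_gt0// ltrD2l ltrN2.
Qed.

End ComplexLimits.

Section DiskExhaustion.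
Context {R : realType}.
Notation mu := (@area_measure R).

(** Each point of the open disk lies in all but finitely many of the smaller disks, so dominated
    convergence applies to the truncations of [g]. *)
Lemma Rintegral_disk_lim (g : R * R -> R) :
  mu.-integrable (pdisk 1) (EFin \o g) ->
  (fun k => Rintegral mu (pdisk (disk_radius k)) g) @ \oo --> Rintegral mu (pdisk 1) g.
Proof.
move=> ig; have mD r := measurable_pdisk (R := R) r.
have sub k : pdisk (disk_radius k) `<=` pdisk (1 : R).
  by move=> p /= h; apply: lt_trans h _; have /andP[] := @disk_radius_itv R k.
pose f_ k : R * R -> \bar R := EFin \o (g \_ (pdisk (disk_radius k))).
have mg : measurable_fun (pdisk 1) g by apply/measurable_EFinP; exact: measurable_int ig.
have mf_ k : measurable_fun (pdisk 1) (f_ k).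
  apply/measurable_EFinP; apply/(measurable_restrict _ (mD _) (mD _)).
  exact: measurable_funS mg.
have := @dominated_convergence _ _ _ mu (pdisk 1) (mD 1) f_ (EFin \o g)
  (fun p => `|(EFin \o g) p|%E) mf_ _ _ _ _.
case.
- exact/measurable_EFinP.
- apply/aeW => p pD; apply: cvg_near_cst; apply: filterS (disk_radius_gt pD) => k pk.
  by rewrite /f_ /= /patch mem_set.
- exact: integrable_abse.
- apply/aeW => p k pD; rewrite /f_ /= /patch; case: ifP => // _.
  by rewrite normr0 lee_fin.
have fE : ((Rintegral mu (pdisk 1) g)%:E = \int[mu]_(x in pdisk 1) (EFin \o g) x)%E.
  by rewrite /Rintegral fineK//; exact: integrable_fin_num.
rewrite -fE => _ _ /fine_cvg H.
have e k : (\int[mu]_(x in pdisk (disk_radius k)) (g x)%:E = \int[mu]_(x in pdisk 1) f_ k x)%E.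
  have {1}-> : pdisk (disk_radius k) = pdisk 1 `&` pdisk (disk_radius k) :> set (R * R).
    by rewrite setIidr//; exact: sub.
  rewrite integral_mkcondr; apply: eq_integral => p _.
  by rewrite /f_ /= /patch; case: ifP.
rewrite (_ : (fun k => _) = fine \o [sequence (\int[mu]_(x in pdisk 1) f_ n x)%E]_n)//.
by apply/funext => k; rewrite /Rintegral e.
Qed.

Lemma cint_disk_lim (g : R * R -> R[i]) : cintegrable mu (pdisk 1) g ->
  clim (fun k => cint mu (pdisk (disk_radius k)) g) (cint mu (pdisk 1) g).
Proof. by move=> [i1 i2]; apply: clim_complex; exact: Rintegral_disk_lim. Qed.

End DiskExhaustion.

Section SeriesIntegrals.
Context {R : realType}.
Implicit Types (r : R) (a b : nat -> R[i]) (f h : R[i] -> R[i]) (G : R * R -> R[i]).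
Notation pt := (@plane_pt R).
Notation mu := (@area_measure R).
Notation I r f := (cint mu (pdisk r) f).

Lemma pser_cmeasurable a f : pser a f 1 -> cmeasurable (pdisk 1) (fun p => f (pt p)).
Proof.
move=> Hf.
have ms n : cmeasurable (pdisk 1) (fun p : R * R => \sum_(k < n) a k * pt p ^+ k).
  apply: cmeasurable_sum => k; apply: cmeasurableM; first exact: cmeasurable_cst.
  by apply: cmeasurableX; exact: cmeasurable_plane_pt.
have cv (g : R[i] -> R) : (forall z w, `|g z - g w| <= cabs (z - w)) ->
    forall p, pdisk 1 p -> (fun n => g (\sum_(k < n) a k * pt p ^+ k)) @ \oo --> g (f (pt p)).
  move=> gl p pD; apply/cvgrPdist_lt => e e0; have [N HN] := Hf _ pD _ e0.
  by exists N => // n /HN; apply: le_lt_trans; exact: gl.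
split.
  apply: (measurable_fun_cvg (h := fun n (p : R * R) => Re (\sum_(k < n) a k * pt p ^+ k))).
    by move=> n; case: (ms n).
  by move=> p pD; apply: (cv (@Re R)) => //; exact: dist_Re.
apply: (measurable_fun_cvg (h := fun n (p : R * R) => Im (\sum_(k < n) a k * pt p ^+ k))).
  by move=> n; case: (ms n).
by move=> p pD; apply: (cv (@Im R)) => //; exact: dist_Im.
Qed.

Lemma cmeasurable_subdisk r (g : R * R -> R[i]) : r <= 1 -> cmeasurable (pdisk 1) g -> cmeasurable (pdisk r) g.
Proof.
have mD := measurable_pdisk (R := R).
move=> r1 [m1 m2]; have s : pdisk r `<=` pdisk (1 : R).
  by move=> p /= h; exact: lt_le_trans h r1.
by split; [apply: measurable_funS m1|apply: measurable_funS m2].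
Qed.

Lemma pser_bmeas a f r : pser a f 1 -> 0 < r < 1 -> bmeas r (fun p => f (pt p)).
Proof.
move=> Hf r01; have [r0 r1] := andP r01; split.
  by apply: cmeasurable_subdisk (ltW r1) _; exact: pser_cmeasurable Hf.
have [M _ [q _ HM]] := pser_uniform Hf r01.
exists M => p pr; have := HM (pt p) 0%N (ltW pr).
by rewrite big_ord0 subr0 expr0 mulr1.
Qed.

(** Since r < 1, the partial sums converge uniformly on the disk of radius r, and [G] is bounded
    there. *)
Lemma pser_int a f r G : pser a f 1 -> 0 < r < 1 -> bmeas r G ->
  has_sum (fun n => a n * I r (fun p => mono n 0 p * G p)) (I r (fun p => f (pt p) * G p)).
Proof.
move=> Hf r01 HG; have [r0 r1] := andP r01; have mD := measurable_pdisk (R := R) r.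
have bf := pser_bmeas Hf r01; have [M M0 [q q01 HM]] := pser_uniform Hf r01.
have [mG [C HC]] := HG.
have bt n : bmeas r (fun p => a n * (mono n 0 p * G p)).
  by apply: bmeasM; [exact: bmeas_cst|apply: bmeasM => //; exact: bmeas_mono].
have ib n := bmeas_cintegrable (bt n).
pose s N := fun p => \sum_(k < N) a k * (mono k 0 p * G p).
have is_ N : cintegrable mu (pdisk r) (s N).
  by apply: cintegrable_sum => //; exact: area_pdisk_lty.
have C0 : 0 <= `|C| by [].
have cv := @cint_cvg _ _ _ mu (pdisk r) (fun p => f (pt p) * G p) s mD (area_pdisk_lty r)
  (bmeas_cintegrable (bmeasM bf HG)) is_.
have Cp : 0 < `|C| + 1 by rewrite ltr_wpDl.
have unif e : 0 < e -> exists N0, forall n, (N0 <= n)%N ->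
     forall p, pdisk r p -> cabs (f (pt p) * G p - s n p) <= e.
  move=> e0; have [N0 HN0] := geom_small (M * (`|C| + 1)) q01 e0.
  exists N0 => n /HN0 h p pr; apply: ltW; apply: le_lt_trans h.
  have -> : s n p = (\sum_(k < n) a k * pt p ^+ k) * G p.
    rewrite /s mulr_suml; apply: eq_bigr => k _.
    by rewrite /mono expr0 mulr1 mulrA.
  rewrite -mulrBl cabsM mulrAC; apply: ler_pM; rewrite ?cabs_ge0//.
    exact: HM (ltW pr).
  by apply: le_trans (HC p pr) _; apply: le_trans (ler_norm _) _; rewrite lerDl.
move=> e e0; have [N0 HN0] := cv unif e e0.
exists N0 => n /HN0; rewrite cint_sum//; last exact: area_pdisk_lty.
congr (cabs (_ - _) < _); apply: eq_bigr => k _.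
by rewrite bmeas_cintZ//; apply: bmeasM => //; exact: bmeas_mono.
Qed.

(** By orthogonality of the monomials only the index n with n + p = q survives. *)
Lemma pser_mono_int a f r p q : pser a f 1 -> 0 < r < 1 ->
  I r (fun x => f (pt x) * mono p q x) =
  if (p <= q)%N then a (q - p)%N * (r ^+ (2 * q) / q.+1%:R * disk_area r)%:C else 0.
Proof.
move=> Hf r01; have [r0 r1] := andP r01.
have := pser_int Hf r01 (bmeas_mono r p q).
have E n : I r (fun x => mono n 0 x * mono p q x) =
    if (n + p == q)%N then (r ^+ (2 * q) / q.+1%:R * disk_area r)%:C else 0.
  rewrite -mono_int//; apply: eq_cint => x _.
  by rewrite /mono expr0 mulr1 mulrA exprD.
under [fun n => _]eq_fun do rewrite E.
move/has_sum_unique; apply; case: leqP => [pq|qp].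
  move=> e e0; exists (q - p).+1 => N qN.
  rewrite (bigD1 (Ordinal qN)) //= subnK// eqxx big1 ?addr0 ?subrr ?cabs0// => i.
  rewrite -val_eqE /= => /negPf iq; case: ifP => [/eqP h|]; last by rewrite mulr0.
  by rewrite -h addnK eqxx in iq.
apply: eq_has_sum has_sum0 => n; case: ifP => [/eqP h|]; last by rewrite mulr0.
by move: qp; rewrite -h ltnNge leq_addl.
Qed.

End SeriesIntegrals.

(** * Bergman functions and the kernel as an orthogonality condition *)

Section Bergman.
Context {R : realType}.
Implicit Types (r : R) (a b : nat -> R[i]) (f g h k : R[i] -> R[i]).
Notation pt := (@plane_pt R).
Notation mu := (@area_measure R).
Notation I r f := (cint mu (pdisk r) f).

Lemma holomorphic_on_diskP f : holomorphic_on_disk f <->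
  (forall z, cabs z < 1 -> exists d, has_deriv f z d).
Proof.
split=> H z.
  by move=> z1; apply: derivable_has_deriv; apply: H; apply/unit_diskE.
by move=> /unit_diskE /H[d /has_deriv_derivable].
Qed.

Lemma innerE f g : inner f g = I 1 (fun p => f (pt p) * (g (pt p))^*%C).
Proof. by rewrite /inner /disk_integral plane_diskE. Qed.

Lemma bergman_pser f : bergman_space f -> exists a, pser a f 1.
Proof. by move=> [/holomorphic_on_diskP/holomorphic_pser]. Qed.

Definition sq_integrable f : Prop :=
  cmeasurable (pdisk 1) (fun p => f (pt p)) /\
  mu.-integrable (pdisk 1) (EFin \o (fun p => cabs (f (pt p)) ^+ 2)).

Lemma L2_diskP f : L2_disk f <-> sq_integrable f.
Proof.
rewrite /L2_disk plane_diskE.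
have E : (fun p : R * R => (Re (f (pt p)) ^+ 2 + Im (f (pt p)) ^+ 2)%:E) =
    EFin \o (fun p => cabs (f (pt p)) ^+ 2).
  by apply/funext => p /=; rewrite cabs_sqr.
split=> [[m1 m2]|[[m1 m2]]].
  rewrite E => H; split => //; apply/integrableP; split.
    rewrite -E; apply/measurable_EFinP.
    by apply: measurable_funD; exact: measurable_funX.
  by under eq_integral do rewrite /= ger0_norm ?exprn_ge0 ?cabs_ge0//.
move=> /integrableP[_ H]; split => //; rewrite E.
by move: H; under eq_integral do rewrite /= ger0_norm ?exprn_ge0 ?cabs_ge0//.
Qed.

(** The product of the moduli is at most [|f|^2 + |g|^2]; the bounded factor [u] makes room for the
    symbol. *)
Lemma sq_integrable_mul f g (u : R * R -> R[i]) : bmeas 1 u ->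
  sq_integrable f -> sq_integrable g ->
  cintegrable mu (pdisk 1) (fun p => f (pt p) * (g (pt p))^*%C * u p).
Proof.
move=> [mu1 [C HC]] [mf If] [mg Ig]; have mD := measurable_pdisk (R := R) 1.
have C0 : 0 <= `|C| by [].
apply: (@cintegrable_dominated _ _ _ mu (pdisk 1) _
  (fun p => `|C| * (cabs (f (pt p)) ^+ 2 + cabs (g (pt p)) ^+ 2)) mD).
- by apply: cmeasurableM => //; apply: cmeasurableM => //; exact: cmeasurableJ.
- move=> p pD; rewrite !cabsM cabs_conj mulrC.
  have := HC p pD; have := ler_norm C; have c0 := cabs_ge0 (u p).
  have f0 := cabs_ge0 (f (pt p)); have g0 := cabs_ge0 (g (pt p)).
  move=> h1 h2; apply: ler_pM => //; first exact: mulr_ge0.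
    exact: le_trans h2 h1.
  have : 0 <= (cabs (f (pt p)) - cabs (g (pt p))) ^+ 2 by exact: sqr_ge0.
  nra.
- have := integrableZl mD `|C| (integrableD mD If Ig).
  by apply: eq_integrable.
Qed.

Lemma bounded_bergman f (M : R) : holomorphic_on_disk f ->
  (forall z, cabs z < 1 -> cabs (f z) <= M) -> bergman_space f.
Proof.
move=> Hf HM; split => //; apply/L2_diskP.
have [a Ha] : exists a, pser a f 1 by apply/holomorphic_pser/holomorphic_on_diskP.
have mf := pser_cmeasurable Ha; split => //.
have [m1 m2] := mf.
apply: measurable_bounded_integrable; [exact: measurable_pdisk|exact: area_pdisk_lty| |].
  under eq_fun do rewrite cabs_sqr.
  by apply: measurable_funD; exact: measurable_funX.
exists (M ^+ 2); split; first exact: num_real.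
move=> x Mx p pD /=; rewrite ger0_norm ?exprn_ge0 ?cabs_ge0//.
apply: le_trans (ltW Mx); rewrite lerXn2r ?nnegrE ?cabs_ge0 ?HM//.
exact: le_trans (cabs_ge0 _) (HM _ pD).
Qed.

Lemma bergman_pow n : bergman_space (fun z : R[i] => z ^+ n).
Proof.
apply: (bounded_bergman (M := 1)).
  by apply/holomorphic_on_diskP => z _; eexists; exact: has_derivX.
by move=> z /ltW z1; rewrite cabsX exprn_ile1 ?cabs_ge0.
Qed.

Lemma bmeas_poly_symbol m (alpha beta : R[i]) r :
  bmeas r (fun p => symbol m alpha beta (pt p)).
Proof.
apply: bmeasD; last exact: bmeas_cst.
apply: bmeasD.
  by apply: bmeasX; apply: bmeasJ; exact: bmeas_pt.
by apply: bmeasM; [exact: bmeas_cst|apply: bmeasX; exact: bmeas_pt].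
Qed.

Lemma disk_area_lim : clim (fun i => (disk_area (disk_radius i))%:C) (disk_area (1 : R))%:C.
Proof.
have mD := measurable_pdisk (R := R).
have E r : (disk_area r)%:C = I r (fun=> 1) by rewrite cint_cst ?mul1r.
rewrite E; under eq_fun do rewrite E.
by apply: cint_disk_lim; apply: cintegrable_cst => //; exact: area_pdisk_lty.
Qed.

Lemma disk_area_neq0 r : 0 < r -> (disk_area r)%:C != 0 :> R[i].
Proof. by move=> r0; rewrite -cabs_gt0 cabs_real normr_gt0 gt_eqF// area_pdisk_gt0. Qed.

(** The pairing is computed termwise on smaller disks, where convergence is uniform, and the radius
    then tends to 1. *)
Lemma bergman_coef_inner f a n : bergman_space f -> pser a f 1 ->
  inner f (fun z => z ^+ n) = a n / n.+1%:R * (disk_area (1 : R))%:C.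
Proof.
move=> Bf Ha; rewrite innerE.
have E (p : R * R) : f (pt p) * (pt p ^+ n)^*%C = f (pt p) * mono 0 n p.
  by rewrite /mono expr0 mul1r rmorphXn.
have ci : cintegrable mu (pdisk 1) (fun p => f (pt p) * (pt p ^+ n)^*%C).
  have [_ /L2_diskP sf] := Bf; have [_ /L2_diskP sp] := bergman_pow n.
  have := sq_integrable_mul (bmeas_cst 1 1) sf sp.
  by under eq_fun do rewrite mulr1.
apply: (clim_unique (cint_disk_lim ci)).
have L : clim (fun i => a n / n.+1%:R * ((disk_radius i)%:C ^+ (2 * n) * (disk_area (disk_radius i))%:C))
   (a n / n.+1%:R * (1 ^+ (2 * n) * (disk_area (1 : R))%:C)).
  apply: climM; first exact: clim_cst.
  by apply: climM; [apply: climX; exact: clim_disk_radius|exact: disk_area_lim].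
move: L; rewrite expr1n mul1r; apply: eq_clim => i.
transitivity (I (disk_radius i) (fun p => f (pt p) * mono 0 n p)); last first.
  by apply: eq_cint => p _; rewrite E.
rewrite (pser_mono_int 0 n Ha (disk_radius_itv i)) /= subn0.
rewrite -rmorphXn -[in LHS](rmorph_nat (real_complex R)) -fmorphV -!mulrA; congr (_ * _).
by rewrite -!rmorphM /=; congr (_%:C); ring.
Qed.

Lemma bergman_orth_eq0 f : bergman_space f ->
  (forall k, bergman_space k -> inner f k = 0) -> forall z, unit_disk z -> f z = 0.
Proof.
move=> Bf H z /unit_diskE z1; have [a Ha] := bergman_pser Bf.
have a0 n : a n = 0.
  have := H _ (bergman_pow n); rewrite (bergman_coef_inner n Bf Ha) => /eqP.
  rewrite mulf_eq0 (negPf (disk_area_neq0 ltr01)) orbF mulf_eq0 invr_eq0 pnatr_eq0 orbF.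
  by move/eqP.
apply: (has_sum_unique (Ha z z1)); apply: eq_has_sum has_sum0 => n.
by rewrite a0 mul0r.
Qed.

(** If the chosen function vanishes on the disk, it is a genuine projection, and its defining
    orthogonality becomes that of [g]. Conversely, when [g] is orthogonal to the Bergman space, 0 is
    a projection, and every projection is orthogonal to the whole space, itself included, hence 0 on
    the disk. *)
Lemma toeplitz_kernelP m (alpha beta : R[i]) f :
  toeplitz_kernel (symbol m alpha beta) f <->
  bergman_space f /\
  forall k, bergman_space k -> inner (fun z => symbol m alpha beta z * f z) k = 0.
Proof.
set phi := symbol m alpha beta; set g := fun z => phi z * f z.
have mD := measurable_pdisk (R := R) 1.
have zero_proj h : bergman_space f -> is_bergman_projection g h ->
    (forall k, bergman_space k -> inner g k = 0) -> forall z, unit_disk z -> h z = 0.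
  move=> Bf [Bh Hh] Hg; apply: bergman_orth_eq0 => // k Bk.
  have [_ /L2_diskP sf] := Bf; have [_ /L2_diskP sh] := Bh; have [_ /L2_diskP sk] := Bk.
  have i1 : cintegrable mu (pdisk 1) (fun p => g (pt p) * (k (pt p))^*%C).
    have := sq_integrable_mul (bmeas_poly_symbol m alpha beta 1) sf sk.
    by congr cintegrable; apply/funext => p; rewrite /g /phi; ring.
  have i2 : cintegrable mu (pdisk 1) (fun p => h (pt p) * (k (pt p))^*%C).
    have := sq_integrable_mul (bmeas_cst 1 1) sh sk.
    by under eq_fun do rewrite mulr1.
  have := Hh k Bk; rewrite innerE.
  under [fun p => _]eq_fun do rewrite mulrBl.
  by rewrite cintB// -!innerE Hg// sub0r => /eqP; rewrite oppr_eq0 => /eqP.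
split=> -[Bf H]; split => //.
  have [h Hh] : exists h, is_bergman_projection g h.
    (* Without a projection [xget] returns the constant 1, which does not vanish at 0. *)
    apply: contrapT => nex; have := H 0; rewrite /toeplitz /bergman_projection xgetPN.
      by move=> /(_ ltac:(by apply/unit_diskE; rewrite cabs0)) /eqP; rewrite oner_eq0.
    by move=> h Hh; apply: nex; exists h.
  have := xgetI (fun=> 1) Hh => -[_ Hp] k Bk.
  rewrite -(Hp k Bk) !innerE; apply: eq_cint => p pD; congr (_ * _).
  have h0 : xget (fun=> 1) [set h | is_bergman_projection g h] (pt p) = 0.
    by apply: H; apply/unit_diskE.
  by rewrite h0 subr0.
move=> z zD; have P0 : is_bergman_projection g (fun=> 0).
  split.
    apply: (bounded_bergman (M := 0)); last by move=> *; rewrite cabs0.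
    by apply/holomorphic_on_diskP => w _; exists 0; exact: has_deriv_cst.
  move=> k Bk; rewrite -[RHS](H k Bk) !innerE; apply: eq_cint => p _.
  by rewrite subr0.
exact: zero_proj Bf (xgetI (fun=> 1) P0) H z zD.
Qed.

End Bergman.

(** * The kernel in terms of Taylor coefficients *)

Section KernelRecurrence.
Context {R : realType}.
Variables (m : nat) (alpha beta : R[i]).
Implicit Types (r : R) (a b : nat -> R[i]) (f g h k : R[i] -> R[i]).
Notation pt := (@plane_pt R).
Notation mu := (@area_measure R).
Notation I r f := (cint mu (pdisk r) f).

(** The integral of [|z| ^ (2 q)] over the disk of radius r. *)
Definition moment r (q : nat) : R[i] := (r ^+ (2 * q) / q.+1%:R * disk_area r)%:C.

(** The Taylor coefficient of index n of [(alpha * z ^+ m + beta) * f z]. *)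
Definition lower_coef a (n : nat) : R[i] :=
  beta * a n + (if (m <= n)%N then alpha * a (n - m)%N else 0).

(** At radius 1 the moments are proportional to 1 / (q + 1); this is the vanishing of the pairing
    with [z ^+ n], cleared of denominators. *)
Definition kernel_rec a : Prop := forall n,
  n.+1%:R * a (n + m)%N + (n + m).+1%:R * lower_coef a n = 0.

(* The parameter [c] is [1] for the symbol itself and [r ^- (2 * m)] for its
   perturbation that annihilates every monomial on the disk of radius [r]. *)
Definition weighted_symbol (c : R[i]) (p : R * R) : R[i] :=
  c * (pt p)^*%C ^+ m + alpha * pt p ^+ m + beta.

Lemma bmeas_weighted_symbol r c : bmeas r (weighted_symbol c).
Proof.
apply: bmeasD; last exact: bmeas_cst.
apply: bmeasD; apply: bmeasM; try exact: bmeas_cst; apply: bmeasX.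
  by apply: bmeasJ; exact: bmeas_pt.
exact: bmeas_pt.
Qed.

Lemma weighted_symbol_int a f r c n : pser a f 1 -> 0 < r < 1 ->
  I r (fun p => f (pt p) * weighted_symbol c p * (pt p)^*%C ^+ n) =
  c * (a (n + m)%N * moment r (n + m)) + lower_coef a n * moment r n.
Proof.
move=> Hf r01; have bf := pser_bmeas Hf r01.
have bm p q := bmeasM bf (bmeas_mono r p q).
have bc := bmeas_cst r.
transitivity (I r (fun p => c * (f (pt p) * mono 0 (n + m) p) +
  (alpha * (f (pt p) * mono m n p) + beta * (f (pt p) * mono 0 n p)))).
  apply: eq_cint => p _; rewrite /weighted_symbol /mono expr0 exprD.
  by move: (pt p) ((pt p)^*%C) (f (pt p)) => v w u; ring.
have b1 := bmeasM (bc c) (bm 0%N (n + m)%N).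
have b2 := bmeasM (bc alpha) (bm m n).
have b3 := bmeasM (bc beta) (bm 0%N n).
rewrite (bmeas_cintD b1 (bmeasD b2 b3)) (bmeas_cintD b2 b3) !bmeas_cintZ//.
rewrite !(pser_mono_int _ _ Hf r01) /= !subn0 -/(moment _ _) -/(moment _ _) /lower_coef.
by case: ifP => _; ring.
Qed.

Lemma symbol_weighted p : symbol m alpha beta (pt p) = weighted_symbol 1 p.
Proof. by rewrite /symbol /weighted_symbol mul1r. Qed.

Lemma momentE r q : moment r q = r%:C ^+ (2 * q) / q.+1%:R * (disk_area r)%:C.
Proof.
by rewrite /moment -rmorphXn -[in RHS](rmorph_nat (real_complex R)) -fmorphV -!rmorphM.
Qed.

Lemma moment_lim q : clim (fun i => moment (disk_radius i) q)
  ((q.+1%:R)^-1 * (disk_area (1 : R))%:C).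
Proof.
have L : clim (fun i => (disk_radius i)%:C ^+ (2 * q) / q.+1%:R * (disk_area (disk_radius i))%:C)
   (1 ^+ (2 * q) / q.+1%:R * (disk_area (1 : R))%:C).
  apply: climM; last exact: disk_area_lim.
  by apply: climM; [apply: climX; exact: clim_disk_radius|exact: clim_cst].
move: L; rewrite expr1n mul1r; apply: eq_clim => i.
by rewrite momentE.
Qed.

Lemma kernel_symbol_integrable f g c : bergman_space f -> bergman_space g ->
  cintegrable mu (pdisk 1) (fun p => f (pt p) * weighted_symbol c p * (g (pt p))^*%C).
Proof.
move=> [_ /L2_diskP sf] [_ /L2_diskP sg].
have := sq_integrable_mul (bmeas_weighted_symbol 1 c) sf sg.
by congr cintegrable; apply/funext => p; rewrite mulrAC.
Qed.

Lemma inner_symbolE f g : inner (fun z => symbol m alpha beta z * f z) g =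
  I 1 (fun p => f (pt p) * weighted_symbol 1 p * (g (pt p))^*%C).
Proof.
rewrite innerE; apply: eq_cint => p _.
by rewrite symbol_weighted [f _ * _]mulrC.
Qed.

Lemma kernel_to_rec a f : pser a f 1 ->
  toeplitz_kernel (symbol m alpha beta) f -> kernel_rec a.
Proof.
move=> Hf /toeplitz_kernelP[Bf H] n.
have := H _ (bergman_pow n); rewrite inner_symbolE => I0.
have ci := kernel_symbol_integrable 1 Bf (bergman_pow n).
have := cint_disk_lim ci; rewrite I0 => L.
have E i : I (disk_radius i) (fun p => f (pt p) * weighted_symbol 1 p * (pt p ^+ n)^*%C) =
   a (n + m)%N * moment (disk_radius i) (n + m) + lower_coef a n * moment (disk_radius i) n.
  rewrite -[a (n + m)%N * _]mul1r -(weighted_symbol_int _ _ Hf (disk_radius_itv i)).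
  by apply: eq_cint => p _; rewrite rmorphXn.
have L' := climD (climM (clim_cst (a (n + m)%N)) (moment_lim (n + m)))
  (climM (clim_cst (lower_coef a n)) (moment_lim n)).
have := clim_unique (eq_clim E L) L'.
rewrite !mulrA -mulrDl => /esym/eqP; rewrite mulf_eq0 (negPf (disk_area_neq0 ltr01)) orbF => /eqP H0.
have n1 : (n.+1%:R : R[i]) != 0 by rewrite pnatr_eq0.
have n2 : ((n + m).+1%:R : R[i]) != 0 by rewrite pnatr_eq0.
have -> : n.+1%:R * a (n + m)%N + (n + m).+1%:R * lower_coef a n =
  n.+1%:R * (n + m).+1%:R * (a (n + m)%N / (n + m).+1%:R + lower_coef a n / n.+1%:R).
  by move: n1 n2; move: (n.+1%:R) ((n + m).+1%:R) => x y x0 y0; field; rewrite x0.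
by rewrite H0 mulr0.
Qed.

(** [moment r (n + m)] exceeds [moment r n] by the power [r ^+ (2 * m)], which the weight cancels;
    each pairing with a monomial is then a multiple of the recurrence, and [g] is expanded uniformly
    on the smaller disk. *)
Lemma rec_disk_orth a f g r : pser a f 1 -> kernel_rec a -> bergman_space g -> 0 < r < 1 ->
  I r (fun p => f (pt p) * weighted_symbol (r%:C ^- (2 * m)) p * (g (pt p))^*%C) = 0.
Proof.
move=> Hf Ha Bg r01; have [r0 r1] := andP r01; have [b Hb] := bergman_pser Bg.
set c := r%:C ^- (2 * m).
have rn0 : (r%:C : R[i]) != 0 by rewrite -cabs_gt0 cabs_real normr_gt0 gt_eqF.
have bG : bmeas r (fun p => f (pt p) * weighted_symbol c p).
  by apply: bmeasM; [exact: pser_bmeas Hf r01|exact: bmeas_weighted_symbol].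
have mD := measurable_pdisk (R := R) r.
(* [pser_int] expands the unconjugated factor, here [g], so the pairing is computed through its
   complex conjugate. *)
have z n : I r (fun p => mono n 0 p * (f (pt p) * weighted_symbol c p)^*%C) = 0.
  transitivity (I r (fun p => (f (pt p) * weighted_symbol c p * (pt p)^*%C ^+ n)^*%C)).
    apply: eq_cint => p _; rewrite /mono expr0 mulr1.
    move: (pt p) (f (pt p) * weighted_symbol c p) => v u.
    by rewrite [RHS]rmorphM [X in _ = _ * X]rmorphXn /= conjcK mulrC.
  rewrite cintJ//; last first.
    by apply/bmeas_cintegrable/bmeasM => //; apply: bmeasX; apply: bmeasJ; exact: bmeas_pt.
  rewrite (weighted_symbol_int _ _ Hf r01) !momentE /c.
  have n1 : (n.+1%:R : R[i]) != 0 by rewrite pnatr_eq0.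
  have n2 : ((n + m).+1%:R : R[i]) != 0 by rewrite pnatr_eq0.
  rewrite [X in X^*%C](_ : _ = r%:C ^+ (2 * n) * (disk_area r)%:C / (n.+1%:R * (n + m).+1%:R) *
    (n.+1%:R * a (n + m)%N + (n + m).+1%:R * lower_coef a n)).
    by rewrite Ha mulr0 conjc0.
  rewrite mulnDr exprD; have := expf_neq0 (2 * m) rn0.
  move: n1 n2; move: (n.+1%:R) ((n + m).+1%:R) (r%:C ^+ (2 * m)) => x y w x0 y0 w0.
  by field; rewrite x0 y0.
have S := pser_int Hb r01 (bmeasJ bG).
have S0 : I r (fun p => g (pt p) * (f (pt p) * weighted_symbol c p)^*%C) = 0.
  apply: (has_sum_unique S); apply: eq_has_sum has_sum0 => n.
  by rewrite z mulr0.
rewrite -[LHS]conjcK -cintJ//; last first.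
  by apply/bmeas_cintegrable/bmeasM => //; apply: bmeasJ; exact: pser_bmeas Hb r01.
rewrite -[RHS]conjc0 -S0; congr (_^*%C); apply: eq_cint => p _.
by rewrite [LHS]rmorphM /= conjcK mulrC.
Qed.

(** The symbol and its perturbation differ by [1 - r ^- (2 * m)] times [conj z ^+ m]. That factor
    tends to 0, while the integral it multiplies converges, its integrand being integrable on the
    full disk. *)
Lemma rec_to_kernel a f : bergman_space f -> pser a f 1 -> kernel_rec a ->
  toeplitz_kernel (symbol m alpha beta) f.
Proof.
move=> Bf Hf Ha; apply/toeplitz_kernelP; split=> // g Bg; rewrite inner_symbolE.
have [b Hb] := bergman_pser Bg.
have mD := measurable_pdisk (R := R).
have ci := kernel_symbol_integrable 1 Bf Bg.
have cJ : cintegrable mu (pdisk 1) (fun p => f (pt p) * (pt p)^*%C ^+ m * (g (pt p))^*%C).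
  have [_ /L2_diskP sf] := Bf; have [_ /L2_diskP sg] := Bg.
  have := sq_integrable_mul (bmeasX m (bmeasJ (bmeas_pt 1))) sf sg.
  by congr cintegrable; apply/funext => p; rewrite mulrAC.
apply: (clim_unique (cint_disk_lim ci)).
have L1 : clim (fun i => (disk_radius i)%:C ^- (2 * m)) (1 : R[i]).
  move=> e e0.
  have X := climX (2 * m) (@clim_disk_radius R).
  have h2 : 0 < (1 / 2 : R) by lra.
  have [N HN] := X _ h2; have [|N' HN'] := X (e / 2); first by rewrite divr_gt0.
  exists (maxn N N') => i; rewrite geq_max => /andP[/HN h1 /HN'].
  rewrite expr1n in h1 *; move: h1; set w := _ ^+ _ => h1 h3.
  have w1 : 1 / 2 < cabs w.
    have := cabs_sub 1 (1 - w); rewrite cabs1 opprB addrCA subrr addr0; lra.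
  have w0 : w != 0 by rewrite -cabs_gt0; lra.
  have -> : 1 - w^-1 = - ((1 - w) / w) by field.
  rewrite cabsN cabsM cabsV ltr_pdivrMr ?cabs_gt0//; nra.
have L2 := climM (climD (clim_cst 1) (climM (clim_cst (-1)) L1)) (cint_disk_lim cJ).
move: L2; rewrite mulr1 subrr mul0r; apply: eq_clim => i.
have r01 := @disk_radius_itv R i; move: (disk_radius i) r01 => r r01.
have bf := pser_bmeas Hf r01; have bg := pser_bmeas Hb r01.
have b1 : bmeas r (fun p => f (pt p) * (pt p)^*%C ^+ m * (g (pt p))^*%C).
  by apply: bmeasM; [apply: bmeasM => //; apply/bmeasX/bmeasJ/bmeas_pt|exact: bmeasJ].
have b2 : bmeas r (fun p => f (pt p) * weighted_symbol (r%:C ^- (2 * m)) p * (g (pt p))^*%C).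
  by apply: bmeasM; [apply: bmeasM => //; exact: bmeas_weighted_symbol|exact: bmeasJ].
rewrite mulN1r -bmeas_cintZ// -[LHS]addr0 -(rec_disk_orth Hf Ha Bg r01) -bmeas_cintD//; last first.
  by apply: bmeasM => //; exact: bmeas_cst.
apply: eq_cint => p _; rewrite /weighted_symbol.
by move: (pt p) ((pt p)^*%C) (f (pt p)) ((g (pt p))^*%C) => v w u x; ring.
Qed.

End KernelRecurrence.

(** * The explicit kernel functions *)

Section ExplicitFactors.
Context {R : realType}.
Variable c : R[i].
Hypothesis c01 : 0 < cabs c < 1.
Implicit Types (w z : R[i]).

(** In the variable [w = z ^+ m]: [Efun] is [G1] without its sign and its factor [z ^+ m.-1], [Bfun]
    is [Efun] times [quad], and [Kfun], the inverse of [Bfun], is the analytic factor of the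
    integrand. *)
Definition den w : R[i] := 1 + c * w.
Definition Efun w : R[i] := cexp (den w)^-1 / den w ^+ 3.
Definition Bfun w : R[i] := cexp (den w)^-1 / den w.
Definition Kfun w : R[i] := den w * cexp (- (den w)^-1).

Lemma c_neq0 : c != 0.
Proof. by rewrite -cabs_gt0; case/andP: c01. Qed.

Lemma den_neq0 w : cabs w * cabs c < 1 -> den w != 0.
Proof.
move=> h; apply/eqP => d0; have : c * w = -1 by rewrite -[RHS]addr0 -d0 /den addKr.
by move=> /(congr1 cabs); rewrite cabsM cabsN cabs1 mulrC => h1; rewrite h1 ltxx in h.
Qed.

Lemma disk_den_neq0 w : cabs w <= 1 -> den w != 0.
Proof.
case/andP: c01 => c0 c1 w1; apply: den_neq0.
by rewrite (le_lt_trans _ c1)// ler_piMl// ltW.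
Qed.

Lemma has_deriv_den w : has_deriv den w c.
Proof.
apply: has_deriv_eq (has_derivD (has_deriv_cst 1 w) (has_derivZ c (has_deriv_id w))).
by rewrite add0r mulr1.
Qed.

Lemma has_deriv_denV w : den w != 0 ->
  has_deriv (fun u => (den u)^-1) w (- c / den w ^+ 2).
Proof. by move=> d0; exact: has_derivV d0 (has_deriv_den w). Qed.

Lemma has_deriv_cexp_den w : den w != 0 ->
  has_deriv (fun u => cexp (den u)^-1) w (cexp (den w)^-1 * (- c / den w ^+ 2)).
Proof.
move=> d0; apply: (has_deriv_comp (f := fun u => (den u)^-1)); last exact: has_deriv_cexp.
exact: has_deriv_denV.
Qed.

(** Substituting [c * w = den w - 1] makes the product telescope. The relation says that
    [w * Bfun w] has derivative [Efun w], which is the differential equation of [G1]. *)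
Lemma has_deriv_Bfun w : den w != 0 ->
  exists2 B', has_deriv Bfun w B' & w * B' = Efun w - Bfun w.
Proof.
move=> d0; set x := cexp (den w)^-1.
exists (x * (- c / den w ^+ 2) + (den w)^-1 * (x * (- c / den w ^+ 2))).
  by apply: has_derivM; [exact: has_deriv_cexp_den|exact: has_deriv_denV].
have cw : c * w = den w - 1 by rewrite /den addrC addKr.
rewrite /Efun /Bfun -/x; move: (den w) x d0 cw => d x d0 cw.
have -> : w * (x * (- c / d ^+ 2) + d^-1 * (x * (- c / d ^+ 2))) =
   - (c * w) * x * (1 / d ^+ 2 + 1 / d ^+ 3) by field.
by rewrite cw; field.
Qed.

Lemma has_deriv_wBfun w : den w != 0 -> has_deriv (fun u => u * Bfun u) w (Efun w).
Proof.
move=> d0; have [B' HB wB] := has_deriv_Bfun d0.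
apply: has_deriv_eq (has_derivM (has_deriv_id w) HB).
by rewrite wB mulr1 subrK.
Qed.

Lemma has_deriv_Efun w : den w != 0 -> exists d, has_deriv Efun w d.
Proof.
move=> d0; eexists; apply: has_derivM; first exact: has_deriv_cexp_den.
apply: has_derivV; first by rewrite expf_neq0.
by apply: (has_deriv_comp (g := fun u => u ^+ 3)); [exact: has_deriv_den|exact: has_derivX].
Qed.

Lemma has_deriv_Kfun w : den w != 0 -> exists d, has_deriv Kfun w d.
Proof.
move=> d0; eexists; apply: has_derivM; first exact: has_deriv_den.
apply: (has_deriv_comp (f := fun u => - (den u)^-1)); last exact: has_deriv_cexp.
by apply: has_derivN; exact: has_deriv_denV.
Qed.

Lemma BKfun w : den w != 0 -> Bfun w * Kfun w = 1.
Proof.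
move=> d0; rewrite /Bfun /Kfun cexpNV.
by move: (cexp _) (cexp_neq0 (den w)^-1) => x x0; field; rewrite x0 d0.
Qed.

Lemma den2_Efun w : den w != 0 -> den w ^+ 2 * Efun w = Bfun w.
Proof. by move=> d0; rewrite /Efun /Bfun; field. Qed.

(** On the closed disk [den] has modulus at least [1 - cabs c], and the real part of its inverse is
    at most the inverse of that. *)
Lemma cabs_Efun w : cabs w <= 1 ->
  cabs (Efun w) <= expR (1 - cabs c)^-1 / (1 - cabs c) ^+ 3.
Proof.
case/andP: c01 => c0 c1 w1.
have d1 : 1 - cabs c <= cabs (den w).
  have := cabs_sub 1 (- (c * w)); rewrite cabs1 cabsN opprK -/(den w).
  apply: le_trans; rewrite lerD2l lerN2 cabsM ler_piMr// ltW//.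
have e0 : 0 < 1 - cabs c by rewrite subr_gt0.
have dp : 0 < cabs (den w) by exact: lt_le_trans d1.
rewrite /Efun cabsM cabsV cabsX cabs_cexp; apply: ler_pM.
- exact: expR_ge0.
- by rewrite invr_ge0 exprn_ge0// cabs_ge0.
- rewrite ler_expR (le_trans (ler_norm _))// (le_trans (cabs_Re _))// cabsV.
  by rewrite lef_pV2// posrE.
- by rewrite lef_pV2 ?posrE ?exprn_gt0// lerXn2r// nnegrE ltW.
Qed.

(** [Kfun] is holomorphic for |w| < 1/|c|, and [rho] is the midpoint of 1 and 1/|c|; the rescaling
    [w = rho v] reduces to expansions on the unit disk. A radius above 1 later yields bounds on the
    closed unit disk. *)
Lemma Kfun_pser : exists2 rho, 1 < rho & exists kappa, pser kappa Kfun rho.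
Proof.
case/andP: c01 => c0 c1; set q := cabs c in c0 c1.
set rho : R := (1 + q^-1) / 2.
have iq : 1 < q^-1 by rewrite invf_gt1.
have [h1 h2] : 1 < rho /\ rho < q^-1 by rewrite /rho !midf_lt.
have rho0 : 0 < rho by exact: lt_trans h1.
have rn0 : rho%:C != 0 :> R[i] by rewrite -cabs_gt0 cabs_real normr_gt0 gt_eqF.
exists rho => //.
have [|a Ha] := @holomorphic_pser R (fun v => Kfun (rho%:C * v)).
  move=> z z1; have [|d Hd] := @has_deriv_Kfun (rho%:C * z).
    apply: den_neq0; rewrite cabsM cabs_real gtr0_norm// -/q.
    rewrite -ltr_pdivlMr// mul1r; apply: le_lt_trans h2.
    by rewrite ler_piMr// ltW.
  exists (d * (rho%:C * 1)).
  apply: (has_deriv_comp (f := fun v => rho%:C * v)) => //.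
  exact: has_derivZ (has_deriv_id z).
exists (fun k => a k / rho%:C ^+ k) => w wr.
have := Ha (w / rho%:C); rewrite mulrCA divff// mulr1 cabsM cabsV cabs_real gtr0_norm//.
rewrite ltr_pdivrMr// mul1r => /(_ wr); apply: eq_has_sum => k.
by rewrite expr_div_n mulrAC mulrA.
Qed.

(** The integrated exponents are never 0: the Laurent expansion has no term of degree -1. *)
Lemma mul_sub_neq0 (m p k : nat) : (0 < p < m)%N -> (k * m)%:Z - p%:Z != 0 :> int.
Proof.
case/andP => p0 pm; rewrite subr_eq0; apply/eqP => -[E].
case: k E => [|k] E; first by rewrite -E in p0.
by rewrite -E mulSn ltnNge leq_addr in pm.
Qed.

(* The termwise primitive of [w ^ (-p/m) K(w)], in the variable [w = z ^ m]. *)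
Lemma Lfun_exists (kappa : nat -> R[i]) rho m p : 1 < rho -> pser kappa Kfun rho ->
  (0 < p < m)%N ->
  exists L L' : R[i] -> R[i], exists2 rho', 1 < rho' &
  [/\ pser (fun k => kappa k / ((k * m)%:Z - p%:Z)%:~R) L rho',
      (forall w, cabs w < rho' -> has_deriv L w (L' w)) &
      (forall w, cabs w < rho' -> m%:R * (w * L' w) - p%:R * L w = Kfun w)].
Proof.
move=> r1 HK pm; set lam := fun k => kappa k / ((k * m)%:Z - p%:Z)%:~R.
have k0 k : (((k * m)%:Z - p%:Z)%:~R : R[i]) != 0 by rewrite intr_eq0 mul_sub_neq0.
set rho' := (1 + rho) / 2.
have [h1 h2] : 1 < rho' /\ rho' < rho by rewrite /rho' !midf_lt.
have p0 : 0 < rho' by exact: lt_trans h1.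
have [|M M0 HM] := pser_bounded HK (rho := rho'); first by rewrite p0.
(* The divisor is a nonzero integer, of modulus at least 1, so the bound on [kappa] is inherited. *)
have HL k : cabs (lam k) * rho' ^+ k <= M.
  apply: le_trans (HM k); rewrite ler_wpM2r ?exprn_ge0 ?(ltW p0)//.
  rewrite /lam cabsM cabsV ler_piMr ?cabs_ge0//.
  rewrite invf_le1 ?cabs_gt0//.
  have -> : ((k * m)%:Z - p%:Z)%:~R = (((k * m)%:Z - p%:Z)%:~R : R)%:C by rewrite rmorph_int.
  by rewrite cabs_real -intr_norm ler1z -gtz0_ge1 normr_gt0 mul_sub_neq0.
have [L HLs] := pser_exists p0 HL; have [L' HL' DL] := pser_deriv HLs.
exists L, L', rho' => //; split => // w wr.
apply: (has_sum_unique (u := fun k => kappa k * w ^+ k)); last exact: HK (lt_trans wr h2).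
have S1 := has_sumZ m%:R (pser_shift HL' wr); have S2 := has_sumZ p%:R (HLs w wr).
apply: eq_has_sum (has_sumB S1 S2) => k.
have -> : (if k is k'.+1 then deriv_coef lam k' else 0) = k%:R * lam k.
  by case: k => [|k]//; rewrite mul0r.
(* The differential equation for [L] is this identity, coefficient by coefficient. *)
have Q : kappa k = lam k * (m%:R * k%:R - p%:R).
  have -> : (m%:R * k%:R - p%:R : R[i]) = ((k * m)%:Z - p%:Z)%:~R.
    by rewrite intrD rmorphN /= -!pmulrn natrM mulrC.
  by rewrite /lam divfK.
rewrite Q; move: (lam k) (w ^+ k) => x y; ring.
Qed.

End ExplicitFactors.

(** * From the first-order differential equation to the recurrence *)

Section FirstOrderODE.
Context {R : realType}.
Variables (m : nat) (alpha beta : R[i]).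

(* [z (z^m-quadratic) f] has derivative [m f] up to a monomial of low degree;
   comparing coefficients turns this into the kernel recurrence. *)
Lemma ode_coef (a : nat -> R[i]) (f : R[i] -> R[i]) (e : R[i]) (l : nat) : (l < m)%N ->
  pser a f 1 ->
  (forall z, cabs z < 1 ->
     has_deriv (fun u => u * quad m alpha beta u * f u) z (m%:R * f z - e * z ^+ l)) ->
  kernel_rec m alpha beta a /\
  (forall n, (n < m)%N -> (n.+1%:R - m%:R) * a n = if n == l then - e else 0).
Proof.
move=> lm Ha D.
have U := pser_shift (pserD (pserD Ha (pserZ beta (pser_Xn m Ha))) (pserZ alpha (pser_Xn (2 * m) Ha))).
have {}U : pser (fun n => if n is n'.+1 then a n' + beta * (if (m <= n')%N then a (n' - m)%N else 0)
     + alpha * (if (2 * m <= n')%N then a (n' - 2 * m)%N else 0) else 0)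
   (fun u => u * quad m alpha beta u * f u) 1.
  by apply: eq_pser U => // z _; rewrite /quad; ring.
have W := pser_deriv_eq U D; have V := pserB (pserZ m%:R Ha) (@pser_monomial _ e l 1).
have E := pser_unique ltr01 W V.
have {}E n : n.+1%:R * (a n + beta * (if (m <= n)%N then a (n - m)%N else 0)
     + alpha * (if (2 * m <= n)%N then a (n - 2 * m)%N else 0)) =
   m%:R * a n - (if n == l then e else 0) by rewrite -E.
split=> n.
  (* The index [n + m] exceeds [l], so [e] is absent, and the factor [(n + m).+1 - m] of [a (n + m)]
     is [n.+1]. *)
  have := E (n + m)%N; rewrite leq_addl addnK gtn_eqF; last by rewrite (leq_trans lm)// leq_addl.
  rewrite mul2n -addnn leq_add2r subnDr subr0 /lower_coef => H.
  have -> : n.+1%:R * a (n + m)%N = (n + m).+1%:R * a (n + m)%N - m%:R * a (n + m)%N.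
    by rewrite -mulrBl; congr (_ * _); rewrite -addSn natrD addrK.
  have -> : (if (m <= n)%N then alpha * a (n - m)%N else 0) =
      alpha * (if (m <= n)%N then a (n - m)%N else 0) by case: ifP; rewrite ?mulr0.
  rewrite -H -mulrBr -mulrDr [X in _ * X](_ : _ = 0) ?mulr0//.
  by move: (a (n + m)%N) (a n) (if (m <= n)%N then _ else _) => u v w; ring.
move=> nm; have h1 : (m <= n)%N = false by rewrite leqNgt nm.
have h2 : (2 * m <= n)%N = false.
  by rewrite leqNgt (leq_trans nm)// leq_pmull.
have := E n; rewrite h1 h2 !mulr0 !addr0 => H.
by rewrite mulrBl H addrAC subrr add0r; case: ifP; rewrite ?oppr0.
Qed.

End FirstOrderODE.

(** At index [n - m] the recurrence yields [a n] from earlier values, its leading factor being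
    nonzero. *)
Lemma kernel_rec_eq0 (R : realType) m (alpha beta : R[i]) (a : nat -> R[i]) :
  (1 <= m)%N -> kernel_rec m alpha beta a -> (forall n, (n < m)%N -> a n = 0) ->
  forall n, a n = 0.
Proof.
move=> m1 rec a0 n; have [k] := ubnP n; elim: k n => // k IH n; rewrite ltnS => nk.
have [/a0//|mn] := ltnP n m.
have := rec (n - m)%N; rewrite subnK// /lower_coef.
have nmn : (n - m < n)%N by rewrite ltn_subrL m1 (leq_trans m1).
rewrite (IH (n - m)%N) ?(leq_trans nmn)// mulr0 add0r.
rewrite [if _ then _ else _](_ : _ = 0); last first.
  by case: ifP => // _; rewrite IH ?mulr0// (leq_trans _ nk)// (leq_ltn_trans (leq_subr _ _)).
by rewrite mulr0 addr0 => /eqP; rewrite mulf_eq0 pnatr_eq0 => /eqP.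
Qed.

(** * The functions h_j: closed forms, bounds and first coefficients *)

Section KernelFunctionFacts.
Context {R : realType}.
Variables (m : nat) (alpha beta z0 c s : R[i]) (S : R[i] -> R[i]).
Hypothesis m1 : (1 <= m)%N.
Hypothesis c01 : 0 < cabs c < 1.
Hypothesis alphaE : alpha = c ^+ 2.
Hypothesis betaE : beta = 2 * c.
Hypothesis z0E : z0 ^+ m = - (beta / (2 * alpha)).
Implicit Types (z w t : R[i]).

Local Notation quadf := (quad m alpha beta).
Local Notation D z := (den c (z ^+ m)).

Lemma quadE z : quadf z = D z ^+ 2.
Proof. by rewrite /quad /den alphaE betaE mulnC exprM; ring. Qed.

Lemma pow_le1 z n : cabs z < 1 -> cabs (z ^+ n) <= 1.
Proof. by move=> /ltW z1; rewrite cabsX exprn_ile1 ?cabs_ge0. Qed.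

Lemma pow_lt1 z : cabs z < 1 -> cabs (z ^+ m) < 1.
Proof. by move=> z1; rewrite cabsX exprn_ilt1 ?cabs_ge0// -lt0n. Qed.

Lemma D_neq0 z : cabs z < 1 -> D z != 0.
Proof. by move=> z1; apply: disk_den_neq0 => //; exact: pow_le1. Qed.

Lemma has_deriv_pow_comp f z d : has_deriv f (z ^+ m) d ->
  has_deriv (fun u => f (u ^+ m)) z (d * (m%:R * z ^+ m.-1)).
Proof. by move=> H; apply: (has_deriv_comp (f := fun u => u ^+ m)) => //; exact: has_derivX. Qed.

(** [S / den ^ 3] squares to 1. A change of sign between 0 and z would force its real part through 0
    along the segment, by the intermediate value theorem. *)
Lemma branch_sign : branch_pow32 quadf S ->
  exists s, s * s = 1 /\ forall z, cabs z < 1 -> S z = s * D z ^+ 3.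
Proof.
move=> [/holomorphic_on_diskP HS S2].
pose T z := S z / D z ^+ 3.
have T2 z : cabs z < 1 -> T z = 1 \/ T z = -1.
  move=> z1; have d0 := D_neq0 z1.
  have : (T z - 1) * (T z + 1) = 0.
    have -> : (T z - 1) * (T z + 1) = (S z ^+ 2 - quadf z ^+ 3) / (D z ^+ 3) ^+ 2.
      by rewrite /T quadE; field.
    by rewrite S2 ?subrr ?mul0r//; apply/unit_diskE.
  move=> /eqP; rewrite mulf_eq0 subr_eq0 addr_eq0 => /orP[] /eqP; by [left|right].
have HT z : cabs z < 1 -> exists d, has_deriv T z d.
  move=> z1; have [d Hd] := HS z z1; eexists; apply: has_derivM; first exact: Hd.
  apply: has_derivV; first by rewrite expf_neq0// D_neq0.
  apply: (has_deriv_comp (g := fun u => u ^+ 3)); last exact: has_derivX.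
  by apply: has_deriv_pow_comp; exact: has_deriv_den.
have o1 : cabs (0 : R[i]) < 1 by rewrite cabs0.
exists (T 0); split.
  by case: (T2 0 o1) => ->; rewrite ?mulrNN mulr1.
move=> z z1; suff -> : T 0 = T z by rewrite divfK// expf_neq0// D_neq0.
have seg (t : R) : 0 <= t <= 1 -> cabs ((t +i* 0) * z) < 1.
  move=> /andP[t0 t1]; rewrite cabsM (_ : (t +i* 0) = t%:C)// cabs_real ger0_norm//.
  by rewrite (le_lt_trans _ z1)// ler_piMl// cabs_ge0.
have ct : cont_on 0 1 (fun t : R => T ((t +i* 0) * z)).
  apply: (@cont_on_hor _ (fun u => T (u * z))) => t t01.
  have [d Hd] := HT _ (seg t t01); exists (d * (z * 1)).
  apply: (has_deriv_comp (f := fun u => u * z)) => //.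
  by have := has_derivZ z (has_deriv_id (t +i* 0)); under eq_fun do rewrite mulrC.
have cRe := cont_on_within dist_Re ct.
have E0 : T ((0 +i* 0) * z) = T 0 by rewrite (_ : (0 +i* 0) = 0)// mul0r.
have E1 : T ((1 +i* 0) * z) = T z by rewrite (_ : (1 +i* 0) = 1)// mul1r.
have nz v : Num.min (Re (T 0)) (Re (T z)) <= v <= Num.max (Re (T 0)) (Re (T z)) -> v != 0.
  move=> hv; apply/eqP => v0.
  have := IVT ler01 cRe; rewrite E0 E1 => /(_ _ hv)[t]; rewrite in_itv /= => t01.
  by case: (T2 _ (seg t t01)) => ->; rewrite v0 /= => /eqP; rewrite ?oppr_eq0 oner_eq0.
case: (T2 0 o1) => t0; case: (T2 z z1) => t1; rewrite t0 t1 //; exfalso;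
  have := nz 0; rewrite t0 t1 /= eqxx; move=> /(_ _)/negP; apply=> //;
  by rewrite ge_min le_max ?lerN10 ?ler01 ?orbT.
Qed.

Hypothesis ss : s * s = 1.
Hypothesis SE : forall z, cabs z < 1 -> S z = s * D z ^+ 3.

Local Notation h j := (hfun m alpha beta z0 S j).

Lemma s_neq0 : s != 0.
Proof. by apply/eqP => s0; move: ss; rewrite s0 mul0r => /eqP; rewrite eq_sym oner_eq0. Qed.

Lemma G1E z : cabs z < 1 -> G1 m alpha beta z0 S z = s * (z ^+ m.-1 * Efun c (z ^+ m)).
Proof.
move=> z1; have d0 := D_neq0 z1; have c0 := c_neq0 c01.
have sV : s^-1 = s by apply: (mulfI s_neq0); rewrite mulfV ?ss// s_neq0.
rewrite /G1 SE// subn1 /Efun.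
have -> : beta / (2 * alpha) * (1 / (z ^+ m - z0 ^+ m)) = (D z)^-1.
  have E : z ^+ m - z0 ^+ m = D z / c.
    rewrite z0E opprK alphaE betaE /den; field; exact: c0.
  rewrite E alphaE betaE; move: (D z) d0 => d d0; field; by rewrite c0 d0.
by rewrite invfM sV; move: (cexp _) => x; ring.
Qed.

Lemma near_disk_deriv f g z d : cabs z < 1 -> (forall w, cabs w < 1 -> f w = g w) ->
  has_deriv f z d -> has_deriv g z d.
Proof.
move=> z1 fg; apply: (near_has_deriv (r := 1 - cabs z)); first by rewrite subr_gt0.
move=> w wz; apply: fg; have := cabs_sub w z; lra.
Qed.

(** [z * quad z * h 1 z] is [s * (w * Bfun w)] at [w = z ^+ m], with derivative [m%:R * h 1 z]: the
    equation with [e = 0]. *)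
Lemma first_function : exists a, [/\ pser a (h 1) 1, kernel_rec m alpha beta a,
  (exists M, forall z, cabs z < 1 -> cabs (h 1 z) <= M) &
  (forall n, (n < m)%N -> (n.+1 == m) = false -> a n = 0) /\ a m.-1 != 0].
Proof.
have hE z : cabs z < 1 -> s * (z ^+ m.-1 * Efun c (z ^+ m)) = h 1 z.
  by move=> z1; rewrite /hfun eqxx G1E.
have Hd z : cabs z < 1 -> exists d, has_deriv (h 1) z d.
  move=> z1; have [d Hd] := has_deriv_Efun (D_neq0 z1); eexists.
  apply: near_disk_deriv hE _ => //.
  by apply: has_derivZ; apply: has_derivM; [exact: has_derivX|exact: has_deriv_pow_comp Hd].
have [a Ha] := holomorphic_pser Hd; exists a.
have ode z : cabs z < 1 -> has_deriv (fun u => u * quadf u * h 1 u) z (m%:R * h 1 z - 0 * z ^+ 0).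
  move=> z1; rewrite mul0r subr0.
  apply: (@near_disk_deriv (fun u => s * (u ^+ m * Bfun c (u ^+ m)))) => //.
    move=> w w1; rewrite -hE// quadE -den2_Efun ?D_neq0//.
    have -> : w ^+ m = w * w ^+ m.-1 by rewrite -exprS prednK.
    by move: (den c _) (Efun c _) => x y; ring.
  rewrite -hE//; have := has_derivZ s (has_deriv_pow_comp (has_deriv_wBfun (D_neq0 z1))).
  by apply: has_deriv_eq; ring.
have [rec low] := ode_coef m1 Ha ode.
have low0 n : (n < m)%N -> (n.+1 == m) = false -> a n = 0.
  move=> nm nm1; have := low n nm; rewrite oppr0 if_same => /eqP.
  by rewrite mulf_eq0 subr_eq0 eqr_nat nm1 => /eqP.
have bound : exists M, forall z, cabs z < 1 -> cabs (h 1 z) <= M.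
  exists (cabs s * (1 * (expR (1 - cabs c)^-1 / (1 - cabs c) ^+ 3))) => z z1.
  rewrite -hE// cabsM [cabs (_ * Efun _ _)]cabsM.
  apply: ler_wpM2l; first exact: cabs_ge0.
  apply: ler_pM; [exact: cabs_ge0|exact: cabs_ge0|exact: pow_le1|].
  by apply: cabs_Efun => //; exact: pow_le1.
(* At index [m.-1] the factor [n.+1 - m] is 0 and the equation is silent; a zero coefficient there
   would make all of them vanish, against [h 1] being nonzero at 1/2. *)
split => //; split => //; apply/eqP => am.
have a0 n : a n = 0.
  apply: (kernel_rec_eq0 m1 rec) => {}n nm.
  have [n1|n1] := eqVneq n.+1 m; last by apply: low0 => //; exact: negbTE.
  by rewrite -am -n1.
pose x : R[i] := (1 / 2)%:C.
have x1 : cabs x < 1 by rewrite /x cabs_real ger0_norm; lra.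
have x0 : x != 0 by rewrite /x -cabs_gt0 cabs_real ger0_norm; lra.
have : h 1 x = 0.
  apply: (has_sum_unique (Ha x x1)); apply: eq_has_sum has_sum0 => n.
  by rewrite a0 mul0r.
apply/eqP; rewrite -hE//; apply: mulf_neq0; first exact: s_neq0.
apply: mulf_neq0; first exact: expf_neq0.
apply: mulf_neq0; first exact: cexp_neq0.
by rewrite invr_eq0 expf_neq0// D_neq0.
Qed.

Section HigherFunctions.
Variable i : nat.
Hypothesis im : (0 < i < m)%N.
(** Here [i] is j - 1, so the integrated exponents j - 1 - m + k m are [k * m - p]. *)
Let p := (m - i)%N.

Lemma p_itv : (0 < p < m)%N.
Proof. by case/andP: im => i0 im'; rewrite /p subn_gt0 im' ltn_subrL i0. Qed.

Lemma integrandE t : cabs t < 1 -> t != 0 ->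
  integrand m alpha beta z0 S i.+1 t = t ^+ i.-1 / t ^+ m * (s * Kfun c (t ^+ m)).
Proof.
move=> t1 t0; have d0 := D_neq0 t1.
have sV : s^-1 = s by apply: (mulfI s_neq0); rewrite mulfV ?ss// s_neq0.
have tm : t ^+ m = t * t ^+ m.-1 by rewrite -exprS prednK.
have tm0 : t ^+ m.-1 != 0 by rewrite expf_neq0.
rewrite /integrand G1E// quadE subSS subn1 /Efun /Kfun cexpNV.
move: (cexp _) (cexp_neq0 (D t)^-1) d0 => x x0; move: (den c (t ^+ m)) => d d0.
rewrite tm -{2}sV; move: (t ^+ m.-1) (t ^+ i.-1) tm0 => u v u0.
by field; rewrite t0 u0 d0 x0 s_neq0.
Qed.

Lemma exponentE t k : t != 0 ->
  t ^ (integrand_exp m i.+1 k) = t ^+ i.-1 / t ^+ m * (t ^+ m) ^+ k.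
Proof.
move=> t0; have i0 : (0 < i)%N by case/andP: im.
have -> : integrand_exp m i.+1 k = i.-1%:Z - m%:Z + (k * m)%:Z.
  rewrite /integrand_exp -{1}(prednK i0) -[X in X - _ - _]/(Posz _.+2) PoszM.
  by rewrite -[i.-1.+2]addn2 PoszD addrK.
by rewrite !expfzDr// -exprnN -!exprnP mulnC exprM.
Qed.

Lemma exponent_succ k : integrand_exp m i.+1 k + 1 = (k * m)%:Z - p%:Z.
Proof.
have /andP[i0 /ltnW im'] := im.
rewrite /integrand_exp /p -subzn// PoszM -[i.+1]addn1 PoszD.
by move: (Posz i) (Posz m) (Posz k) => a b d; ring.
Qed.

(** [laurent_coef] is a choice, pinned down by uniqueness: divided by [t ^+ i.-1 / t ^+ m], two
    expansions become power series in [w = t ^+ m] with equal sums for all nonzero w in the disk. *)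
Lemma laurent_coefE kappa rho : 1 < rho -> pser kappa (Kfun c) rho ->
  forall k, laurent_coef (integrand_exp m i.+1) (integrand m alpha beta z0 S i.+1) k = s * kappa k.
Proof.
move=> r1 HK.
have HK1 w : cabs w < 1 -> has_sum (fun k => (s * kappa k) * w ^+ k) (s * Kfun c w).
  move=> w1; apply: eq_has_sum (has_sumZ s (HK w (lt_trans w1 r1))) => k.
  by rewrite mulrA.
have L : is_laurent (integrand_exp m i.+1) (integrand m alpha beta z0 S i.+1)
    (fun k => s * kappa k).
  move=> t /unit_diskE t1 t0; apply/has_sumP; rewrite integrandE//.
  apply: eq_has_sum (has_sumZ _ (HK1 _ (pow_lt1 t1))) => k.
  by rewrite exponentE// mulrCA.
have := xgetI (fun=> 0) L; rewrite -/(laurent_coef _ _); set b := laurent_coef _ _ => Lb k.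
apply/eqP; rewrite -subr_eq0; apply/eqP.
apply: (pser0_coef (a := fun k => b k - s * kappa k) ltr01) => w w0 w1.
(* An m-th root of w exists in [R[i]], so the values [t ^+ m] exhaust the punctured disk. *)
pose t := m.-root w.
have tw : t ^+ m = w by rewrite rootCK.
have t0 : t != 0 by apply: contraNneq w0 => t0; rewrite -tw t0 expr0n gtn_eqF.
have t1 : cabs t < 1.
  rewrite ltNge; apply/negP => t1; move: w1; rewrite -tw cabsX ltNge => /negP; apply.
  exact: exprn_ege1.
have /has_sumP := Lb t (proj2 (unit_diskE t) t1) t0; rewrite integrandE// => H.
have u0 : t ^+ i.-1 / t ^+ m != 0 by rewrite mulf_neq0 ?invr_eq0 ?expf_neq0.
have := has_sumZ (t ^+ i.-1 / t ^+ m)^-1 H; rewrite mulKf// tw => H1.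
have := has_sumB H1 (HK1 w w1); rewrite subrr; apply: eq_has_sum => j.
rewrite exponentE// tw mulrBl; congr (_ - _).
by rewrite mulrCA mulKf// -tw.
Qed.

(** [z * quad z * h i.+1 z] is [- z ^+ i * Bfun w * L w] at [w = z ^+ m]. The relations
    [w B' = E - B], [m w L' - p L = K] and [B K = 1], with i + p = m, turn its derivative into
    [m h - z ^+ i.-1]: the equation with [e = 1]. *)
Lemma higher_function : exists a, [/\ pser a (h i.+1) 1, kernel_rec m alpha beta a,
  (exists M, forall z, cabs z < 1 -> cabs (h i.+1 z) <= M) &
  (forall n, (n < m)%N -> (n.+1 == m) = false -> n != i.-1 -> a n = 0) /\ a i.-1 != 0].
Proof.
have /andP[i0 im'] := im.
have [rho r1 [kappa HK]] := Kfun_pser c01.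
have [L [L' [rho' r1' [HL DL KL]]]] := Lfun_exists r1 HK p_itv.
(* The pole [z ^+ i / z ^+ m] of the integral is absorbed by the factor [z ^+ m.-1] of [G1], and the
   signs cancel as [s * s = 1]; [H] is thus regular at 0. *)
pose H z := - (z ^+ i.-1 * (Efun c (z ^+ m) * L (z ^+ m))).
have pl w : cabs w <= 1 -> cabs w < rho' by move=> w1; exact: le_lt_trans r1'.
have T z : cabs z < 1 -> z != 0 ->
    termwise_int (integrand_exp m i.+1) (integrand m alpha beta z0 S i.+1) z =
    z ^+ i / z ^+ m * (s * L (z ^+ m)).
  move=> z1 zn0; apply: (cvg_lim (T := R[i]^o)); first exact: norm_hausdorff.
  apply/has_sumP; have := has_sumZ (z ^+ i / z ^+ m) (has_sumZ s (HL _ (pl _ (pow_le1 m z1)))).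
  apply: eq_has_sum => k; rewrite (laurent_coefE r1 HK) exponent_succ.
  have -> : z ^ ((k * m)%:Z - p%:Z) = z ^+ i / z ^+ m * (z ^+ m) ^+ k.
    rewrite -exponent_succ expfzDr// exponentE// expr1z -{2}(prednK i0) exprS.
    by ring.
  by move: (kappa k) (_%:~R^-1) => u v; ring.
have hH z : cabs z < 1 -> z != 0 ->
    - G1 m alpha beta z0 S z *
      termwise_int (integrand_exp m i.+1) (integrand m alpha beta z0 S i.+1) z = H z.
  move=> z1 zn0; rewrite T// G1E// /H.
  have zm : z ^+ m = z * z ^+ m.-1 by rewrite -exprS prednK.
  have zi : z ^+ i = z * z ^+ i.-1 by rewrite -exprS prednK.
  have zm0 : z ^+ m.-1 != 0 by rewrite expf_neq0.
  move: (Efun _ _) (L _) => x y; rewrite zm zi.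
  move: (z ^+ m.-1) (z ^+ i.-1) zm0 => u v u0.
  have -> : - (s * (u * x)) * (z * v / (z * u) * (s * y)) = - (v * (x * y)) * (s * s).
    by field; rewrite zn0 u0.
  by rewrite ss mulr1.
have DH z : cabs z < 1 -> exists d, has_deriv H z d.
  move=> z1; have [d Hd] := has_deriv_Efun (D_neq0 z1); eexists.
  apply: has_derivN; apply: has_derivM; first exact: has_derivX.
  apply: has_derivM; first exact: has_deriv_pow_comp Hd.
  apply: has_deriv_pow_comp; apply: DL; apply: pl; exact: pow_le1.
have hE z : cabs z < 1 -> H z = h i.+1 z.
  move=> z1; rewrite /hfun eqSS (gtn_eqF i0) /extend0.
  have [->|zn0] := eqVneq z 0; last by rewrite hH.
  (* At 0 the value of [extend0] is a limit over the punctured neighbourhood, equal to [H 0] by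
     continuity of [H]. *)
  apply/esym/(cvg_lim (T := R[i]^o)); first exact: norm_hausdorff.
  apply/cvg_cabsP => e e0.
  have [d Hd] := DH 0 ltac:(by rewrite cabs0).
  have [delta delta0 Hdelta] := has_deriv_cont Hd e0.
  apply/nbhs_cabsP; exists (Num.min delta 1); first by rewrite lt_min delta0 ltr01.
  move=> w; rewrite lt_min subr0 => /andP[wd w1] wn0.
  by rewrite hH// cabsB Hdelta// subr0.
have Hd z : cabs z < 1 -> exists d, has_deriv (h i.+1) z d.
  by move=> z1; have [d Hd] := DH z z1; exists d; apply: near_disk_deriv hE Hd.
have [a Ha] := holomorphic_pser Hd; exists a.
have bound : exists M, forall z, cabs z < 1 -> cabs (h i.+1 z) <= M.
  have [|M M0 [q q01 HM]] := pser_uniform HL (r' := 1); first by rewrite ltr01.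
  exists (expR (1 - cabs c)^-1 / (1 - cabs c) ^+ 3 * M) => z z1.
  rewrite -hE// /H cabsN cabsM cabsM -[X in _ <= X]mul1r.
  have w1 := pow_le1 m z1.
  apply: ler_pM; rewrite ?mulr_ge0 ?cabs_ge0 ?pow_le1//.
  apply: ler_pM; rewrite ?cabs_ge0 ?cabs_Efun//.
  by have := HM _ 0%N w1; rewrite big_ord0 subr0 expr0 mulr1.
have ode z : cabs z < 1 -> has_deriv (fun u => u * quadf u * h i.+1 u) z
     (m%:R * h i.+1 z - 1 * z ^+ i.-1).
  move=> z1; rewrite mul1r.
  apply: (@near_disk_deriv (fun u => - (u ^+ i * (Bfun c (u ^+ m) * L (u ^+ m))))) => //.
    move=> w w1; rewrite -hE// quadE -den2_Efun ?D_neq0// /H.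
    have -> : w ^+ i = w * w ^+ i.-1 by rewrite -exprS prednK.
    by move: (den c _) (Efun c _) (L _) => x y v; ring.
  have d0 := D_neq0 z1; have wr := pl _ (pow_le1 m z1).
  have [B' HB wB] := has_deriv_Bfun d0.
  have HD := has_derivN (has_derivM (has_derivX i z)
    (has_derivM (has_deriv_pow_comp HB) (has_deriv_pow_comp (DL _ wr)))).
  apply: has_deriv_eq HD; rewrite -hE// /H.
  have wL := KL _ wr; have BK := BKfun d0.
  have zm : z ^+ m = z * z ^+ m.-1 by rewrite -exprS prednK.
  have zi : z ^+ i = z * z ^+ i.-1 by rewrite -exprS prednK.
  have mp : (m%:R : R[i]) = p%:R + i%:R by rewrite -natrD /p subnK// ltnW.
  (* Rewriting the inhomogeneous term through [Bfun], [L] and [L'] makes the remaining identity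
     polynomial. *)
  have vE : z ^+ i.-1 = z ^+ i.-1 * (Bfun c (z ^+ m) *
      (m%:R * (z ^+ m * L' (z ^+ m)) - p%:R * L (z ^+ m))) by rewrite wL BK mulr1.
  rewrite [X in _ = _ - X]vE zi.
  have wB' : z * z ^+ m.-1 * B' = Efun c (z ^+ m) - Bfun c (z ^+ m) by rewrite -zm.
  have -> : Efun c (z ^+ m) = z * z ^+ m.-1 * B' + Bfun c (z ^+ m) by rewrite wB' subrK.
  move: (Bfun _ _) (L _) (L' _) => x y y'; rewrite zm mp; ring.
have [rec low] := ode_coef (leq_ltn_trans (leq_pred i) im') Ha ode.
split => //; split.
  move=> n nm nm1 ni; have := low n nm; rewrite (negPf ni) => /eqP.
  by rewrite mulf_eq0 subr_eq0 eqr_nat nm1 => /eqP.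
have ip : (i.-1 < m)%N by exact: leq_ltn_trans (leq_pred _) im'.
(* At the pivot the equation reads [(i%:R - m%:R) * a i.-1 = -1]. *)
apply/eqP => a0; have := low _ ip; rewrite a0 mulr0 eqxx => /eqP.
by rewrite eq_sym oppr_eq0 oner_eq0.
Qed.

End HigherFunctions.
End KernelFunctionFacts.

Section KernelRecLinear.
Context {R : realType}.
Variables (m : nat) (alpha beta : R[i]).
Implicit Types (a b : nat -> R[i]).
Local Notation rec := (kernel_rec m alpha beta).

Lemma eq_kernel_rec a b : (forall n, a n = b n) -> rec a -> rec b.
Proof. by move=> /funext ->. Qed.

Lemma kernel_recD a b : rec a -> rec b -> rec (fun n => a n + b n).
Proof.
move=> Ha Hb n; have := Ha n; have := Hb n; rewrite /lower_coef.
have -> : (if (m <= n)%N then alpha * (a (n - m)%N + b (n - m)%N) else 0) =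
    (if (m <= n)%N then alpha * a (n - m)%N else 0) +
    (if (m <= n)%N then alpha * b (n - m)%N else 0).
  by case: ifP => _; rewrite ?mulrDr ?addr0.
move: (if _ then _ else _) (if _ then _ else _) => u v hb ha.
by rewrite -[RHS](addr0 (0 : R[i])) -{1}ha -hb; ring.
Qed.

Lemma kernel_recZ (c : R[i]) a : rec a -> rec (fun n => c * a n).
Proof.
move=> Ha n; have := Ha n; rewrite /lower_coef.
have -> : (if (m <= n)%N then alpha * (c * a (n - m)%N) else 0) =
    c * (if (m <= n)%N then alpha * a (n - m)%N else 0).
  by case: ifP => _; rewrite ?mulr0// mulrCA.
move: (if _ then _ else _) => u ha.
by rewrite -[RHS](mulr0 c) -ha; ring.
Qed.

Lemma kernel_rec_sum k (A : 'I_k -> nat -> R[i]) : (forall i, rec (A i)) ->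
  rec (fun n => \sum_(i < k) A i n).
Proof.
elim: k A => [|k IH] A HA.
  apply: (@eq_kernel_rec (fun=> 0)) => n; first by rewrite big_ord0.
  by rewrite /lower_coef !mulr0 if_same addr0 mulr0 addr0.
apply: eq_kernel_rec (kernel_recD (IH _ (fun i => HA (widen_ord (leqnSn k) i))) (HA ord_max)) => n.
by rewrite big_ord_recr.
Qed.

End KernelRecLinear.

(** * From triangular coefficients to a basis of the kernel *)

Section KernelBasis.
Context {R : realType}.
Variables (m : nat) (alpha beta : R[i]) (h : 'I_m -> R[i] -> R[i]) (A : 'I_m -> nat -> R[i]).
Hypothesis m1 : (1 <= m)%N.
Hypothesis hA : forall i, pser (A i) (h i) 1.
Hypothesis recA : forall i, kernel_rec m alpha beta (A i).
Hypothesis boundh : forall i, exists M, forall z, cabs z < 1 -> cabs (h i z) <= M.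
(* The matrix of the first [m] coefficients is triangular once the row of
   index 0 is moved to the end. *)
Let piv (i : 'I_m) : nat := if (i == 0 :> nat) then m.-1 else i.-1.
Hypothesis pivA : forall i, A i (piv i) != 0.
Hypothesis triA : forall (i : 'I_m) n, (n < m)%N -> n.+1 != m -> n != piv i -> A i n = 0.

Let i0 : 'I_m := Ordinal m1.

Lemma pser_lincomb (c : 'I_m -> R[i]) :
  pser (fun n => \sum_(i < m) c i * A i n) (fun z => \sum_(i < m) c i * h i z) 1.
Proof. by apply: pser_big => i; exact: pserZ. Qed.

(** At an index below [m.-1] the only function with a nonzero coefficient is the one with its pivot
    there. *)
Lemma lincomb_coef (c : 'I_m -> R[i]) (i : 'I_m) : i != i0 ->
  \sum_(k < m) c k * A k i.-1 = c i * A i i.-1.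
Proof.
move=> ii0; have ip : (0 < i)%N by rewrite lt0n; exact: ii0.
have im := ltn_ord i; rewrite (bigD1 i) //= big1 ?addr0// => k ki.
rewrite triA ?mulr0//; first exact: leq_ltn_trans (leq_pred _) im.
  by rewrite prednK// ltn_eqF.
rewrite /piv; case: ifP => [_|/negbT k0].
  by rewrite -eqSS (prednK ip) (prednK m1) ltn_eqF.
by rewrite -eqSS (prednK ip) prednK ?lt0n// eq_sym.
Qed.

Lemma basis_lin_indep : lin_indep_on_disk h.
Proof.
move=> c Hc.
have H0 : pser (fun=> 0) (fun z => \sum_(i < m) c i * h i z) 1.
  move=> z z1; rewrite Hc; last exact/unit_diskE.
  by apply: eq_has_sum has_sum0 => n; rewrite mul0r.
have E n : \sum_(i < m) c i * A i n = 0 := pser_unique ltr01 (pser_lincomb c) H0 n.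
have c0 i : i != i0 -> c i = 0.
  move=> ii0; have := E i.-1; rewrite lincomb_coef// => /eqP.
  have in0 : (i == 0 :> nat) = false by exact: negbTE ii0.
  have := pivA i; rewrite /piv in0.
  by rewrite mulf_eq0 => /negPf -> ; rewrite orbF => /eqP.
move=> i; have [->|/c0//] := eqVneq i i0.
(* With the other coefficients gone, the index [m.-1] isolates [c i0]. *)
have := E m.-1; rewrite (bigD1 i0) //= big1 => [|k /c0 ->]; last by rewrite mul0r.
rewrite addr0 => /eqP; rewrite mulf_eq0; have := pivA i0; rewrite /piv /= => /negPf ->.
by rewrite orbF => /eqP.
Qed.

(** For a kernel element the triangular system is solved explicitly, and the recurrence extends
    agreement of the first m coefficients to all. Conversely a combination of the [h i] is bounded,
    hence in the Bergman space, and inherits the recurrence by linearity. *)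
Lemma basis_span : toeplitz_kernel (symbol m alpha beta) = span_on_disk h.
Proof.
apply/seteqP; split=> f.
  move=> Kf; have /toeplitz_kernelP[Bf _] := Kf.
  have [a Ha] := bergman_pser Bf; have rec := kernel_to_rec Ha Kf.
  (* Below index [m.-1] the system is diagonal, which gives [c1]; [c i0] then corrects the index
     [m.-1] for the contributions of the other functions. *)
  pose c1 (i : 'I_m) := a i.-1 / A i i.-1.
  pose c (i : 'I_m) := if i == i0 then
    (a m.-1 - \sum_(k < m | k != i0) c1 k * A k m.-1) / A i0 m.-1 else c1 i.
  exists c => z /unit_diskE z1.
  apply: (has_sum_unique (Ha z z1)); apply: eq_has_sum (pser_lincomb c z1) => n.
  congr (_ * _); apply/esym/eqP; rewrite -subr_eq0; apply/eqP.
  have rec' : kernel_rec m alpha beta (fun n => a n - \sum_(i < m) c i * A i n).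
    have := kernel_recD rec (kernel_recZ (-1) (kernel_rec_sum (fun i => kernel_recZ (c i) (recA i)))).
    by apply: eq_kernel_rec => k; rewrite mulN1r.
  apply: (kernel_rec_eq0 m1 rec') => {}n nm.
  have [nm1|nm1] := eqVneq n.+1 m.
    have -> : n = m.-1 by rewrite -nm1.
    have p0 : A i0 m.-1 != 0 by have := pivA i0.
    rewrite (bigD1 i0) //= {1}/c eqxx divfK//.
    have -> : \sum_(k < m | k != i0) c k * A k m.-1 = \sum_(k < m | k != i0) c1 k * A k m.-1.
      by apply: eq_bigr => k /negPf k0; rewrite /c k0.
    by rewrite subrK subrr.
  have nm2 : (n.+1 < m)%N by rewrite ltn_neqAle nm1.
  have -> : n = (Ordinal nm2).-1 by [].
  have ci : c (Ordinal nm2) = c1 (Ordinal nm2) by rewrite /c; case: eqP.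
  have p0 : A (Ordinal nm2) (Ordinal nm2).-1 != 0 by have := pivA (Ordinal nm2).
  by rewrite lincomb_coef// ci /c1 divfK// subrr.
move=> [c Hc].
have D z : cabs z < 1 -> exists d, has_deriv f z d.
  move=> z1; have [f' _ Df] := pser_deriv (pser_lincomb c).
  exists (f' z); apply: near_disk_deriv (Df z z1) => // w w1.
  by rewrite Hc//; apply/unit_diskE.
have Pf : pser (fun n => \sum_(i < m) c i * A i n) f 1.
  by apply: eq_pser (pser_lincomb c) => // z z1; rewrite Hc//; apply/unit_diskE.
have [M HM] := choice boundh.
have Bf : bergman_space f.
  apply: (bounded_bergman (M := \sum_(i < m) cabs (c i) * M i)).
    exact/holomorphic_on_diskP.
  move=> z z1; rewrite Hc; last exact/unit_diskE.
  apply: le_trans (cabs_sum _ _ _) _; apply: ler_sum => i _.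
  by rewrite cabsM ler_wpM2l ?cabs_ge0 ?HM.
by apply: rec_to_kernel Bf Pf _; apply: kernel_rec_sum => i; exact: kernel_recZ.
Qed.

End KernelBasis.

Unset Implicit Arguments.

Theorem theorem4p3 (R : realType) (m : nat) (alpha beta z0 : R[i])
    (S : R[i] -> R[i])
    (hm : (1 <= m)%N)
    (hab : beta ^+ 2 = 4 * alpha)
    (hbeta : 0 < `|beta| < 2)
    (hz0 : z0 ^+ m = - (beta / (2 * alpha)))
    (hS : branch_pow32 (quad m alpha beta) S) :
  let h := fun i : 'I_m => hfun m alpha beta z0 S i.+1 in
  lin_indep_on_disk h /\
  toeplitz_kernel (symbol m alpha beta) = span_on_disk h.
Proof.
move=> h; pose c := beta / 2.
have n2 : (2 : R[i]) != 0 by rewrite pnatr_eq0.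
have betaE : beta = 2 * c by rewrite /c mulrC divfK.
have alphaE : alpha = c ^+ 2.
  have n4 : (4 : R[i]) != 0 by rewrite pnatr_eq0.
  by apply: (mulfI n4); rewrite -hab betaE; ring.
have c01 : 0 < cabs c < 1.
  move: hbeta; rewrite cabsE -(rmorph0 (real_complex R)) -(rmorph_nat (real_complex R) 2) !ltcR.
  rewrite /c cabsM cabsV cabs_nat => /andP[b0 b2].
  by rewrite divr_gt0//= ltr_pdivrMr// mul1r.
have [s [ss SE]] := branch_sign c01 alphaE betaE hS.
(* The numbering of [h] starts at 0: index 0 is h_1 with pivot [m.-1], and a positive index i is
   h_(i+1) with pivot [i.-1]. One existential per index lets [choice] select all coefficient
   sequences together. *)
have key (i : 'I_m) : exists a, [/\ pser a (h i) 1, kernel_rec m alpha beta a,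
    (exists M, forall z, cabs z < 1 -> cabs (h i z) <= M),
    a (if (i == 0 :> nat) then m.-1 else i.-1) != 0 &
    forall n, (n < m)%N -> n.+1 != m ->
      n != (if (i == 0 :> nat) then m.-1 else i.-1) -> a n = 0].
  have [i0|i0] := eqVneq (i : nat) 0%N.
    have [a [H1 H2 H3 [H4 H5]]] := first_function hm c01 alphaE betaE hz0 ss SE.
    exists a; split => //; rewrite /h ?i0//.
    by move=> n nm /negPf nm1 _; exact: H4.
  have im : (0 < i < m)%N by rewrite lt0n i0 ltn_ord.
  have [a [H1 H2 H3 [H4 H5]]] := higher_function hm c01 alphaE betaE hz0 ss SE im.
  exists a; split => // n nm /negPf nm1; exact: H4.
have [A HA] := choice key.
split.
  apply: (@basis_lin_indep _ m h A hm); by move=> i; have [] := HA i.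
by apply: (@basis_span _ m alpha beta h A hm) => i; have [] := HA i.
Qed.
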